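(* Let $\Gamma$ be a connected graph with at least two edges. Then there is an isomorphism of non-commutative (tracial) probability spaces $$M(\Gamma)\;\cong\; M\;\oplus\bigoplus_{\{v\in V:\ \delta(v)<1\}}\ \underset{(1-\delta(v))\mu^2(v)}{\mathbb C e^I_v},$$ where $M$ is some $II_1$ factor. (The number under a summand is the trace of the identity of that summand; the summand $M$ carries the remaining trace.)
   Context: Graphs. A graph $\Gamma$ means a finite, weighted, bipartite graph: a finite vertex set $V=V_0\sqcup V_1$ (even and odd vertices), a finite set $E$ of oriented edges with start and finish maps $s,f:E\to V$ and a reversal involution $\xi\mapsto\tilde\xi$ of $E$ interchanging $s$ and $f$, such that $s(\xi)\in V_0\Leftrightarrow f(\xi)\in V_1$, and a weighting $\mu:V\to(0,\infty)$ with $\sum_{v\in V}\mu^2(v)=1$. Multiple edges are allowed. When edges are counted, an oriented edge and its reversal count as one edge. For $v\in V$, $\delta(v)=\sum_{\rho\in E:\,s(\rho)=v}\big(\mu(f(\rho))/\mu(v)\big)^2$. Paths. A path $\xi$ of length $n\ge 0$ is $(v^\xi_0\xrightarrow{\xi_1}v^\xi_1\xrightarrow{\xi_2}\cdots\xrightarrow{\xi_n}v^\xi_n)$ with $\xi_i\in E$ an edge from $v^\xi_{i-1}$ to $v^\xi_i$; $s(\xi)=v^\xi_0$, $f(\xi)=v^\xi_n$; $\xi_{[i,j]}$ is the subpath from $v_i^\xi$ to $v_j^\xi$; $\circ$ is composition and $\tilde\xi$ the reversed path. $P_n(\Gamma)$ is the complex vector space with basis $\{[\xi]:\xi \text{ a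 path of length } n\}$. The algebra $F(\Gamma)=\bigoplus_{n\ge0}P_n(\Gamma)$ has the product $\#$ defined as follows: if $\xi,\eta$ are paths of lengths $m,n$, then $[\xi]\#[\eta]=0$ if $f(\xi)\ne s(\eta)$, and otherwise $[\xi]\#[\eta]=\sum_{k=0}^{\min\{m,n\}}([\xi]\#[\eta])_{m+n-2k}$ with $$([\xi]\#[\eta])_{m+n-2k}=\Big(\prod_{i=1}^k\delta_{\xi_{m+1-i},\widetilde{\eta_i}}\Big)\frac{\mu(f(\xi))}{\mu(v^\xi_{m-k})}\,[\xi_{[0,m-k]}\circ\eta_{[k,n]}]\in P_{m+n-2k}(\Gamma).$$ The involution is the conjugate-linear extension of $[\xi]^*=[\tilde\xi]$, and $t$ is the faithful positive trace that vanishes on $P_n(\Gamma)$, $n\ge1$, with $t([(v)])=\mu^2(v)$. $H(\Gamma)$ is the Hilbert space completion of $F(\Gamma)$ for $\langle x,y\rangle=t(y^*x)$; left multiplication extends to a bounded representation $\lambda:F(\Gamma)\to\mathcal L(H(\Gamma))$, and $M(\Gamma)=\lambda(F(\Gamma))''$, a finite von Neumann algebra with the faithful normal trace extending $t$. The elements $e_v^I$. For $v\in V$ put $c_0=e_v=[(v)]$ and $c_{2n}=\sum_{\rho_1,\dots,\rho_n}\prod_{i=1}^n\frac{\mu(f(\rho_i))}{\mu(v)}\,[\rho_1\circ\tilde\rho_1\circ\cdots\circ\rho_n\circ\tilde\rho_n]$, the sum being over all $\rho_1,\dots,\rho_n\in E$ with $s(\rho_i)=v$. If $\delta(v)<1$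 the series $z_v=\sum_{n\ge0}(-1)^nc_{2n}$ converges in the strong operator topology, and $e_v^I=(1-\delta(v))z_v\in M(\Gamma)$. *)

(* Defs.v *)
From HB Require Import structures.
From mathcomp Require Import all_boot all_order all_algebra.
From mathcomp Require Import complex finmap monalg.
From mathcomp Require Import all_classical all_reals all_analysis.

Set Implicit Arguments.
Unset Strict Implicit.
Unset Printing Implicit Defensive.

Import Order.TTheory GRing.Theory Num.Theory.
Import numFieldNormedType.Exports.

Local Open Scope classical_set_scope.
Local Open Scope complex_scope.
Local Open Scope ring_scope.

(* Norms take their values in R[i].  The form hdot is linear in its first
   argument and conjugate-linear in its second. *)
Record hilbert (R : realType) := Hilbert {
  hsort :> completeNormedModType R[i];
  hdot : {dot hsort for @Num.conj R[i]};
  hdot_norm : forall x : hsort, hdot x x = `|x| ^+ 2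
}.

Section Operators.
Variables (R : realType) (H : hilbert R).
Implicit Types (S T : H -> H) (A : set (H -> H)).

Definition bounded_op : set (H -> H) := [set T | linear T /\ continuous T].

(* The value 0 is only taken when T has no bounded adjoint, hence never for a
   bounded T, by the Riesz representation theorem. *)
Definition adjoint T : H -> H :=
  xget (0 : H -> H) [set S | bounded_op S /\
                             forall x y, hdot H (T x) y = hdot H x (S y)].

Definition commutant A : set (H -> H) :=
  [set T | bounded_op T /\ forall S, A S -> T \o S = S \o T].

Record von_neumann A : Prop := VonNeumann {
  vn_bounded : A `<=` bounded_op;
  vn_adjoint : forall T, A T -> A (adjoint T);
  vn_bicommutant : commutant (commutant A) = A
}.

Definition op_le S T : Prop := forall x, 0 <= hdot H (T x - S x) x.

Definition op_sup A (D : set (H -> H)) T : Prop :=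
  [/\ A T, forall S, D S -> op_le S T
    & forall U, A U -> (forall S, D S -> op_le S U) -> op_le T U].

Definition op_directed (D : set (H -> H)) : Prop :=
  D !=set0 /\
  forall S T, D S -> D T -> exists U, [/\ D U, op_le S U & op_le T U].

Definition normal_on A (tau : (H -> H) -> R[i]) : Prop :=
  forall (D : set (H -> H)) T,
    D `<=` A -> (forall S, D S -> op_le 0 S) -> op_directed D ->
    op_sup A D T -> supremums (tau @` D) (tau T).

Record faithful_normal_tracial_state A (tau : (H -> H) -> R[i]) : Prop :=
  FaithfulNormalTracialState {
  ts_linear : forall (a : R[i]) S T, A S -> A T ->
                tau (a *: S + T) = a * tau S + tau T;
  ts_one : tau idfun = 1;
  ts_pos : forall T, A T -> 0 <= tau (adjoint T \o T);
  ts_faithful : forall T, A T -> tau (adjoint T \o T) = 0 -> T = 0;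
  ts_tracial : forall S T, A S -> A T -> tau (S \o T) = tau (T \o S);
  ts_normal : normal_on A tau
}.

Definition finite_dimensional A : Prop :=
  exists (n : nat) (b : 'I_n -> H -> H),
    forall T, A T -> exists c : 'I_n -> R[i], T = \sum_(j < n) c j *: b j.

(* An infinite-dimensional factor with a faithful normal tracial state. *)
Record II1_factor A (tau : (H -> H) -> R[i]) : Prop := II1Factor {
  II1_von_neumann : von_neumann A;
  II1_center : forall T, A T -> commutant A T ->
                 exists c : R[i], T = c *: (idfun : H -> H);
  II1_infinite : ~ finite_dimensional A;
  II1_trace : faithful_normal_tracial_state A tau
}.

End Operators.

(* The elements of the space are those of ncset, a subset of an ambient vector
   space; the operations are only meaningful on ncset. *)
Record ncps (R : realType) := Ncps {
  nccar :> lmodType R[i];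
  ncset : set nccar;
  ncone : nccar;
  ncmul : nccar -> nccar -> nccar;
  ncstar : nccar -> nccar;
  nctr : nccar -> R[i]
}.

Definition op_ncps (R : realType) (H : hilbert R) (A : set (H -> H))
    (tau : (H -> H) -> R[i]) : ncps R :=
  @Ncps R [the lmodType R[i] of H -> H] A idfun (fun S T => S \o T)
    (@adjoint R H) tau.

(* A (+) (+)_(i : I) C : the identity of the i-th copy of C has trace w i, the
   identity of A has the remaining trace. *)
Definition dsum_ncps (R : realType) (A : ncps R) (I : finType) (w : I -> R) :
    ncps R :=
  @Ncps R [the lmodType R[i] of (A * (I -> R[i]))%type]
    [set x | ncset x.1]
    (ncone A, fun=> 1)
    (fun x y => (ncmul x.1 y.1, fun i => x.2 i * y.2 i))
    (fun x => (ncstar x.1, fun i => Num.conj (x.2 i)))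
    (fun x => (1 - \sum_i w i)%:C * nctr x.1 + \sum_i (w i)%:C * x.2 i).

Record ncps_iso (R : realType) (A B : ncps R) (Phi : A -> B) : Prop :=
  NcpsIso {
  iso_bij : set_bij (@ncset R A) (@ncset R B) Phi;
  iso_linear : forall (a : R[i]) x y, ncset x -> ncset y ->
                 Phi (a *: x + y) = a *: Phi x + Phi y;
  iso_one : Phi (ncone A) = ncone B;
  iso_mul : forall x y, ncset x -> ncset y ->
              Phi (ncmul x y) = ncmul (Phi x) (Phi y);
  iso_star : forall x, ncset x -> Phi (ncstar x) = ncstar (Phi x);
  iso_tr : forall x, ncset x -> nctr (Phi x) = nctr x
}.

Record graph (R : realType) := Graph {
  vertex : finType;
  edge : finType;
  even_vertex : pred vertex;
  src : edge -> vertex;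
  dst : edge -> vertex;
  bar : edge -> edge;
  mu : vertex -> R;
  barK : involutive bar;
  src_bar : forall e, src (bar e) = dst e;
  dst_bar : forall e, dst (bar e) = src e;
  bipartite : forall e, even_vertex (src e) = ~~ even_vertex (dst e);
  mu_gt0 : forall v, 0 < mu v;
  mu_sum : \sum_v mu v ^+ 2 = 1
}.

Section Graphs.
Variables (R : realType) (G : graph R).
Local Notation C := (R[i]).
Local Notation V := (vertex G).
Local Notation E := (edge G).

Definition delta (v : V) : R :=
  \sum_(e : E | src e == v) (mu (dst e) / mu v) ^+ 2.

(* An oriented edge and its reversal count as one edge. *)
Definition nedges : nat := #|[set [set e; bar e]%SET | e : E]%SET|.

Definition graph_connected : Prop :=
  forall u v : V,
    connect [rel a b | [exists e : E, (src e == a) && (dst e == b)]] u v.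

Fixpoint walk (v : V) (s : seq E) : bool :=
  if s is e :: s' then (src e == v) && walk (dst e) s' else true.

(* A path is given by its start and the sequence of its edges. *)
Definition gpath : Type := {p : V * seq E | walk p.1 p.2}.

Definition pstart (p : gpath) : V := (val p).1.
Definition pedges (p : gpath) : seq E := (val p).2.
Definition plen (p : gpath) : nat := size (pedges p).
Definition pvertex (p : gpath) (i : nat) : V :=
  last (pstart p) (map (@dst R G) (take i (pedges p))).
Definition pfinish (p : gpath) : V := pvertex p (plen p).

Definition vpath (v : V) : gpath := exist _ (v, [::]) isT.

(* The direct sum of the spaces P_n: the free vector space on all paths. *)
Definition F : Type := {malg C[gpath]}.

(* [xi] for the path xi starting at v with edges s; 0 if there is none. *)
Definition bas (v : V) (s : seq E) : F :=
  if insub (v, s) is Some p then << p >> else 0.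

(* The i-th factor compares the edges number m-i of p and number i+1 of q,
   which both exist for i < k <= min(m,n).  When this product is not 0, the
   concatenation below is a path. *)
Definition path_mul (p q : gpath) : F :=
  if pfinish p == pstart q then
    \sum_(k < (minn (plen p) (plen q)).+1)
      ((\prod_(i < k) (onth (pedges p) (plen p - i.+1)
                         == omap (@bar R G) (onth (pedges q) i))%:R) *
       (mu (pfinish p) / mu (pvertex p (plen p - k)))%:C)
      *: bas (pstart p) (take (plen p - k) (pedges p) ++ drop k (pedges q))
  else 0.

Definition Fmul (x y : F) : F :=
  \sum_(p <- msupp x) \sum_(q <- msupp y) (x@_p * y@_q) *: path_mul p q.

Definition Fstar (x : F) : F :=
  \sum_(p <- msupp x)
     Num.conj (x@_p) *: bas (pfinish p) (rev (map (@bar R G) (pedges p))).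

Definition Ftr (x : F) : C := \sum_(v : V) (mu v ^+ 2)%:C * x@_(vpath v).

Definition Fone : F := \sum_(v : V) << vpath v >>.

(* c_{2n} at the vertex v, of degree 2n: the tuple r lists rho_1, ..., rho_n. *)
Definition cloop (v : V) (n : nat) : F :=
  \sum_(r : n.-tuple E | all (fun e => src e == v) r)
    (\prod_(e <- r) (mu (dst e) / mu v))%:C
    *: bas v (flatten [seq [:: e; bar e] | e <- r]).

Section Completion.
Variables (H : hilbert R) (iota : {linear F -> H}).

Record hilbert_completion : Prop := HilbertCompletion {
  hc_isometric : forall x y, hdot H (iota x) (iota y) = Ftr (Fmul (Fstar y) x);
  hc_dense : dense (range iota)
}.

(* The bounded extension of the left multiplication by x; it exists for every
   x, so that the default value 0 of xget is not used. *)
Definition lambda (x : F) : H -> H :=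
  xget (0 : H -> H) [set T | bounded_op T /\
                             forall y, T (iota y) = iota (Fmul x y)].

Definition MGamma : set (H -> H) := commutant (commutant (range lambda)).

(* The vector state of 1; it extends Ftr to a faithful normal trace, as
   <x # 1, 1> = Ftr x. *)
Definition MGamma_tr (T : H -> H) : C := hdot H (T (iota Fone)) (iota Fone).

(* (1 - delta v) z_v, where the series z_v is summed in the strong operator
   topology, i.e. pointwise in H. *)
Definition eI (v : V) : H -> H := fun xi =>
  (1 - delta v)%:C *:
    limn (fun m : nat => \sum_(n < m) (-1) ^+ n *: lambda (cloop v n) xi).

End Completion.
End Graphs.

(* Main.v *)
Require Import Defs.
From HB Require Import structures.
From mathcomp Require Import all_boot all_order all_algebra.
From mathcomp Require Import complex finmap monalg.
From mathcomp Require Import all_classical all_reals all_analysis.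
From mathcomp Require Import zify ring lra.
Set Implicit Arguments.
Unset Strict Implicit.
Unset Printing Implicit Defensive.
Import Order.TTheory GRing.Theory Num.Theory.
Import numFieldNormedType.Exports.
Local Open Scope classical_set_scope.
Local Open Scope complex_scope.
Local Open Scope ring_scope.

(* Write rho for the element [rho] of the algebra of an edge rho, and let h be a
   vector of H which is tracial: <x # y, h> = <y # x, h> for all x, y in F(G).
   On loops at v, left multiplication by c_2 is X + X^* + Q and right
   multiplication is Y + Y^* + Q, where X and Y insert a cup at the beginning or
   at the end of a path, X^* X = Y^* Y = delta, and Q kills the trivial path.
   Traciality with respect to c_2 makes <z, h> grow like delta^n along the
   vectors X^n Y^n z when z is orthogonal to the trivial path and to the range
   of X, while these vectors divided by delta^n tend weakly to 0; so <z, h> = 0.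
   Hence h is determined by the numbers <c_{2n}, h> at all vertices.
   Traciality with respect to the edges leaves them one free parameter per
   vertex and a global one; the former vanishes when delta(v) >= 1, again by a
   weak limit.  So h lies in the span of 1 and of the vectors zhat_v = z_v 1 with
   delta(v) < 1.

   All edges annihilate zhat_v, on both sides.  So e_v^I is the orthogonal
   projection onto the line of zhat_v and is central in M(G).  If p denotes
   1 - \sum_v e_v^I, a central element T of M(G) p satisfies T 1 = p T 1, which
   is a multiple of p 1; as 1 is separating, T is a multiple of p.  The algebra
   M(G) p is infinite-dimensional because F(G) is and the e_v^I have rank one. *)

(** * Bounded operators on a Hilbert space *)

(** Right multiplications lie in the commutant of M(G), so T in M(G) is recovered from the single
    vector T 1; for a central T, left and right multiplication by any x agree on T 1. Factoriality
    thus becomes a statement about tracial vectors. The obstacle is that such a vector is only a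
    norm limit of elements of F(G): it has no longest path to start an induction from. Its place is
    taken by bounded sequences of F(G) that become orthogonal to every fixed element. The remaining
    data are alpha_n(v) = <c_{2n}, h> / delta(v)^n. For n >= 1, traciality along an edge a with the
    path a (bar a a)^n shows that alpha_n + alpha_{n+1} vanishes at one end of a if it vanishes at
    the other. With a (c bar c)^n, where c continues a and c is not bar a, it does vanish;
    connectedness and two edges provide such a turn. The path a alone shows that (alpha_0 + alpha_1)
    / mu^2 is the same at all vertices. So the free parameters are this constant and one alpha_1(v)
    per vertex. The vector 1 has alpha = (mu^2, 0, 0, ...) at each vertex, and zhat_v has alpha_n =
    (-1)^n mu^2 at v and 0 elsewhere. *)

Section LinearProp.
Variables (K : ringType) (U V : lmodType K) (f : U -> V).
Hypothesis lf : linear f.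
Lemma linD x y : f (x + y) = f x + f y.
Proof. by have := lf 1 x y; rewrite !scale1r. Qed.
Lemma lin0 : f 0 = 0.
Proof. by apply: (addrI (f 0)); rewrite -linD !addr0. Qed.
Lemma linZ a x : f (a *: x) = a *: f x.
Proof. by have := lf a x 0; rewrite !addr0 lin0 addr0. Qed.
Lemma linN x : f (- x) = - f x.
Proof. by rewrite -scaleN1r linZ scaleN1r. Qed.
Lemma linB x y : f (x - y) = f x - f y.
Proof. by rewrite linD linN. Qed.
Lemma lin_sum I (r : seq I) (P : pred I) (F : I -> U) :
  f (\sum_(i <- r | P i) F i) = \sum_(i <- r | P i) f (F i).
Proof. by apply: (big_morph f linD lin0). Qed.
End LinearProp.

Lemma real_complexE (R : realType) (z : R[i]) :
  z \is Num.real -> z = (complex.Re z)%:C.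
Proof. by move=> /Creal_ReP; rewrite complexRe => ->. Qed.

Section PositiveForms.
Variable C : numClosedFieldType.
Implicit Types a b d t : C.

Lemma conj_ge0 a : 0 <= a -> a^* = a.
Proof. by move=> /ger0_real /CrealP. Qed.

(** The form is real at t = 1, -1 and i; these three equations determine [b']. *)
Lemma psd_herm a b b' d :
  (forall t, 0 <= a + t^* * b + t * b' + t * t^* * d) -> b' = b^*.
Proof.
move=> P.
have rd : a + d + (b + b') = (a + d + (b + b'))^*.
  have := P 1; rewrite conjC1 !mul1r => /conj_ge0 e.
  by rewrite (_ : _ + _ = a + b + b' + d) ?e //; ring.
have rdN : a + d - (b + b') = (a + d - (b + b'))^*.
  have := P (-1); rewrite rmorphN rmorph1 => /conj_ge0 e.
  by rewrite (_ : _ - _ = a + -1 * b + -1 * b' + -1 * -1 * d) ?e //; ring.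
have rdi : a + d + 'i * (b' - b) = (a + d + 'i * (b' - b))^*.
  have := P 'i; rewrite conjCi => /conj_ge0 e.
  rewrite (_ : _ + _ = a + - 'i * b + 'i * b' + 'i * - 'i * d) ?e //.
  by rewrite mulrN -expr2 sqrCi; ring.
move: rd rdN rdi; rewrite !(rmorphD, rmorphB, rmorphN, rmorphM) /= conjCi => rd rdN rdi.
have e1 : b + b' = b^* + b'^*.
  apply: (mulfI (_ : 2 != 0 :> C)); first by rewrite pnatr_eq0.
  transitivity (a + d + (b + b') - (a + d - (b + b'))); first by ring.
  by rewrite rd rdN; ring.
have e0 : a + d = a^* + d^* by move: rd; rewrite -e1 => /addIr.
have e2 : b' - b = b^* - b'^*.
  apply: (mulfI (neq0Ci C)).
  by move: rdi; rewrite e0 => /addrI ->; ring.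
apply: (mulfI (_ : 2 != 0 :> C)); first by rewrite pnatr_eq0.
transitivity ((b + b') + (b' - b)); first by ring.
by rewrite e1 e2; ring.
Qed.

(** Put t = -s b with s real: the form becomes a - 2 s |b|^2 + s^2 |b|^2 d. The coefficients are
    abstract because this serves both for positive operators and, with a = 0, for the variation of a
    functional at its minimum. *)
Lemma psd_cauchy_schwarz a b b' d : 0 <= a -> 0 <= d ->
  (forall t, 0 <= a + t^* * b + t * b' + t * t^* * d) -> `|b| ^+ 2 <= a * d.
Proof.
move=> a0 d0 P; have hb := psd_herm P.
have P' s : s \is Num.real -> 0 <= a - (s *+ 2) * `|b| ^+ 2 + s ^+ 2 * `|b| ^+ 2 * d.
  move=> sr; have := P (- s * b); rewrite hb !rmorphM rmorphN /= (CrealP sr) normCK.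
  set u := (X in 0 <= X -> _); set v := (X in _ -> 0 <= X).
  by rewrite (_ : u = v) // /u /v; ring.
have [->|bn0] := eqVneq b 0; first by rewrite normr0 expr0n /= mulr_ge0.
have b2 : 0 < `|b| ^+ 2 by rewrite exprn_gt0 // normr_gt0.
have [d00|dn0] := eqVneq d 0.
  (* For d = 0 the form is affine in s, and this s makes it -(a + 2) < 0. *)
  have := P' ((a + 1) / (`|b| ^+ 2)) _.
  rewrite d00 !mulr0 addr0 mulrnAl mulfVK ?gt_eqF // => /(_ _).
  have -> : a - (a + 1) *+ 2 = - (a + 2) by ring.
  rewrite oppr_ge0 => /(_ _) h.
  have : a + 2 <= 0 by apply: h; rewrite ger0_real // mulr_ge0 ?addr_ge0 // invr_ge0 ltW.
  by move=> /le_gtF; rewrite ltr_wpDl.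
have dp : 0 < d by rewrite lt_def dn0.
(* The quadratic in s is minimal at 1 / d. *)
have := P' d^-1 _; rewrite ger0_real ?invr_ge0 // => /(_ isT).
rewrite -(pmulr_lge0 _ dp).
set u := (X in 0 <= X -> _); rewrite (_ : u = a * d - `|b| ^+ 2) ?subr_ge0 //.
by rewrite /u; field.
Qed.
End PositiveForms.

Section Hilbert.
Variables (R : realType) (H : hilbert R).
Local Notation C := R[i].
Local Notation ip := (hdot H).
Implicit Types (x y z : H) (a : C).

Lemma ipDl x y z : ip (x + y) z = ip x z + ip y z. Proof. by rewrite linearDl. Qed.
Lemma ipDr x y z : ip x (y + z) = ip x y + ip x z. Proof. by rewrite linearDr. Qed.
Lemma ipNr x y : ip x (- y) = - ip x y. Proof. by rewrite linearNr. Qed.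
Lemma ipBl x y z : ip (x - y) z = ip x z - ip y z. Proof. by rewrite linearBl. Qed.
Lemma ipBr x y z : ip x (y - z) = ip x y - ip x z. Proof. by rewrite linearBr. Qed.
Lemma ip0l x : ip 0 x = 0. Proof. by rewrite linear0l. Qed.
Lemma ip0r x : ip x 0 = 0. Proof. by rewrite linear0r. Qed.
Lemma ipZl a x y : ip (a *: x) y = a * ip x y. Proof. by rewrite linearZl_LR. Qed.
Lemma ipZr a x y : ip x (a *: y) = a^* * ip x y. Proof. by rewrite linearZr_LR. Qed.
Lemma ipC x y : ip y x = (ip x y)^*.
Proof. by rewrite hermC expr0 mul1r. Qed.
Lemma ip_suml I (r : seq I) (P : pred I) (F : I -> H) y :
  ip (\sum_(i <- r | P i) F i) y = \sum_(i <- r | P i) ip (F i) y.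
Proof. by rewrite linear_sumlz. Qed.
Lemma ip_sumr I (r : seq I) (P : pred I) (F : I -> H) y :
  ip y (\sum_(i <- r | P i) F i) = \sum_(i <- r | P i) ip y (F i).
Proof. by rewrite linear_sumr. Qed.
Lemma ip_ge0 x : 0 <= ip x x. Proof. by rewrite hdot_norm exprn_ge0. Qed.
Lemma ip_eq0 x : ip x x = 0 -> x = 0.
Proof. by move/eqP; rewrite hdot_norm sqrf_eq0 normr_eq0 => /eqP. Qed.
Lemma ip_inj x x' : (forall y, ip x y = ip x' y) -> x = x'.
Proof.
by move=> e; apply/subr0_eq/ip_eq0; rewrite ipBl e subrr.
Qed.

Definition op_pos (T : H -> H) := forall x, 0 <= ip (T x) x.

Lemma op_pos_cs T x y : linear T -> op_pos T ->
  `|ip (T x) y| ^+ 2 <= ip (T x) x * ip (T y) y.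
Proof.
move=> lT pT; apply: (@psd_cauchy_schwarz _ _ _ (ip (T y) x)) => // t.
have := pT (x + t *: y); rewrite (linD lT) (linZ lT) !(ipDl, ipDr, ipZl, ipZr).
set u := (X in 0 <= X -> _); set v := (X in _ -> 0 <= X).
by rewrite (_ : u = v) // /u /v; ring.
Qed.

(** Cauchy-Schwarz for the form of [T] at the pair x, T x bounds |T x|^4 by c <T x, x> |T x|^2. It
    turns convergence of <T x, x> into convergence in norm. *)
Lemma op_pos_norm T x (c : C) : linear T -> op_pos T -> 0 <= c ->
  (forall y, ip (T y) y <= c * `|y| ^+ 2) -> `|T x| ^+ 2 <= c * ip (T x) x.
Proof.
move=> lT pT c0 bT.
have [->|Tn0] := eqVneq (T x) 0; first by rewrite normr0 expr0n ip0l mulr0.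
have n0 : 0 < `|T x| ^+ 2 by rewrite exprn_gt0 // normr_gt0.
rewrite -(ler_pM2r n0) -expr2.
have := op_pos_cs x (T x) lT pT; rewrite hdot_norm ger0_norm ?exprn_ge0 //.
move/le_trans; apply.
rewrite [leRHS]mulrAC [leRHS]mulrC; apply: ler_wpM2l => //.
Qed.

Lemma cauchy_schwarz x y : `|ip x y| <= `|x| * `|y|.
Proof.
rewrite -(ler_pXn2r (ltn0Sn 1)) ?nnegrE ?mulr_ge0 // exprMn -!hdot_norm.
by apply: (@op_pos_cs idfun) => // z; apply: ip_ge0.
Qed.

Lemma norm_eps0 (V : normedZmodType C) (v : V) (c : C) : 0 <= c ->
  (forall e : C, 0 < e -> `|v| <= c * e) -> v = 0.
Proof.
move=> c0 h; apply/eqP; rewrite -normr_le0; apply/ler_addgt0Pr => e e0; rewrite add0r.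
have c1 : 0 < c + 1 by rewrite ltr_wpDl.
apply: (le_trans (h (e / (c + 1)) _)); first by rewrite divr_gt0.
by rewrite mulrCA ger_pMr // ler_pdivrMr // mul1r lerDl ler01.
Qed.

Lemma ge0_eps (z : C) :
  (forall e : C, 0 < e -> exists2 w, 0 <= w & `|z - w| <= e) -> 0 <= z.
Proof.
move=> h; suff -> : z = `|z| by [].
apply/subr0_eq/(@norm_eps0 _ _ 2) => // e /h [w w0 hw].
rewrite (_ : z - `|z| = (z - w) + (`|w| - `|z|)); last by rewrite (ger0_norm w0); ring.
apply: (le_trans (ler_normD _ _)); rewrite mulr_natl mulr2n lerD //.
by apply: le_trans hw; rewrite distrC; apply: ler_dist_dist.
Qed.

Lemma dense_approx (D : set H) x (e : C) : dense D -> 0 < e ->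
  exists2 y, D y & `|x - y| < e.
Proof.
move=> dD e0; have [||y [xy Dy]] := dD (ball x e).
- by exists x; apply: ballxx.
- exact: ball_open.
- by exists y => //; rewrite -ball_normE in xy.
Qed.

Lemma dense_ip0 (D : set H) x : dense D -> (forall y, D y -> ip y x = 0) -> x = 0.
Proof.
move=> dD h; apply: (@norm_eps0 _ _ 1) => // e e0; rewrite mul1r.
have [y Dy xy] := dense_approx x dD e0.
have [->|xn0] := eqVneq x 0; first by rewrite normr0 ltW.
have xp : 0 < `|x| by rewrite normr_gt0.
rewrite -(ler_pM2l xp) -expr2 -hdot_norm.
have -> : ip x x = ip (x - y) x by rewrite ipBl (h y Dy) subr0.
rewrite -[leLHS]ger0_norm; last by rewrite ipBl (h y Dy) subr0 ip_ge0.
apply: (le_trans (cauchy_schwarz _ _)); rewrite mulrC ler_wpM2l //; exact: ltW.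
Qed.

Lemma bounded_opP (T : H -> H) : bounded_op T <->
  linear T /\ exists c : C, 0 < c /\ forall x, `|T x| <= c * `|x|.
Proof.
split=> -[lT].
- move=> cT; split=> //.
  pose f : {linear H -> H} := HB.pack T (GRing.isLinear.Build _ _ _ _ T lT).
  have := @continuous_linear_bounded _ _ _ 0 f (cT 0).
  move/linear_boundedP => [M [Mr hM]].
  exists (`|M| + 1); split; first by rewrite ltr_wpDl.
  by apply: hM; rewrite (le_lt_trans (real_ler_norm Mr)) // ltrDl.
- move=> [c [c0 hc]]; split=> //.
  pose f : {linear H -> H} := HB.pack T (GRing.isLinear.Build _ _ _ _ T lT).
  apply: (@bounded_linear_continuous _ _ _ f); apply/linear_boundedP.
  exists c; split; first exact: gtr0_real.
  by move=> r cr x; apply: (le_trans (hc x)); rewrite ler_wpM2r // ltW.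
Qed.

Lemma bounded_lin (T : H -> H) : bounded_op T -> linear T. Proof. by case. Qed.

Lemma bounded_idfun : bounded_op (idfun : H -> H).
Proof. by apply/bounded_opP; split=> //; exists 1; split => // x; rewrite mul1r. Qed.

Lemma bounded_comp (S T : H -> H) : bounded_op S -> bounded_op T -> bounded_op (S \o T).
Proof.
case=> lS cS [lT cT]; split => [a x y|x]; first by rewrite /= lT lS.
by apply: continuous_comp; [exact: cT|exact: cS].
Qed.

Lemma bounded_lincomb a (S T : H -> H) : bounded_op S -> bounded_op T -> bounded_op (a *: S + T).
Proof.
case/bounded_opP => lS [c [c0 hc]] /bounded_opP [lT [d [d0 hd]]]; apply/bounded_opP; split.
  move=> b x y; rewrite !fctE lS lT !scalerDr !scalerA mulrC !addrA; congr (_ + _).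
  by rewrite addrAC.
exists (`|a| * c + d); split; first by rewrite ltr_wpDl // mulr_ge0 // ltW.
move=> x; rewrite !fctE; apply: (le_trans (ler_normD _ _)).
by rewrite normrZ mulrDl -mulrA lerD // ler_wpM2l.
Qed.

Lemma bounded_op0 : bounded_op (0 : H -> H).
Proof.
apply/bounded_opP; split=> [a x y|]; first by rewrite scaler0 addr0.
by exists 1; split => // x; rewrite normr0 mul1r.
Qed.

Lemma cvg_dist_bound (T : Type) (F : set_system T) (FF : ProperFilter F)
    (f : T -> H) (l z : H) (c : C) :
  f @ F --> l -> (\forall t \near F, `|f t - z| <= c) -> `|l - z| <= c.
Proof.
move=> /cvgrPdist_lt fl fz; apply/ler_addgt0Pr => e e0.
have : \forall t \near F, `|f t - z| <= c /\ `|l - f t| < e by near=> t; split; near: t; [|exact: fl].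
move=> /filter_ex [t [h1 h2]].
by rewrite -(subrKA (f t)) (le_trans (ler_normD _ _)) // addrC lerD // ltW.
Unshelve. all: by end_near.
Qed.

Lemma cauchy_net_cvg (T : Type) (F : set_system T) (FF : ProperFilter F) (f : T -> H) :
  (forall e : C, 0 < e -> exists z, \forall t \near F, `|z - f t| < e) -> cvg (f @ F).
Proof.
move=> h; apply/cauchy_cvgP/cauchy_exP => e /h [z hz].
by exists z; rewrite -ball_normE.
Qed.

Lemma ip_cvg_near (T : Type) (F : set_system T) (FF : Filter F) (f : T -> H) (l y : H) (e : C) :
  f @ F --> l -> 0 < e -> \forall t \near F, `|ip l y - ip (f t) y| < e.
Proof.
move=> /cvgrPdist_lt fl e0.
have y1 : 0 < `|y| + 1 by rewrite ltr_wpDl.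
have := fl (e / (`|y| + 1)); rewrite divr_gt0 // => /(_ isT).
apply: filterS => t ht; rewrite -ipBl (le_lt_trans (cauchy_schwarz _ _)) //.
have [->|yn0] := eqVneq y 0; first by rewrite normr0 mulr0.
have yp : 0 < `|y| by rewrite normr_gt0.
by rewrite -ltr_pdivlMr // (lt_le_trans ht) // ler_pM2l // lef_pV2 ?posrE // lerDl.
Qed.

Lemma ip_cvg_eq (T : Type) (F : set_system T) (FF : ProperFilter F) (f : T -> H) (l y : H) (c : C) :
  f @ F --> l -> (\forall t \near F, ip (f t) y = c) -> ip l y = c.
Proof.
move=> fl fc; apply/subr0_eq/(@norm_eps0 _ _ 1) => // e e0; rewrite mul1r.
have [|t [<- /ltW //]] := @filter_ex _ F _ [set t | ip (f t) y = c /\ `|ip l y - ip (f t) y| < e].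
by apply: filterI => //; exact: ip_cvg_near.
Qed.

Lemma ip_cvg_ge0 (T : Type) (F : set_system T) (FF : ProperFilter F) (f : T -> H) (l y : H) (c : C) :
  f @ F --> l -> (\forall t \near F, 0 <= c + ip (f t) y) -> 0 <= c + ip l y.
Proof.
move=> fl fc; apply: ge0_eps => e e0.
have [|t [h1 h2]] := @filter_ex _ F _ [set t | 0 <= c + ip (f t) y /\ `|ip l y - ip (f t) y| < e].
  by apply: filterI => //; exact: ip_cvg_near.
by exists (c + ip (f t) y) => //; rewrite [c + _]addrC addrKA ltW.
Qed.

Lemma bounded_cvg (T : Type) (F : set_system T) (FF : Filter F) (f : T -> H) (l : H) (S : H -> H) :
  bounded_op S -> f @ F --> l -> S \o f @ F --> S l.
Proof. by move=> [_ cS] fl; apply: continuous_cvg => //; exact: cS. Qed.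

Lemma bounded_dense_eq (D : set H) (S T : H -> H) : dense D -> bounded_op S -> bounded_op T ->
  (forall x, D x -> S x = T x) -> S = T.
Proof.
move=> dD bS bT h; apply/funext => x.
have bST := bounded_lincomb (-1) bS bT.
have /bounded_opP [l [c [c0 hc]]] := bST.
apply/esym/subr0_eq/(@norm_eps0 _ _ c); first exact: ltW.
move=> e e0; have [y Dy xy] := dense_approx x dD e0.
have -> : T x - S x = (-1 *: S + T) (x - y).
  rewrite !fctE scaleN1r (linB (bounded_lin bS)) (linB (bounded_lin bT)) (h y Dy).
  by rewrite opprB addrC addrA subrK.
by rewrite (le_trans (hc _)) // ler_wpM2l // ltW.
Qed.
End Hilbert.

Section BoundedOperators.
Variables (R : realType) (H : hilbert R).
Local Notation C := R[i].
Local Notation ip := (hdot H).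

(* The representing vector minimizes |x|^2 - 2 Re (f x). *)
Lemma riesz (f : H -> C) (M : C) : (forall a x y, f (a *: x + y) = a * f x + f y) ->
  0 < M -> (forall x, `|f x| <= M * `|x|) -> exists u, forall x, f x = ip x u.
Proof.
move=> lf M0 bf.
have fD x y : f (x + y) = f x + f y by rewrite -[x in LHS]scale1r lf mul1r.
have f0 : f 0 = 0 by apply: (addrI (f 0)); rewrite -fD !addr0.
have fZ a x : f (a *: x) = a * f x by rewrite -[a *: x]addr0 lf f0 addr0.
pose G x : C := ip x x - (f x + (f x)^*).
pose g x : R := complex.Re (G x).
have Gr x : G x \is Num.real.
  rewrite /G; apply: rpredB; first exact: ger0_real (ip_ge0 x).
  apply/CrealP.
  by rewrite rmorphD /= conjCK addrC.
have GE x : G x = (g x)%:C by exact: real_complexE.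
have Glb x : - M ^+ 2 <= G x.
  rewrite -subr_ge0 opprK; apply: le_trans (_ : (`|x| - M) ^+ 2 <= _).
    by rewrite real_exprn_even_ge0 // rpredB // ?normr_real // gtr0_real.
  rewrite sqrrB /G hdot_norm lerD2r lerD2l lerN2.
  have -> : f x + (f x)^* = `|f x + (f x)^*| + (f x + (f x)^* - `|f x + (f x)^*|) by ring.
  have rf : f x + (f x)^* \is Num.real by apply/CrealP; rewrite rmorphD /= conjCK addrC.
  apply: (@le_trans _ _ `|f x + (f x)^*|); first by rewrite gerDl subr_le0 real_ler_norm.
  by apply: (le_trans (ler_normD _ _)); rewrite norm_conjC mulr2n (mulrC _ M) lerD.
pose S := [set g x | x in [set: H]].
have infS : has_inf S.
  split; first by exists (g 0); exists 0.
  exists (complex.Re (- M ^+ 2)) => _ [x _ <-].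
  by have := Glb x; rewrite lecE => /andP [_].
pose m := inf S.
have mle x : m <= g x by apply: ge_inf; [case: infS|exists x].
pose B (e : R) : set H := [set x | g x < m + e].
have B0 (e : R) : 0 < e -> B e !=set0.
  by move=> e0; have [_ [x _ <-] hx] := inf_adherent e0 infS; exists x.
(* The near-minimizers of [g] form a filter; the representing vector is its limit. *)
pose F := filter_from [set e : R | 0 < e] B.
have FF : ProperFilter F.
  apply: filter_from_proper => [|e e0]; last exact: B0.
  apply: filter_from_filter; first by exists 1 => /=.
  move=> e e' e0 e'0; exists (Num.min e e'); first by rewrite /= lt_min; apply/andP.
  by move=> x; rewrite /B /= -!ltrBlDl lt_min => /andP.
(* Parallelogram identity: the linear part of [G] cancels against the midpoint. *)
have par x y : `|x - y| ^+ 2 = 2 * (G x + G y - 2 * G (2^-1 *: (x + y))).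
  rewrite -hdot_norm /G fZ fD !rmorphM rmorphD /= fmorphV /= conjC_nat.
  rewrite !(ipBl, ipBr, ipZl, ipZr, ipDl, ipDr) fmorphV /= conjC_nat.
  by field.
have ex e : 0 < e -> exists2 e', 0 < e' & forall x y, B e' x -> B e' y -> `|x - y| < e%:C.
  (* If g x and g y are below m + e', then [par] and m <= g z give |x - y|^2 < 4 e'. *)
  move=> e0; exists (e ^+ 2 / 4); first by rewrite divr_gt0 ?exprn_gt0.
  move=> x y Bx By; rewrite -(ltr_pXn2r (ltn0Sn 1)) ?nnegrE ?lecR ?(ltW e0) //.
  rewrite par !GE -[e%:C ^+ 2]rmorphXn /=; set z := 2^-1 *: _.
  have -> : 2 * ((g x)%:C + (g y)%:C - 2 * (g z)%:C) = (2 * (g x + g y - 2 * g z))%:C.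
    by rewrite !(rmorphM, rmorphB, rmorphD, rmorph_nat).
  rewrite ltcR.
  have := mle z.
  by move: Bx By; rewrite /B /=; lra.
have cF : cvg ((id : H -> H) @ F).
  apply: cauchy_net_cvg => e e0.
  have [e'' e''E] : exists e'', e = e''%:C.
    by exists (complex.Re e); apply/real_complexE/gtr0_real.
  move: e0; rewrite e''E ltcR => /ex [e' e'0 h].
  have [z Bz] := B0 _ e'0; exists z; exists e' => // y By; exact: h.
pose u : H := lim (id @ F); exists u => h.
(* Minimality makes G (u + t h) - G u nonnegative for all t. As a form in t its constant term is 0,
   so Cauchy-Schwarz kills the linear term. Below, [G] is evaluated at a near-minimizer y close to
   u, which costs an arbitrarily small error. *)
suff : `|(ip h u - f h)^*| ^+ 2 <= 0 * ip h h.
  rewrite mul0r norm_conjC => n0; apply/esym/subr0_eq/eqP; rewrite -normr_le0.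
  by rewrite -(@ler_pXn2r _ 2) ?nnegrE // expr0n.
have d0 := ip_ge0 h.
apply: (@psd_cauchy_schwarz _ _ _ (ip h u - f h)) => // t; apply: ge0_eps => e e0.
have [e'' e''E] : exists e'', e = e''%:C.
  by exists (complex.Re e); apply/real_complexE/gtr0_real.
have e2 : 0 < e'' / 2 by move: e0; rewrite e''E ltcR => ?; rewrite divr_gt0.
have [y [By hy]] : exists y, B (e'' / 2) y /\ `|ip u (t *: h) - ip y (t *: h)| < (e'' / 4)%:C.
  apply: (@filter_ex _ F); apply: filterI; first by exists (e'' / 2).
  by apply: (@ip_cvg_near _ _ _ _ _ id) cF _; rewrite ltcR; lra.
exists (G (y + t *: h) - G y + (e'' / 2)%:C).
  rewrite !GE -!(rmorphD, rmorphB) lecR; have := mle (y + t *: h); move: By; rewrite /B /=; lra.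
set w := (X in X - _); set a := ip u _ - _ in hy.
have aE : a = t^* * ip u h - t^* * ip y h by rewrite /a !ipZr.
have acE : a^* = t * ip h u - t * ip h y by rewrite /a rmorphB /= -!ipC !ipZl.
have -> : w - (G (y + t *: h) - G y + (e'' / 2)%:C) = a + a^* - (e'' / 2)%:C.
  rewrite /w [(ip h u - f h)^*]rmorphB /= -ipC acE aE /G fD fZ rmorphD rmorphM /=.
  by rewrite !(ipDl, ipDr, ipZl, ipZr); ring.
apply: (le_trans (ler_normB _ _)).
rewrite [X in _ + X]ger0_norm ?lecR ?(ltW e2) //.
apply: (@le_trans _ _ ((e'' / 4)%:C + (e'' / 4)%:C + (e'' / 2)%:C)).
  rewrite lerD2r (le_trans (ler_normD _ _)) // norm_conjC.
  by rewrite lerD // ltW.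
by rewrite e''E -!rmorphD lecR /=; lra.
Qed.

Implicit Types (S T U : H -> H) (A B : set (H -> H)).

Lemma ip_injr (x x' : H) : (forall y, ip y x = ip y x') -> x = x'.
Proof. by move=> e; apply: (@ip_inj _ H) => y; rewrite ipC e -ipC. Qed.

Definition is_adjoint (T S : H -> H) := forall x y, ip (T x) y = ip x (S y).

Lemma is_adjoint_uniq T S S' : is_adjoint T S -> is_adjoint T S' -> S = S'.
Proof. by move=> h h'; apply/funext => y; apply: ip_injr => x; rewrite -h -h'. Qed.

Lemma is_adjoint_sym T S : is_adjoint T S -> is_adjoint S T.
Proof. by move=> h x y; rewrite ipC -h -ipC. Qed.

Lemma is_adjoint_bounded T S : bounded_op T -> is_adjoint T S -> bounded_op S.
Proof.
move=> /bounded_opP [lT [c [c0 hc]]] h; apply/bounded_opP; split.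
  by move=> a x y; apply: ip_injr => z; rewrite -h !ipDr !ipZr !h.
exists c; split => // x.
have [->|n0] := eqVneq (S x) 0; first by rewrite normr0 mulr_ge0 // ltW.
have p : 0 < `|S x| by rewrite normr_gt0.
rewrite -(ler_pM2l p) -expr2 -hdot_norm -h -[leLHS]ger0_norm ?h ?ip_ge0 // -h.
by rewrite (le_trans (cauchy_schwarz _ _)) // mulrCA mulrA ler_wpM2r.
Qed.

Lemma adjoint_exists T : bounded_op T -> exists S, is_adjoint T S.
Proof.
move=> /bounded_opP [lT [c [c0 hc]]].
suff /choice [S hS] : forall y, exists u, forall x, ip (T x) y = ip x u.
  by exists S => x y; apply: hS.
move=> y; apply: (@riesz _ (c * `|y| + 1)).
- by move=> a x x'; rewrite lT ipDl ipZl.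
- by rewrite ltr_wpDl // mulr_ge0 // ltW.
- move=> x; rewrite (le_trans (cauchy_schwarz _ _)) // mulrDl mul1r ler_wpDr //.
  by rewrite mulrAC ler_wpM2r.
Qed.

Lemma adjointP T : bounded_op T -> bounded_op (adjoint T) /\ is_adjoint T (adjoint T).
Proof.
move=> bT; have [S hS] := adjoint_exists bT.
rewrite /adjoint; case: xgetP => [U _ [bU hU]|/(_ S) []]; first by split.
by split => //; apply: is_adjoint_bounded hS.
Qed.

Lemma adjointE T S : bounded_op T -> is_adjoint T S -> adjoint T = S.
Proof. by move=> /adjointP [_ h] h'; apply: is_adjoint_uniq h h'. Qed.

Lemma adjointK T : bounded_op T -> adjoint (adjoint T) = T.
Proof.
by move=> /adjointP [b h]; apply: adjointE => //; apply: is_adjoint_sym.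
Qed.

Lemma is_adjoint_comp T S T' S' : is_adjoint T S -> is_adjoint T' S' ->
  is_adjoint (T \o T') (S' \o S).
Proof. by move=> h h' x y; rewrite /= h h'. Qed.

Lemma is_adjoint_lincomb a T S T' S' : is_adjoint T S -> is_adjoint T' S' ->
  is_adjoint (a *: T + T') (a^* *: S + S').
Proof. by move=> h h' x y; rewrite !fctE ipDl ipDr ipZl ipZr conjCK h h'. Qed.

Lemma commutantP A T : A `<=` @bounded_op R H ->
  commutant A T <-> bounded_op T /\ forall S x, A S -> T (S x) = S (T x).
Proof.
move=> bA; split=> -[bT h]; split => // S.
- by move=> x AS; have /(congr1 (@^~ x)) := h S AS.
- by move=> AS; apply/funext => x /=; rewrite h.
Qed.

Lemma commutantE A T S x : commutant A T -> A S -> T (S x) = S (T x).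
Proof. by move=> [_ h] /h /(congr1 (@^~ x)). Qed.

Lemma commutant_bounded A : commutant A `<=` @bounded_op R H.
Proof. by move=> T []. Qed.

Lemma commutant_lincomb A a S T : A `<=` @bounded_op R H ->
  commutant A S -> commutant A T -> commutant A (a *: S + T).
Proof.
move=> bA cS cT; split; first by apply: bounded_lincomb; [case: cS|case: cT].
move=> U AU; apply/funext => x /=; rewrite !fctE (commutantE _ cS) // (commutantE _ cT) //.
by have l := bounded_lin (bA _ AU); rewrite (linD l) (linZ l).
Qed.

Lemma commutant_comp A S T : commutant A S -> commutant A T -> commutant A (S \o T).
Proof.
move=> cS cT; split; first by apply: bounded_comp; [case: cS|case: cT].
by move=> U AU; apply/funext => x /=; rewrite (commutantE _ cT) // (commutantE _ cS).
Qed.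

Lemma commutant_id A : commutant A (idfun : H -> H).
Proof. by split => //; apply: bounded_idfun. Qed.

Lemma sub_bicommutant A : A `<=` @bounded_op R H -> A `<=` commutant (commutant A).
Proof. by move=> bA T AT; split => [|S [_ h]]; [apply: bA|rewrite h]. Qed.

Lemma commutantS A B : A `<=` B -> @commutant R H B `<=` commutant A.
Proof. by move=> AB T [bT h]; split => // S /AB; apply: h. Qed.

Lemma tricommutant A : A `<=` @bounded_op R H ->
  commutant (commutant (commutant A)) = commutant A.
Proof.
move=> bA; apply/seteqP; split; last by apply: sub_bicommutant; apply: commutant_bounded.
by apply: commutantS; apply: sub_bicommutant.
Qed.

Lemma commutant_adjoint A : A `<=` @bounded_op R H ->
  (forall T, A T -> A (adjoint T)) -> forall T, commutant A T -> commutant A (adjoint T).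
Proof.
move=> bA sA T cT; have [bT _] := cT; have [bT' aT] := adjointP bT.
split => // S AS; have [bS' aS] := adjointP (bA _ AS).
apply: (@is_adjoint_uniq (adjoint S \o T)).
  by apply: is_adjoint_comp => //; rewrite -{2}(adjointK (bA _ AS)); apply: (adjointP bS').2.
have -> : adjoint S \o T = T \o adjoint S by case: cT => _ ->; rewrite //; apply: sA.
by apply: is_adjoint_comp => //; apply: is_adjoint_sym.
Qed.

Lemma von_neumann_commutant A : A `<=` @bounded_op R H ->
  (forall T, commutant A T -> commutant A (adjoint T)) -> von_neumann (commutant A).
Proof. by move=> bA sA; split => //; [apply: commutant_bounded|apply: tricommutant]. Qed.

Lemma cvg_uniq (T : Type) (F : set_system T) (FF : ProperFilter F) (f : T -> H) (l l' : H) :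
  f @ F --> l -> f @ F --> l' -> l = l'.
Proof. by apply: cvg_unique; apply: norm_hausdorff. Qed.

(* As |A x|^2 <= |A| <A x, x> for A >= 0, a bounded increasing net of operators
   converges strongly, so its supremum is its strong limit. *)
Lemma vector_state_normal A (w : H) : A `<=` @bounded_op R H ->
  commutant (commutant A) `<=` A -> normal_on A (fun T => ip (T w) w).
Proof.
move=> bA cA D T DA Dpos [[S0 DS0] dir] [AT ubT lubT].
have [lT [c [c0 hc]]] := (bounded_opP T).1 (bA _ AT).
have Dlin S : D S -> linear S by move=> /DA /bA /bounded_lin.
have Dp S : D S -> op_pos S by move=> DS x; have := Dpos S DS x; rewrite subr0.
have leD S U x : op_le S U -> ip (S x) x <= ip (U x) x.
  by move=> /(_ x); rewrite ipBl subr_ge0.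
have Tc y : ip (T y) y <= c * `|y| ^+ 2.
  have p : 0 <= ip (T y) y by apply: le_trans (Dp _ DS0 y) (leD _ _ y (ubT _ DS0)).
  rewrite -[leLHS]ger0_norm // (le_trans (cauchy_schwarz _ _)) // expr2 mulrA.
  by rewrite ler_wpM2r.
have diffN S U x : D S -> D U -> op_le S U ->
    `|U x - S x| ^+ 2 <= c * (ip (U x) x - ip (S x) x).
  move=> DS DU SU; rewrite -ipBl.
  apply: (@op_pos_norm _ _ (U - S)) => [|y||y]; last 1 first.
  - rewrite /GRing.add /= ipBl (le_trans _ (Tc y)) // lerBlDr.
    by apply: le_trans (leD _ _ _ (ubT _ DU)) _; rewrite lerDl Dp.
  - move=> a x1 y1; rewrite !fctE (Dlin _ DU) (Dlin _ DS) scalerBr opprD.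
    by rewrite addrACA.
  - exact: SU.
  - exact: ltW.
pose B S := [set U | D U /\ op_le S U].
pose F := filter_from D B.
have op_le_trans S U U' : op_le S U -> op_le U U' -> op_le S U'.
  by move=> h1 h2 x; rewrite -(subrKA (U x)) ipDl addr_ge0.
have op_le_refl S : op_le S S by move=> x; rewrite subrr ip0l.
have FF : ProperFilter F.
  apply: filter_from_proper => [|S DS]; last by exists S.
  apply: filter_from_filter; first by exists S0.
  move=> S U DS DU; have [W [DW SW UW]] := dir _ _ DS DU; exists W => // U' [DU' WU'].
  by split; split => //; [apply: op_le_trans WU'|apply: op_le_trans WU'].
have cv x : cvg ((fun U : H -> H => U x) @ F).
  apply: cauchy_net_cvg => e e0.
  have [e' e'E] : exists e', e = e'%:C by exists (complex.Re e); apply/real_complexE/gtr0_real.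
  have [c' c'E] : exists c', c = c'%:C by exists (complex.Re c); apply/real_complexE/gtr0_real.
  have e'0 : 0 < e' by rewrite -ltcR -e'E.
  have c'0 : 0 < c' by rewrite -ltcR -c'E.
  pose r (U : H -> H) := complex.Re (ip (U x) x).
  have rE U : D U -> ip (U x) x = (r U)%:C.
    by move=> DU; apply/real_complexE/ger0_real/Dp.
  have TxE : ip (T x) x = (complex.Re (ip (T x) x))%:C.
    apply/real_complexE/ger0_real.
    by apply: le_trans (Dp _ DS0 x) (leD _ _ x (ubT _ DS0)).
  have hs : has_sup (r @` D).
    split; first by exists (r S0); exists S0.
    exists (complex.Re (ip (T x) x)) => _ [U DU <-].
    by rewrite -lecR -TxE -rE //; apply: leD; apply: ubT.
  (* By [diffN], a gap below e'^2 / c' between values of <U x, x> is a gap below e' in norm. *)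
  have d0 : 0 < e' ^+ 2 / c' by rewrite divr_gt0 // exprn_gt0.
  have [_ [S DS <-] hS] := sup_adherent d0 hs.
  exists (S x); exists S => // U [DU SU] /=.
  rewrite distrC -(ltr_pXn2r (ltn0Sn 1)) ?nnegrE ?(ltW e0) //.
  apply: le_lt_trans (diffN _ _ x DS DU SU) _.
  rewrite !rE // c'E e'E -rmorphB -rmorphM -rmorphXn ltcR /=.
  have : r U <= sup (r @` D) by apply: ub_le_sup; [case: hs|exists U].
  by rewrite mulrC -ltr_pdivlMr //; lra.
pose T' x := lim ((fun U : H -> H => U x) @ F).
have T'l x : (fun U : H -> H => U x) @ F --> T' x by exact: cv.
have FD : F D by exists S0 => // U [].
have uniq (f : (H -> H) -> H) (l l' : H) : f @ F --> l -> f @ F --> l' -> l = l' by exact: cvg_uniq.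
have bT' : bounded_op T'.
  apply/bounded_opP; split.
    move=> a x y; apply: (uniq (fun U => U (a *: x + y))); first exact: T'l.
    have h : (fun U : H -> H => a *: U x + U y) @ F --> a *: T' x + T' y.
      by apply: cvgD => //; apply: cvgZr.
    apply: cvg_trans h; apply: near_eq_cvg; apply: filterS FD => U DU.
    by rewrite (Dlin _ DU).
  exists c; split => // x; rewrite -[T' x]subr0.
  apply: (cvg_dist_bound _ (T'l x)); apply: filterS FD => U DU; rewrite subr0.
  rewrite -(ler_pXn2r (ltn0Sn 1)) ?nnegrE ?mulr_ge0 // ?(ltW c0) //.
  have UT y : ip (U y) y <= c * `|y| ^+ 2 by apply: le_trans (leD _ _ _ (ubT _ DU)) _.
  apply: le_trans (op_pos_norm _ (Dlin _ DU) (Dp _ DU) (ltW c0) UT) _.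
  by rewrite exprMn expr2 -mulrA ler_wpM2l // ltW.
(* A pointwise limit of elements of [A] commutes with the commutant of [A]; the bicommutant
   hypothesis puts it back into [A]. *)
have AT' : A T'.
  apply: cA; split => // Y [bY cY]; apply/funext => x /=.
  apply: (uniq (fun U => U (Y x))); first exact: T'l.
  have h : (fun U => Y (U x)) @ F --> Y (T' x) by apply: (bounded_cvg _ bY (T'l x)).
  apply: cvg_trans h; apply: near_eq_cvg.
  apply: filterS FD => U DU /=.
  by have /(congr1 (@^~ x)) := cY _ (DA _ DU).
have ubT' S : D S -> op_le S T'.
  move=> DS x; rewrite ipBl addrC; apply: (ip_cvg_ge0 _ (T'l x)).
  by exists S => // U [DU SU]; rewrite addrC subr_ge0 leD.
(* The strong limit [T'] is an upper bound in [A], so the supremum lies below it, while <T' w, w> is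
   a limit of values taken on [D]. *)
have TT' : op_le T T' by apply: lubT.
split.
  by move=> _ [S DS <-]; apply: leD; apply: ubT.
move=> u uD; apply: le_trans (leD _ _ w TT') _.
rewrite -subr_ge0 -ipNr; apply: (ip_cvg_ge0 _ (T'l w)); apply: filterS FD => U DU.
by rewrite ipNr subr_ge0; apply: uD; exists U.
Qed.

(** The value l at h is pinned down by |l - g y| <= c |h - i y| for all y; linearity and boundedness
    follow from this inequality alone. As [X] carries no topology, the limit defining l is taken
    along the filter of those y for which i y is close to h. *)
Lemma dense_extension (X : lmodType C) (i g : X -> H) (c : C) : linear i -> linear g ->
  dense (range i) -> 0 < c -> (forall y, `|g y| <= c * `|i y|) ->
  exists T, bounded_op T /\ forall y, T (i y) = g y.
Proof.
move=> li lg di c0 hg.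
have near_i h (e : C) : 0 < e -> exists y, `|h - i y| < e.
  by move=> e0; have [_ [y _ <-] hy] := dense_approx h di e0; exists y.
suff /choice [T hT] : forall h, exists l, forall y, `|l - g y| <= c * `|h - i y|.
  exists T; split; last first.
    move=> y; apply/subr0_eq/eqP; rewrite -normr_le0.
    by apply: le_trans (hT _ y) _; rewrite subrr normr0 mulr0.
  apply/bounded_opP; split.
    move=> a h k; apply/subr0_eq/(@norm_eps0 _ _ _ (2 * c * (`|a| + 1))).
      by rewrite !mulr_ge0 ?addr_ge0 // ltW.
    move=> e e0; have [y hy] := near_i h e e0; have [z hz] := near_i k e e0.
    have -> : T (a *: h + k) - (a *: T h + T k) =
      (T (a *: h + k) - g (a *: y + z)) - (a *: (T h - g y) + (T k - g z)).
      rewrite lg scalerBr [X in _ = _ - X]addrACA -opprD opprB.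
      by rewrite addrA subrK.
    apply: le_trans (ler_normB _ _) _.
    have b1 : `|a *: h + k - i (a *: y + z)| <= (`|a| + 1) * e.
      rewrite li opprD addrACA -scalerBr (le_trans (ler_normD _ _)) // normrZ mulrDl mul1r.
      by rewrite lerD ?ler_wpM2l // ltW.
    rewrite -!mulrA mulr_natl mulr2n; apply: lerD.
      by apply: le_trans (hT _ _) _; rewrite ler_wpM2l // ltW.
    rewrite (le_trans (ler_normD _ _)) // normrZ (_ : c * _ = `|a| * (c * e) + c * e); last by ring.
    by rewrite lerD ?ler_wpM2l // (le_trans (hT _ _)) // ler_wpM2l // ltW.
  exists (c + 1); split; first by rewrite addr_gt0.
  move=> h; apply/ler_addgt0Pr => e e0.
  have e1 : 0 < e / (2 * c) by rewrite divr_gt0 // mulr_gt0.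
  have [y hy] := near_i h _ e1.
  rewrite -[T h](subrK (g y)) (le_trans (ler_normD _ _)) //.
  have h1 := hT h y; have h2 := hg y.
  have h3 : `|i y| <= `|h| + `|h - i y|.
    by rewrite -{1}[i y](subKr h) (le_trans (ler_normB _ _)).
  apply: (@le_trans _ _ (c * `|h - i y| + c * (`|h| + `|h - i y|))).
    by rewrite lerD // (le_trans h2) // ler_wpM2l // ltW.
  rewrite (_ : _ + _ = c * `|h| + 2 * c * `|h - i y|); last by ring.
  apply: lerD; first by rewrite ler_wpM2r // lerDl.
  by move: hy => /ltW hy; rewrite mulrC -ler_pdivlMr // mulr_gt0.
move=> h.
pose B (e : C) := [set y | `|h - i y| < e].
pose F := filter_from [set e : C | 0 < e] B.
have FF : ProperFilter F.
  apply: filter_from_proper => [|e e0]; last by have [y] := near_i h e e0; exists y.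
  apply: filter_from_filter; first by exists 1 => /=.
  move=> e e' e0 e'0; have [ee'|e'e] : e <= e' \/ e' <= e.
  - have := @real_leP _ e e' (gtr0_real e0) (gtr0_real e'0).
    by case; [left|move/ltW; right].
  - by exists e => // y hy; split => //; apply: lt_le_trans ee'.
  - by exists e' => // y hy; split => //; apply: lt_le_trans e'e.
have cv : cvg (g @ F).
  apply: cauchy_net_cvg => e e0.
  have e1 : 0 < e / (2 * c) by rewrite divr_gt0 // mulr_gt0.
  have [z hz] := near_i h _ e1; exists (g z); exists (e / (2 * c)) => // y hy.
  rewrite -(linB lg) (le_lt_trans (hg _)) // (linB li).
  rewrite mulrC -ltr_pdivlMr //.
  have -> : e / c = e / (2 * c) + e / (2 * c) by field; rewrite gt_eqF.
  rewrite -(subrKA h) (le_lt_trans (ler_normD _ _)) // ltrD // distrC //.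
exists (lim (g @ F)) => y; apply/ler_addgt0Pr => e e0.
have e1 : 0 < e / c by rewrite divr_gt0.
apply: (cvg_dist_bound _ cv); exists (e / c) => // z hz.
rewrite -(linB lg) (le_trans (hg _)) // (linB li).
rewrite (_ : c * _ + e = c * (`|h - i y| + e / c)); last by field; rewrite gt_eqF.
rewrite ler_wpM2l ?(ltW c0) // -(subrKA h) (le_trans (ler_normD _ _)) // addrC lerD //.
by rewrite distrC ltW.
Qed.
End BoundedOperators.
(** * The path algebra *)

Lemma malgU_scale (K : choiceType) (A : nzRingType) (c : A) (k : K) :
  << c *g k >> = c *: << k >> :> {malg A[K]}.
Proof. by apply/malgP => j; rewrite mcoeffZ !mcoeffU mulrnAr mulr1. Qed.

Section Flin.
Variables (K : choiceType) (C : nzRingType) (W : lmodType C).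
Implicit Types (x y : {malg C[K]}) (p : K) (f g h : K -> W).

Definition flin f x : W := \sum_(p <- msupp x) x@_p *: f p.

Lemma flinEw f (d : {fset K}) x : (msupp x `<=` d)%fset ->
  flin f x = \sum_(p <- d) x@_p *: f p.
Proof.
move=> sd; rewrite /flin (big_fset_incl _ sd) // => p _ /mcoeff_outdom ->.
by rewrite scale0r.
Qed.

Lemma flin_linear f : linear (flin f).
Proof.
move=> c x y; pose d := (msupp x `|` msupp y)%fset.
rewrite (@flinEw f d (c *: x + y)) ?(@flinEw f d x) ?(@flinEw f d y) ?fsubsetUl ?fsubsetUr //; last first.
  apply: (fsubset_trans (msuppD_le _ _)); apply: fsetSU; exact: msuppZ_le.
rewrite scaler_sumr -big_split /=; apply: eq_bigr => p _.
by rewrite mcoeffD mcoeffZ scalerDl scalerA.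
Qed.

Lemma flinU f p : flin f << p >> = f p.
Proof. by rewrite /flin msuppU oner_eq0 big_seq_fset1 mcoeffUU scale1r. Qed.

Lemma malg_decomp x : x = \sum_(p <- msupp x) x@_p *: << p >>.
Proof. by rewrite {1}[x]monalgE; apply: eq_bigr => p _; rewrite malgU_scale. Qed.

End Flin.

Lemma flin_fun_linear (K : choiceType) (C : comNzRingType) (W : lmodType C) (f g h : K -> W) (c : C) (x : {malg C[K]}) :
  (forall p, f p = c *: g p + h p) -> flin f x = c *: flin g x + flin h x.
Proof.
move=> e; rewrite /flin scaler_sumr -big_split /=; apply: eq_bigr => p _.
by rewrite e scalerDr !scalerA mulrC.
Qed.

Lemma onth_rev (T : Type) (s : seq T) i : (i < size s)%N -> onth (rev s) (size s - i.+1) = onth s i.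
Proof.
move=> h; case: s h => // e s h.
rewrite !onthE map_rev nth_rev size_map; last by rewrite ltn_subrL (leq_trans _ h).
by rewrite subnSK // subKn // ltnW.
Qed.

Section Walks.
Variables (R : realType) (G : graph R).
Local Notation C := (R[i]).
Local Notation V := (vertex G).
Local Notation E := (edge G).
Implicit Types (v w : V) (s t : seq E) (a b : E) (p q : gpath G).

Definition wend v s : V := last v (map (@dst R G) s).

Lemma walk_cat v s t : walk v (s ++ t) = walk v s && walk (wend v s) t.
Proof. by elim: s v => //= a s IH v; rewrite IH andbA. Qed.
Lemma wend_rcons v s a : wend v (rcons s a) = dst a.
Proof. by rewrite /wend map_rcons last_rcons. Qed.
Lemma walk_rcons v s a : walk v (rcons s a) = walk v s && (src a == wend v s).
Proof. by rewrite -cats1 walk_cat /= andbT. Qed.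

Definition rbar s : seq E := rev (map (@bar R G) s).

Lemma rbarK : involutive rbar.
Proof. by move=> s; rewrite /rbar map_rev revK -map_comp map_id_in // => a _; apply: barK. Qed.
Lemma rbar_rcons s a : rbar (rcons s a) = bar a :: rbar s.
Proof. by rewrite /rbar map_rcons rev_rcons. Qed.
Lemma rbar_cons s a : rbar (a :: s) = rcons (rbar s) (bar a).
Proof. by rewrite /rbar /= rev_cons. Qed.

Lemma wend_rbar v s : walk v s -> wend (wend v s) (rbar s) = v.
Proof.
elim: s v => //= a s IH v /andP [/eqP <- ws].
by rewrite rbar_cons wend_rcons dst_bar.
Qed.
Lemma walk_rbar v s : walk v s -> walk (wend v s) (rbar s).
Proof.
elim: s v => //= a s IH v /andP [/eqP <- ws].
by rewrite rbar_cons walk_rcons (IH (dst a)) // (wend_rbar ws) src_bar eqxx.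
Qed.

Lemma bar_eqC a b : (a == bar b) = (b == bar a).
Proof. by apply/eqP/eqP => ->; rewrite barK. Qed.

Lemma muneq0 v : mu v != 0. Proof. by rewrite gt_eqF // mu_gt0. Qed.

(** The contribution of one cancelled edge: the factor mu(f(xi)) / mu(v_{m-k}) of the product is the
    telescoping product of these over the last k edges of xi. *)
Definition wt a : C := (mu (dst a) / mu (src a))%:C.

Section Junction.
Variables (W : lmodType C) (bs : V -> seq E -> W).

(* The product of two paths computed from the junction: rs is the first path
   read backwards. *)
Fixpoint jm v (rs t : seq E) : W :=
  bs v (rev rs ++ t) +
  (if rs is a :: rs' then if t is b :: t' then
     if b == bar a then wt a *: jm v rs' t' else 0 else 0 else 0).

(** Each unfolding of [jm] cancels one more pair of edges, so k unfoldings give the k-th term of the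
    sum. The recursive form is the one suited to induction on paths. *)
Lemma jm_sum v rs t : walk v (rev rs) ->
  jm v rs t = \sum_(k < (minn (size rs) (size t)).+1)
     ((\prod_(i < k) (onth rs i == omap (@bar R G) (onth t i))%:R) *
      (mu (wend v (rev rs)) / mu (wend v (rev (drop k rs))))%:C)
     *: bs v (rev (drop k rs) ++ drop k t).
Proof.
elim: rs t => [|a rs IH] t wr.
  by rewrite /= min0n big_ord1 big_ord0 mul1r divff ?muneq0 // scale1r drop0 addr0.
case: t => [|b t].
  by rewrite /= minn0 big_ord1 big_ord0 mul1r drop0 divff ?muneq0 // scale1r addr0.
move: wr; rewrite rev_cons walk_rcons => /andP [wr /eqP sa].
rewrite minnSS big_ord_recl big_ord0 mul1r drop0 -rev_cons divff ?muneq0 // scale1r /=.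
congr (_ + _).
have [ba|nba] := eqVneq b (bar a); last first.
  rewrite big1 // => k _; rewrite big_ord_recl /= (_ : Some a == _ = false) ?mul0r ?scale0r //.
  by apply/eqP => -[e]; move: nba; rewrite e barK eqxx.
rewrite IH // scaler_sumr; apply: eq_bigr => k _; rewrite scalerA; congr (_ *: _).
rewrite big_ord_recl /= ba barK eqxx mul1r mulrCA; congr (_ * _).
rewrite rev_cons wend_rcons -sa /wt -rmorphM /=; congr (_%:C).
by rewrite mulrA divfK ?muneq0.
Qed.
End Junction.

(* The structure of F(G) is kept abstract, as conversion does not terminate in
   practice on the finitely supported functions that implement it. *)
Record path_algebra := PathAlgebra {
  pa_car :> lmodType C;
  bs : V -> seq E -> pa_car;
  bs_nwalk : forall v s, ~~ walk v s -> bs v s = 0;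
  pext : forall W : lmodType C, (V -> seq E -> W) -> pa_car -> W;
  pext_linear : forall (W : lmodType C) (f : V -> seq E -> W), linear (pext f);
  pextE : forall (W : lmodType C) (f : V -> seq E -> W) v s, walk v s -> pext f (bs v s) = f v s;
  pspan : forall Q : pa_car -> Prop, Q 0 ->
    (forall c x y, Q x -> Q y -> Q (c *: x + y)) ->
    (forall v s, walk v s -> Q (bs v s)) -> forall x, Q x;
  pmul : pa_car -> pa_car -> pa_car;
  pmul_linl : forall y, linear (pmul^~ y);
  pmul_linr : forall x, linear (pmul x);
  pmul_bs : forall v s w t, walk v s -> walk w t ->
    pmul (bs v s) (bs w t) = if wend v s == w then jm bs v (rev s) t else 0;
  pstar : pa_car -> pa_car;
  pstar_lin : forall c x y, pstar (c *: x + y) = c^* *: pstar x + pstar y;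
  pstar_bs : forall v s, walk v s -> pstar (bs v s) = bs (wend v s) (rbar s);
  ptr : pa_car -> C;
  ptr_lin : forall c x y, ptr (c *: x + y) = c * ptr x + ptr y;
  ptr_bs : forall v s, walk v s ->
    ptr (bs v s) = if s is [::] then (mu v ^+ 2)%:C else 0
}.
End Walks.

(** * The finitely supported functions on paths as a [path_algebra] *)

Section Instance.
Variables (R : realType) (G : graph R).
Local Notation C := (R[i]).
Local Notation V := (vertex G).
Local Notation E := (edge G).
Local Notation F := (F G).
Local Notation bas := (@bas R G).
Implicit Types (x y z : F) (v w : V) (s t : seq E) (a b : E) (p q : gpath G).

Lemma bas_path v s (h : walk v s) : bas v s = << (exist _ (v, s) h : gpath G) >>.
Proof.
rewrite /Defs.bas; case: insubP => [p _ e|]; last by rewrite /= h.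
by congr (<< _ >>); apply: val_inj.
Qed.
Lemma bas_nwalk v s : ~~ walk v s -> bas v s = 0.
Proof. by move=> h; rewrite /Defs.bas insubN. Qed.
Definition fext (W : lmodType C) (f : V -> seq E -> W) : F -> W :=
  flin (fun p => f (pstart p) (pedges p)).
Lemma fext_linear (W : lmodType C) (f : V -> seq E -> W) : linear (fext f).
Proof. exact: flin_linear. Qed.
Lemma fextE (W : lmodType C) (f : V -> seq E -> W) v s : walk v s -> fext f (bas v s) = f v s.
Proof. by move=> h; rewrite bas_path /fext flinU. Qed.
Lemma fspan (Q : F -> Prop) : Q 0 -> (forall c x y, Q x -> Q y -> Q (c *: x + y)) ->
  (forall v s, walk v s -> Q (bas v s)) -> forall x, Q x.
Proof.
move=> Q0 Ql Qb x; rewrite (malg_decomp x).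
elim: (enum_fset (msupp x)) => [|p r IH]; first by rewrite big_nil.
by rewrite big_cons; apply: Ql => //; case: p => [[v s] h]; rewrite -bas_path; apply: Qb.
Qed.

Lemma mulE x y : Fmul x y = flin (fun p => flin (path_mul p) y) x.
Proof.
rewrite /Fmul /flin; apply: eq_bigr => p _; rewrite scaler_sumr.
by apply: eq_bigr => q _; rewrite scalerA.
Qed.
Lemma mul_linl y : linear (fun x => Fmul x y).
Proof. by move=> c x x'; rewrite !mulE flin_linear. Qed.
Lemma mul_linr x : linear (Fmul x).
Proof.
move=> c y y'; rewrite !mulE; apply: flin_fun_linear => p.
by rewrite flin_linear.
Qed.

Lemma mul_bas v s w t : walk v s -> walk w t ->
  Fmul (bas v s) (bas w t) = if wend v s == w then jm bas v (rev s) t else 0.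
Proof.
move=> ws wt'; rewrite (bas_path ws) (bas_path wt') mulE !flinU /path_mul.
rewrite /pfinish /pvertex /plen /pstart /pedges /= take_size -/(wend v s).
case: (_ == w); last by [].
rewrite (@jm_sum R G F bas) ?revK // size_rev.
apply: eq_bigr => k _; rewrite drop_rev revK.
have -> : \prod_(i < k) (onth s (size s - i.+1) == omap (bar (g:=G)) (onth t i))%:R =
  \prod_(i < k) (onth (rev s) i == omap (bar (g:=G)) (onth t i))%:R :> C.
  apply: eq_bigr => i _; congr ((_ == _)%:R).
  have hi : (i < size s)%N.
    by rewrite (leq_trans (ltn_ord i)) // -ltnS (leq_trans (ltn_ord k)) // ltnS geq_minl.
  by rewrite -[in RHS]onth_rev ?size_rev ?revK.
reflexivity.
Qed.

Lemma star_lin c x y : Fstar (c *: x + y) = c^* *: Fstar x + Fstar y.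
Proof.
pose d := (msupp x `|` msupp y)%fset.
have E' z : (msupp z `<=` d)%fset -> Fstar z = \sum_(p <- d) (z@_p)^* *: bas (pfinish p) (rev (map (@bar R G) (pedges p))).
  move=> sd; rewrite /Fstar (big_fset_incl _ sd) // => p _ /mcoeff_outdom ->.
  by rewrite conjC0 scale0r.
rewrite (E' (c *: x + y)) ?(E' x) ?(E' y) ?fsubsetUl ?fsubsetUr //; last first.
  apply: (fsubset_trans (msuppD_le _ _)); apply: fsetSU; exact: msuppZ_le.
rewrite scaler_sumr -big_split; apply: eq_bigr => p _.
by rewrite mcoeffD mcoeffZ rmorphD rmorphM scalerDl scalerA.
Qed.

Lemma star_bas v s : walk v s -> Fstar (bas v s) = bas (wend v s) (rbar s).
Proof.
move=> h; rewrite (bas_path h) /Fstar msuppU oner_eq0 big_seq_fset1 mcoeffUU conjC1 scale1r.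
by rewrite /pfinish /pvertex /plen /pedges take_size.
Qed.

Lemma tr_lin c x y : Ftr (c *: x + y) = c * Ftr x + Ftr y.
Proof.
rewrite /Ftr mulr_sumr -big_split; apply: eq_bigr => v _.
by rewrite mcoeffD mcoeffZ mulrDr mulrCA.
Qed.

Lemma tr_bas v s : walk v s -> Ftr (bas v s) = if s is [::] then (mu v ^+ 2)%:C else 0.
Proof.
move=> h; rewrite (bas_path h) /Ftr.
have e w : (exist _ (v, s) h == vpath w) = (v == w) && (s == [::]).
  by rewrite -(inj_eq val_inj) /= xpair_eqE.
under eq_bigr => w _ do rewrite mcoeffU e.
case: s h e => [|a s] h e; last by rewrite big1 // => w _; rewrite andbF mulr0n mulr0.
rewrite (bigD1 v) //= eqxx mulr1n mulr1 big1 ?addr0 // => w; rewrite eq_sym => /negPf ->.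
by rewrite mulr0n mulr0.
Qed.

Definition F_path_algebra : path_algebra G :=
  @PathAlgebra R G F bas bas_nwalk fext fext_linear fextE fspan (@Fmul R G) mul_linl mul_linr
    mul_bas (@Fstar R G) star_lin star_bas (@Ftr R G) tr_lin tr_bas.
End Instance.

Lemma lin_comp (K : ringType) (U V W : lmodType K) (f : V -> W) (g : U -> V) :
  linear f -> linear g -> linear (fun x => f (g x)).
Proof. by move=> lf lg c x y; rewrite lg lf. Qed.

Lemma conjcR (R : rcfType) (r : R) : (r%:C)^* = r%:C.
Proof. exact: conjc_real. Qed.

(** * Associativity, trace and inner product of the path algebra *)

Section PathAlgebraTheory.
Variables (R : realType) (G : graph R) (P : path_algebra G).
Local Notation C := (R[i]).
Local Notation V := (vertex G).
Local Notation E := (edge G).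
Local Notation b := (@bs R G P).
Local Notation star := (@pstar R G P).
Local Notation tr := (@ptr R G P).
Local Notation "x # y" := (@pmul R G P x y) (at level 40, left associativity).
Implicit Types (x y z : P) (v w : V) (s t : seq E) (a d : E).

Lemma pext_eq (W : lmodType C) (f g : P -> W) : linear f -> linear g ->
  (forall v s, walk v s -> f (b v s) = g (b v s)) -> forall x, f x = g x.
Proof.
move=> lf lg h; apply: pspan => //; first by rewrite (lin0 lf) (lin0 lg).
by move=> c x y ex ey; rewrite lf lg ex ey.
Qed.

Lemma pmul0 x : 0 # x = 0. Proof. exact: lin0 (pmul_linl x). Qed.
Lemma pmulx0 x : x # 0 = 0. Proof. exact: lin0 (pmul_linr x). Qed.
Lemma pmulDl x y z : (x + y) # z = x # z + y # z. Proof. exact: linD (pmul_linl z) x y. Qed.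
Lemma pmulDr x y z : z # (x + y) = z # x + z # y. Proof. exact: linD (pmul_linr z) x y. Qed.
Lemma pmulZl c x z : (c *: x) # z = c *: (x # z). Proof. exact: linZ (pmul_linl z) c x. Qed.
Lemma pmulZr c x z : z # (c *: x) = c *: (z # x). Proof. exact: linZ (pmul_linr z) c x. Qed.
Lemma pmulBl x y z : (x - y) # z = x # z - y # z. Proof. exact: linB (pmul_linl z) x y. Qed.
Lemma pmulBr x y z : z # (x - y) = z # x - z # y. Proof. exact: linB (pmul_linr z) x y. Qed.
Lemma pmul_suml I (r : seq I) (Q : pred I) (f : I -> P) z :
  (\sum_(i <- r | Q i) f i) # z = \sum_(i <- r | Q i) f i # z.
Proof. exact: lin_sum (pmul_linl z) _ _ _ _. Qed.
Lemma pmul_sumr I (r : seq I) (Q : pred I) (f : I -> P) z :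
  z # (\sum_(i <- r | Q i) f i) = \sum_(i <- r | Q i) z # f i.
Proof. exact: lin_sum (pmul_linr z) _ _ _ _. Qed.

Lemma jm_nil v rs : jm b v rs [::] = b v (rev rs).
Proof. by case: rs => [|a rs] /=; rewrite addr0 ?cats0. Qed.

Definition pe a : P := b (src a) [:: a].
Definition pv v : P := b v [::].

Lemma mul_pv v w s : pv v # b w s = if v == w then b w s else 0.
Proof.
have [ws|nws] := boolP (walk w s); last by rewrite (bs_nwalk P nws) pmulx0 if_same.
by rewrite pmul_bs //= addr0 /wend /=; case: eqP => [->|].
Qed.
Lemma mul_pvr v w s : b w s # pv v = if wend w s == v then b w s else 0.
Proof.
have [ws|nws] := boolP (walk w s); last by rewrite (bs_nwalk P nws) pmul0 if_same.
by rewrite pmul_bs // jm_nil revK.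
Qed.
Lemma mul_pe a v s : pe a # b v s =
  if dst a == v then b (src a) (a :: s) +
     (if s is d :: t then if d == bar a then wt a *: b (dst d) t else 0 else 0)
  else 0.
Proof.
have [ws|nws] := boolP (walk v s).
  rewrite pmul_bs //= ?eqxx // /wend /=; case: eqP => // _; congr (_ + _).
  case: s ws => // d t _; case: eqP => // ->.
  by rewrite dst_bar addr0.
rewrite (bs_nwalk P nws) pmulx0; case: eqP => // e.
rewrite bs_nwalk /= ?eqxx ?e // add0r.
case: s nws => // d t /= nw; case: eqP => // eb; rewrite bs_nwalk ?scaler0 //.
by move: nw; rewrite eb src_bar e eqxx.
Qed.

Lemma mul_per a v s : walk v s -> b v s # pe a =
  if wend v s == src a then b v (rcons s a) +
     (if rev s is d :: t then if a == bar d then wt d *: b v (rev t) else 0 else 0)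
  else 0.
Proof.
move=> ws; rewrite pmul_bs //= ?eqxx //; case: eqP => // e.
case: (lastP s) => [|s' d]; rewrite ?rev_rcons /= ?addr0 // rev_cons revK cats1.
congr (_ + _); case: eqP => // _.
by rewrite jm_nil revK.
Qed.

Lemma mul_pv_jm u v rs t : pv u # jm b v rs t = if u == v then jm b v rs t else 0.
Proof.
elim: rs t => [|a rs IH] t /=; first by rewrite !addr0 mul_pv.
rewrite pmulDr mul_pv; case: t => [|d t]; first by rewrite pmulx0 !addr0.
case: (d == bar a); last by rewrite pmulx0 !addr0.
by rewrite pmulZr IH; case: (u == v) => //; rewrite scaler0 addr0.
Qed.

Lemma mul_pe_jm0 a v rs t : dst a != v -> pe a # jm b v rs t = 0.
Proof.
move/negPf => n; elim: rs t => [|d rs IH] t /=; first by rewrite !addr0 mul_pe n.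
rewrite pmulDr mul_pe n; case: t => [|c t]; first by rewrite pmulx0 !addr0.
case: (c == bar d); last by rewrite pmulx0 !addr0.
by rewrite pmulZr IH scaler0 addr0.
Qed.

(** This is associativity for a left factor that is an edge. As [jm] stores the first path
    backwards, the new edge is appended at the far end of [rs]; the extra term is its cancellation
    against the first edge of that path. *)
Lemma mul_pe_jm a rs t :
  pe a # jm b (dst a) rs t = jm b (src a) (rcons rs a) t +
     (if rev rs is c :: s then if c == bar a then wt a *: jm b (dst c) (rev s) t else 0 else 0).
Proof.
elim: rs t => [|d rs IH] t.
  rewrite /= !addr0 mul_pe eqxx; congr (_ + _); case: t => // c t; case: eqP => // ->.
  by rewrite dst_bar addr0.
rewrite rcons_cons /= pmulDr mul_pe eqxx -rcons_cons rev_rcons cat_cons.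
rewrite -!addrA; congr (_ + _); rewrite rev_cons.
case er: (rev rs) => [|c s] /=.
  have -> : rs = [::] by rewrite -[rs]revK er.
  rewrite addr0 addrC; congr (_ + _); case: t => [|c t]; rewrite ?pmulx0 //.
  case: eqP; rewrite ?pmulx0 // => _; rewrite pmulZr /= addr0 mul_pe eqxx /= ; congr (_ *: (_ + _)).
  by case: t => // e t; case: eqP => // ->; rewrite dst_bar addr0.
rewrite rev_rcons /= addrC.
rewrite rev_cons revK; case: t => [|e t]; first by rewrite pmulx0 !add0r addr0 cats0.
case: eqP => [|_]; last by rewrite pmulx0 !add0r !addr0.
move=> -> ; rewrite pmulZr IH er scalerDr -!addrA; congr (_ + _).
case: eqP => _; last by rewrite scaler0 addr0.
by rewrite !scalerDr addrC !scalerA mulrC.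
Qed.

Lemma mul_pe_assoc a x y : pe a # (x # y) = (pe a # x) # y.
Proof.
move: y; apply: pext_eq.
- exact: lin_comp (pmul_linr _) (pmul_linr _).
- exact: pmul_linr.
move=> w t wt'; move: x; apply: pext_eq.
- exact: lin_comp (pmul_linr _) (pmul_linl _).
- exact: lin_comp (pmul_linl _) (pmul_linr _).
move=> v s ws; rewrite mul_pe pmul_bs //.
have [e|ne] := eqVneq (dst a) v; last first.
  by rewrite pmul0; case: ifP => // _; rewrite ?pmulx0 ?mul_pe_jm0.
subst v; rewrite pmulDl pmul_bs //=; last by rewrite eqxx.
have -> : wend (src a) (a :: s) = wend (dst a) s by [].
have -> : ((if s is d :: t0 then if d == bar a then wt a *: b (dst d) t0 else 0 else 0) # b w t) =
   if wend (dst a) s == w then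
   (if s is c :: s' then if c == bar a then wt a *: jm b (dst c) (rev s') t else 0 else 0) else 0.
  case: s ws => [|c s'] /= => [_|/andP [_ ws']]; first by rewrite pmul0 if_same.
  case: (c == bar a); last by rewrite pmul0 if_same.
  rewrite pmulZl pmul_bs // (_ : wend (dst a) (c :: s') = wend (dst c) s') //.
  by case: ifP => //; rewrite scaler0.
case: ifP => _; last by rewrite pmulx0 addr0.
by rewrite mul_pe_jm rev_cons revK.
Qed.

(** Vertices and edges generate: the path a :: s is [pe a] times s, up to a multiple of a path
    shorter by two edges. Hence a strong induction on the length. *)
Lemma pa_ind (Q : P -> Prop) : Q 0 -> (forall c x y, Q x -> Q y -> Q (c *: x + y)) ->
  (forall v, Q (pv v)) -> (forall a x, Q x -> Q (pe a # x)) -> forall x, Q x.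
Proof.
move=> Q0 Ql Qv Qe; apply: (@pspan _ _ P Q) => // v s.
have [n sn] := ubnP (size s); elim: n v s sn => // n IH v [|a s] /= sn; first by move=> _; apply: Qv.
move=> /andP [/eqP <- ws]; have q := Qe a _ (IH (dst a) s sn ws).
have -> : b (src a) (a :: s) =
  - (1 : C) *: (if s is d :: t then if d == bar a then wt a *: b (dst d) t else 0 else 0) + pe a # b (dst a) s.
  by rewrite mul_pe eqxx scaleN1r addrC addrK.
apply: (Ql) => //; case: s sn ws q => [|d t] //= sn.
move=> /andP [_ wt'] q; case: (d == bar a) => //.
by rewrite -[_ *: _]addr0; apply: Ql => //; apply: IH => //; rewrite ltnW.
Qed.

(** By [pa_ind] only vertices and edges remain as left factor, and edges are [mul_pe_assoc]. *)
Lemma pmulA x y z : (x # y) # z = x # (y # z).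
Proof.
move: x y z; apply: pa_ind => [y z|c x x' e e' y z|v y z|a x e y z].
- by rewrite !pmul0.
- by rewrite !pmul_linl e e'.
- move: z; apply: pext_eq; [exact: pmul_linr|exact: lin_comp (pmul_linr _) (pmul_linr _)|].
  move=> w t wt'; move: y; apply: pext_eq.
  + exact: lin_comp (pmul_linl _) (pmul_linr _).
  + exact: lin_comp (pmul_linr _) (pmul_linl _).
  move=> u s ws; rewrite mul_pv (pmul_bs P ws wt').
  case: ifP => e; rewrite ?pmul0 ?(pmul_bs P ws wt'); case: ifP => _; rewrite ?pmulx0 ?mul_pv_jm ?e //.
- by rewrite -!mul_pe_assoc e.
Qed.

Definition pone : P := \sum_v pv v.

Lemma pone_mul x : pone # x = x.
Proof.
move: x; apply: pext_eq => [|//|v s ws]; first exact: pmul_linr.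
rewrite pmul_suml (bigD1 v) //= mul_pv eqxx big1 ?addr0 // => w /negPf n.
by rewrite mul_pv n.
Qed.
Lemma pmul_one x : x # pone = x.
Proof.
move: x; apply: pext_eq => [|//|v s ws]; first exact: pmul_linl.
rewrite pmul_sumr (bigD1 (wend v s)) //= mul_pvr eqxx big1 ?addr0 // => w /negPf n.
by rewrite mul_pvr eq_sym n.
Qed.

Lemma pstar0 : star 0 = 0.
Proof. by have := pstar_lin (-1) (0 : P) 0; rewrite scaler0 addr0 rmorphN rmorph1 scaleN1r addNr. Qed.
Lemma pstarD x y : star (x + y) = star x + star y.
Proof. by have := pstar_lin 1 x y; rewrite conjC1 !scale1r. Qed.
Lemma pstarZ c x : star (c *: x) = c^* *: star x.
Proof. by have := pstar_lin c x 0; rewrite pstar0 !addr0. Qed.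
Lemma pstarB x y : star (x - y) = star x - star y.
Proof. by rewrite -scaleN1r addrC pstar_lin rmorphN rmorph1 scaleN1r addrC. Qed.
Lemma pstar_sum I (r : seq I) (Q : pred I) (f : I -> P) :
  star (\sum_(i <- r | Q i) f i) = \sum_(i <- r | Q i) star (f i).
Proof. exact: (big_morph star pstarD pstar0). Qed.

Lemma pstarK x : star (star x) = x.
Proof.
move: x; apply: (pspan (p := P)) => [|c x y ex ey|v s ws]; first by rewrite !pstar0.
  by rewrite !pstar_lin conjCK ex ey.
by rewrite !pstar_bs ?walk_rbar // rbarK wend_rbar.
Qed.

Lemma pstar_pe a : star (pe a) = pe (bar a).
Proof. by rewrite /pe pstar_bs /= ?eqxx // src_bar. Qed.
Lemma pstar_pv v : star (pv v) = pv v.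
Proof. by rewrite /pv pstar_bs. Qed.

Lemma star_mul_pe a x : star (pe a # x) = star x # pe (bar a).
Proof.
move: x; apply: (pspan (p := P)) => [|c x y ex ey|v s ws].
- by rewrite pmulx0 !pstar0 pmul0.
- by rewrite pmul_linr !pstar_lin pmul_linl ex ey.
rewrite mul_pe pstar_bs // mul_per ?walk_rbar // wend_rbar // src_bar eq_sym.
case: eqP => [e|_]; last by rewrite pstar0.
subst v; rewrite pstarD pstar_bs /= ?eqxx // rbar_cons; congr (_ + _).
rewrite /rbar revK; case: s ws => [|c s] /= => [_|/andP [_ ws]]; first by rewrite pstar0.
rewrite /= (inj_eq (inv_inj (@barK R G))) bar_eqC.
case: eqP => [->|_]; last by rewrite pstar0.
by rewrite pstarZ pstar_bs // /wt conjcR.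
Qed.

Lemma ptrD x y : tr (x + y) = tr x + tr y.
Proof. by have := ptr_lin 1 x y; rewrite scale1r mul1r. Qed.
Lemma ptr0 : tr 0 = 0.
Proof. by apply: (addrI (tr 0)); rewrite -ptrD !addr0. Qed.
Lemma ptrZ c x : tr (c *: x) = c * tr x.
Proof. by have := ptr_lin c x 0; rewrite ptr0 !addr0. Qed.

(** Only complete cancellation reaches degree 0. The weights then telescope to mu(end) / mu(v), to
    be multiplied by the trace mu(v)^2 of the trivial path. *)
Lemma ptr_jm v rs t : walk v (rev rs) -> walk (wend v (rev rs)) t ->
  tr (jm b v rs t) = if t == map (@bar R G) rs then (mu v * mu (wend v (rev rs)))%:C else 0.
Proof.
elim: rs t => [|a rs IH] [|c t] wr wt'; rewrite ?[jm _ _ _ _]/= ?addr0.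
- by rewrite ptr_bs //= expr2.
- by rewrite ptr_bs.
- rewrite ptr_bs ?cats0 //; by case: (lastP rs) => [|? ?]; rewrite rev_cons //; case: (rev _).
rewrite ptrD ptr_bs ?walk_cat ?wr //.
have -> : (if rev (a :: rs) ++ c :: t is [::] then (mu v ^+ 2)%:C else 0) = 0 :> C.
  by case: (rev (a :: rs)).
rewrite add0r /= eqseq_cons.
case: eqP => [ec|_] /=; last by rewrite ptr0.
move: wr wt'; rewrite rev_cons walk_rcons wend_rcons /= ec dst_bar src_bar eqxx => /andP [wr /eqP sa] wt'.
rewrite ptrZ IH // -?sa //; case: ifP => _; last by rewrite mulr0.
rewrite /wt -rmorphM /=; congr (_%:C); rewrite mulrCA; congr (_ * _).
by rewrite divfK ?muneq0.
Qed.

Lemma pstar_mul x y : star (x # y) = star y # star x.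
Proof.
move: x y; apply: pa_ind => [y|c x x' e e' y|v y|a x e y].
- by rewrite pmul0 pstar0 pmulx0.
- by rewrite pmul_linl !pstar_lin pmul_linr e e'.
- rewrite pstar_pv; move: y; apply: (pspan (p := P)) => [|c x y ex ey|w s ws].
  + by rewrite pmulx0 pstar0 pmul0.
  + by rewrite pmul_linr !pstar_lin pmul_linl ex ey.
  rewrite mul_pv pstar_bs // mul_pvr wend_rbar // eq_sym; case: ifP => // _; first by rewrite pstar_bs.
  by rewrite pstar0.
- by rewrite pmulA star_mul_pe e star_mul_pe pmulA.
Qed.

Lemma pstar_one : star pone = pone.
Proof. by rewrite pstar_sum; apply: eq_bigr => v _; rewrite pstar_pv. Qed.

Lemma ptr_mul_bs v s w t : walk v s -> walk w t ->
  tr (b v s # b w t) = if (wend v s == w) && (t == rbar s) then (mu v * mu w)%:C else 0.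
Proof.
move=> ws wt'; rewrite pmul_bs //; case: eqP => [e|] /=; last by rewrite ptr0.
by rewrite ptr_jm ?revK // e // /rbar map_rev.
Qed.

Lemma ptr_mulC x y : tr (x # y) = tr (y # x).
Proof.
move: x y; apply: (pspan (p := P)) => [y|c x x' e e' y|v s ws].
- by rewrite pmul0 pmulx0.
- by rewrite pmul_linl pmul_linr !ptr_lin e e'.
apply: (pspan (p := P)) => [|c x x' e e'|w t wt'].
- by rewrite pmul0 pmulx0.
- by rewrite pmul_linl pmul_linr !ptr_lin e e'.
rewrite !ptr_mul_bs // mulrC; congr (if _ then _ else _).
apply/andP/andP => -[/eqP e /eqP e']; subst.
  by rewrite wend_rbar // rbarK !eqxx.
by rewrite wend_rbar // rbarK !eqxx.
Qed.

Definition pip x y : C := tr (star y # x).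

Lemma pip_linl y c x x' : pip (c *: x + x') y = c * pip x y + pip x' y.
Proof. by rewrite /pip pmul_linr ptr_lin. Qed.
Lemma pip_linr y c x x' : pip y (c *: x + x') = c^* * pip y x + pip y x'.
Proof. by rewrite /pip pstar_lin pmul_linl ptr_lin. Qed.

Lemma pip_bs v s w t : walk v s -> walk w t ->
  pip (b v s) (b w t) = if (v == w) && (s == t) then (mu v * mu (wend v s))%:C else 0.
Proof.
move=> ws wt'; rewrite /pip pstar_bs // ptr_mul_bs ?walk_rbar // wend_rbar // rbarK eq_sym.
by case: andP => // -[/eqP-> /eqP->]; rewrite mulrC.
Qed.

Lemma pip_mull x y z : pip (x # y) z = pip y (star x # z).
Proof. by rewrite /pip pstar_mul pstarK pmulA. Qed.
Lemma pip_mulr x y z : pip (y # x) z = pip y (z # star x).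
Proof. by rewrite /pip pstar_mul pstarK -pmulA ptr_mulC pmulA. Qed.
Lemma pip_star x y : pip (star x) (star y) = pip y x.
Proof. by rewrite /pip pstarK ptr_mulC. Qed.
Lemma pip_one x : pip x pone = tr x.
Proof. by rewrite /pip pstar_one pone_mul. Qed.

Lemma pip_suml I (r : seq I) (Q : pred I) (f : I -> P) x :
  pip (\sum_(i <- r | Q i) f i) x = \sum_(i <- r | Q i) pip (f i) x.
Proof. by rewrite /pip pmul_sumr; apply: (big_morph tr ptrD ptr0). Qed.
Lemma pip0l x : pip 0 x = 0. Proof. by rewrite /pip pmulx0 ptr0. Qed.
Lemma pip0r x : pip x 0 = 0. Proof. by rewrite /pip pstar0 pmul0 ptr0. Qed.
Lemma pipZl c x y : pip (c *: x) y = c * pip x y.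
Proof. by rewrite /pip pmulZr ptrZ. Qed.
Lemma pipZr c x y : pip x (c *: y) = c^* * pip x y.
Proof. by rewrite /pip pstarZ pmulZl ptrZ. Qed.

Lemma pip_adjoint_ext (f g : P -> P) : linear f -> linear g ->
  (forall v s w t, walk v s -> walk w t -> pip (f (b v s)) (b w t) = pip (b v s) (g (b w t))) ->
  forall x y, pip (f x) y = pip x (g y).
Proof.
move=> lf lg h; apply: (pspan (p := P)) => [y|c x x' e e' y|v s ws].
- by rewrite (lin0 lf) !pip0l.
- by rewrite lf !pip_linl e e'.
apply: (pspan (p := P)) => [|c x x' e e'|w t wt'].
- by rewrite (lin0 lg) !pip0r.
- by rewrite lg !pip_linr e e'.
exact: h.
Qed.

(** * Creation and annihilation operators of edges, cups and caps *)

Definition creat a : P -> P :=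
  pext (fun v s => if dst a == v then b (src a) (a :: s) else 0).
Definition annih a : P -> P :=
  pext (fun v s => if dst a == v then
    if s is d :: t then if d == bar a then wt a *: b (dst d) t else 0 else 0 else 0).

Lemma creat_lin a : linear (creat a). Proof. exact: pext_linear. Qed.
Lemma annih_lin a : linear (annih a). Proof. exact: pext_linear. Qed.

Lemma pe_mulE a x : pe a # x = creat a x + annih a x.
Proof.
move: x; apply: pext_eq => [||v s ws]; first exact: pmul_linr.
  by move=> c x y; rewrite creat_lin annih_lin scalerDr addrACA.
by rewrite mul_pe /creat /annih !pextE //; case: ifP; rewrite ?addr0.
Qed.

(** By [pip_bs], removing a first edge [bar a] changes the square norm of a path only through its
    start, which moves from dst a to src a; [wt a] is the resulting ratio. *)
Lemma annih_adjoint a x y : pip (annih a x) y = pip x (creat (bar a) y).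
Proof.
move: x y; apply: pip_adjoint_ext; [exact: annih_lin|exact: creat_lin|].
move=> v s w t ws wt'; rewrite /annih /creat !pextE //.
rewrite dst_bar src_bar.
case: eqP => [e|ne]; last first.
  rewrite pip0l; case: eqP => // e; last by rewrite pip0r.
  rewrite pip_bs //=; last by rewrite src_bar eqxx dst_bar e.
  by rewrite eq_sym; case: eqP => // e'; case: ne.
subst v; case: s ws => [|d s] /= => [_|/andP [/eqP sd ws]].
  rewrite pip0l; case: eqP => // e; last by rewrite pip0r.
  by rewrite pip_bs //= ?src_bar ?dst_bar ?eqxx ?e // andbF.
have [ed|nd] := eqVneq d (bar a); last first.
  rewrite pip0l; case: eqP => // e; last by rewrite pip0r.
  rewrite pip_bs //= ?src_bar ?dst_bar ?eqxx ?e ?sd ?eqxx //.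
  by rewrite eqseq_cons (negPf nd).
subst d; rewrite dst_bar in ws *; rewrite pipZl.
rewrite (pip_bs ws wt').
have [e|ne] := eqVneq (src a) w; last by rewrite mulr0 pip0r.
subst w; rewrite pip_bs /= ?src_bar ?dst_bar ?eqxx // eqseq_cons eqxx /=.
case: eqP => _; last by rewrite mulr0.
rewrite (_ : wend (dst a) (bar a :: s) = wend (src a) s); last by rewrite /wend /= dst_bar.
by rewrite /wt -rmorphM /=; congr (_%:C); rewrite mulrA divfK ?muneq0.
Qed.

(** Prepending [a] multiplies the square norm of every path at dst a by the same constant, so
    [creat a] is a multiple of a partial isometry and in particular bounded. *)
Lemma creat_pip a x y : pip (creat a x) (creat a y) =
  (mu (src a) / mu (dst a))%:C * pip (pv (dst a) # x) y.
Proof.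
pose k := (mu (src a) / mu (dst a))%:C.
move: x y; apply: (pspan (p := P)) => [y|c x x' e e' y|v s ws].
- by rewrite (lin0 (creat_lin a)) pmulx0 !pip0l mulr0.
- by rewrite creat_lin pmul_linr !pip_linl e e' mulrDr mulrCA.
apply: (pspan (p := P)) => [|c x x' e e'|w t wt'].
- by rewrite (lin0 (creat_lin a)) !pip0r mulr0.
- by rewrite creat_lin !pip_linr e e' mulrDr mulrCA.
rewrite /creat !pextE // mul_pv.
have [e|ne] := eqVneq (dst a) v; last by rewrite !pip0l mulr0.
subst v; rewrite (pip_bs ws wt').
have [e|ne] := eqVneq (dst a) w; last by rewrite pip0r mulr0.
subst w; rewrite pip_bs /= ?eqxx // eqseq_cons eqxx /=; case: eqP => _; last by rewrite mulr0.
by rewrite -rmorphM /=; congr (_%:C); rewrite mulrA divfK ?muneq0.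
Qed.

(* The three parts of the left multiplication by c2 v, see c2_mul. *)
Definition cupl v : P -> P :=
  pext (fun w s => if w == v then \sum_(a | src a == v) wt a *: b v [:: a, bar a & s] else 0).
Definition capl v : P -> P :=
  pext (fun w s => if w == v then
     if s is [:: a, d & t] then if d == bar a then wt a *: b v t else 0 else 0 else 0).
Definition nonemp v : P -> P :=
  pext (fun w s => if (w == v) && (s != [::]) then b v s else 0).

Lemma cupl_lin v : linear (cupl v). Proof. exact: pext_linear. Qed.
Lemma capl_lin v : linear (capl v). Proof. exact: pext_linear. Qed.
Lemma nonemp_lin v : linear (nonemp v). Proof. exact: pext_linear. Qed.

Definition deltaC v : C := (delta v)%:C.

Lemma wtM_bar a : wt a * wt (bar a) = 1 :> C.
Proof.
rewrite /wt src_bar dst_bar -rmorphM /= mulrA divfK ?muneq0 // divff ?muneq0 //.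
Qed.

Lemma delta_wt v : deltaC v = \sum_(a | src a == v) wt a * wt a.
Proof.
rewrite /deltaC /delta rmorph_sum; apply: eq_bigr => a /eqP <-.
by rewrite expr2 rmorphM.
Qed.

Lemma capl_cupl v x : capl v (cupl v x) = deltaC v *: (pv v # x).
Proof.
move: x; apply: pext_eq => [||w s ws].
- exact: lin_comp (capl_lin v) (cupl_lin v).
- by move=> c x y; rewrite pmul_linr scalerDr !scalerA mulrC.
rewrite /cupl pextE // mul_pv [v == w]eq_sym; case: eqP => [e|]; last first.
  by rewrite (lin0 (capl_lin v)) scaler0.
subst w; rewrite (lin_sum (capl_lin v)) delta_wt scaler_suml; apply: eq_bigr => a /eqP sa.
rewrite (linZ (capl_lin v)) /capl pextE ?eqxx; last by rewrite /= src_bar dst_bar !eqxx sa eqxx.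
by rewrite scalerA.
Qed.

Lemma cupl_adjoint v x y : pip (cupl v x) y = pip x (capl v y).
Proof.
move: x y; apply: pip_adjoint_ext; [exact: cupl_lin|exact: capl_lin|].
move=> u s w t ws wt'; rewrite /cupl /capl !pextE //.
have [e|ne] := eqVneq u v; last first.
  rewrite pip0l; case: eqP => [e|_]; last by rewrite pip0r.
  subst w; case: t wt' => [|a [|d t]] /= => [_|_|/and3P [/eqP sa /eqP sd wt']]; rewrite ?pip0r //.
  case: eqP => [ed|_]; last by rewrite pip0r.
  by rewrite pipZr pip_bs ?(negPf ne) ?mulr0 //; rewrite -sa -(dst_bar a) -ed.
subst u; rewrite pip_suml.
have [e|ne] := eqVneq w v; last first.
  rewrite pip0r big1 // => a /eqP sa; rewrite pipZl pip_bs //; last by rewrite /= src_bar dst_bar !eqxx sa eqxx.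
  by rewrite eq_sym (negPf ne) mulr0.
subst w.
have wc a : src a == v -> walk v [:: a, bar a & s].
  by move=> /eqP sa; rewrite /= src_bar dst_bar sa !eqxx.
case: t wt' => [|a [|d t]] /= => [_|/andP[/eqP sa _]|/and3P [/eqP sa /eqP sd wt']].
- by rewrite pip0r big1 // => a sa; rewrite pipZl pip_bs ?wc // eqxx mulr0.
- rewrite pip0r big1 // => d sd; rewrite pipZl pip_bs ?wc //= ?sa ?eqxx //.
  by rewrite eqseq_cons andbF mulr0.
- rewrite (bigD1 a) /= ?sa // big1 ?addr0; last first.
    move=> c /andP [sc /negPf nc]; rewrite pipZl pip_bs ?wc //= ?sa ?sd ?eqxx //.
    by rewrite eqseq_cons nc mulr0.
  rewrite pipZl pip_bs ?wc ?sa //= ?sa ?sd ?eqxx // !eqseq_cons eqxx /=.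
  rewrite eq_sym; case: eqP => [ed|_] /=; last by rewrite pip0r mulr0.
  subst d; rewrite dst_bar sa in wt' *; rewrite pipZr /wt conjcR pip_bs // eqxx /=.
  case: eqP => // _; rewrite (_ : wend v [:: a, bar a & s] = wend v s) //.
  by rewrite /wend /= dst_bar sa.
Qed.

Definition c2 v : P := cupl v (pv v).

(** The three parts are the products in which none, one or both edges of a cup are cancelled. With
    one cancelled edge the weights wt a and wt (bar a) multiply to 1 and the path is returned
    unchanged; this requires a first edge, whence [nonemp]. *)
Lemma c2_mul v x : c2 v # x = cupl v x + capl v x + nonemp v x.
Proof.
move: x; apply: pext_eq => [||w s ws]; first exact: pmul_linr.
  move=> c x y; rewrite cupl_lin capl_lin nonemp_lin !scalerDr.
  by rewrite (addrACA (c *: cupl v x)) (addrACA (_ + _) (c *: nonemp v x)).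
rewrite /c2 {1}/cupl /pv pextE // eqxx pmul_suml.
rewrite /cupl /capl /nonemp !pextE //.
have wc a : src a == v -> walk v [:: a; bar a].
  by move=> /eqP sa; rewrite /= src_bar sa !eqxx.
have ec a : src a == v -> wend v [:: a; bar a] = v.
  by move=> /eqP <-; rewrite /wend /= dst_bar.
have [e|ne] := eqVneq w v; last first.
  rewrite /= !addr0 big1 // => a sa; rewrite pmulZl pmul_bs ?wc // ec // eq_sym (negPf ne) scaler0 //.
subst w; rewrite /=.
under eq_bigr => a sa.
  rewrite pmulZl (pmul_bs P (wc a sa) ws) ec // eqxx (_ : rev _ = [:: bar a; a]) //= scalerDr.
  over.
rewrite big_split /= -addrA; congr (_ + _).
case: s ws => [|a s] /= => [_|/andP [/eqP sa ws]].
  by rewrite addr0 big1 // => a _; rewrite scaler0.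
rewrite (bigD1 a) ?sa //= big1 ?addr0; last first.
  by move=> c /andP [_ nc]; rewrite barK eq_sym (negPf nc) scaler0.
rewrite barK eqxx scalerA wtM_bar scale1r /= [in RHS]addrC; congr (_ + _).
by case: s ws => [|d s] //= _; rewrite addr0.
Qed.

Lemma ptr_star x : tr (star x) = (tr x)^*.
Proof.
move: x; apply: (pspan (p := P)) => [|c x y ex ey|v s ws].
- by rewrite pstar0 ptr0 conjC0.
- by rewrite pstar_lin !ptr_lin ex ey rmorphD rmorphM.
rewrite pstar_bs // !ptr_bs ?walk_rbar //; case: s ws => [|a s] ws; first by rewrite conjcR.
by rewrite rbar_cons; case: (rbar s) => *; rewrite conjC0.
Qed.

Lemma pipC x y : pip y x = (pip x y)^*.
Proof. by rewrite /pip -ptr_star pstar_mul pstarK. Qed.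

Lemma capl_adjoint v x y : pip (capl v x) y = pip x (cupl v y).
Proof. by rewrite pipC -cupl_adjoint -pipC. Qed.

Lemma pv_pv v w : pv v # pv w = if v == w then pv v else 0.
Proof. by rewrite mul_pv; case: eqP => [->|]. Qed.

Lemma cupl_pvl v x : pv v # cupl v x = cupl v x.
Proof.
move: x; apply: pext_eq => [||w s ws]; first exact: lin_comp (pmul_linr _) (cupl_lin v).
  exact: cupl_lin.
rewrite /cupl pextE //; case: eqP => [e|]; last by rewrite pmulx0.
by rewrite pmul_sumr; apply: eq_bigr => a _; rewrite pmulZr mul_pv eqxx.
Qed.
Lemma cupl_pv v x : cupl v (pv v # x) = cupl v x.
Proof.
move: x; apply: pext_eq => [||w s ws]; first exact: lin_comp (cupl_lin v) (pmul_linr _).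
  exact: cupl_lin.
rewrite mul_pv eq_sym; case: eqP => [//|n]; rewrite (lin0 (cupl_lin v)) /cupl pextE //.
by case: eqP.
Qed.
Lemma nonemp_cupl v x : nonemp v (cupl v x) = cupl v x.
Proof.
move: x; apply: pext_eq => [||w s ws]; first exact: lin_comp (nonemp_lin v) (cupl_lin v).
  exact: cupl_lin.
rewrite /cupl pextE //; case: eqP => [e|]; last by rewrite (lin0 (nonemp_lin v)).
subst w; rewrite (lin_sum (nonemp_lin v)); apply: eq_bigr => a /eqP sa.
by rewrite (linZ (nonemp_lin v)) /nonemp pextE ?eqxx //= src_bar dst_bar sa !eqxx.
Qed.
Lemma nonemp_nonemp v x : nonemp v (nonemp v x) = nonemp v x.
Proof.
move: x; apply: pext_eq => [||w s ws]; first exact: lin_comp (nonemp_lin v) (nonemp_lin v).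
  exact: nonemp_lin.
rewrite /nonemp pextE //; case: ifP => [h|_]; last by rewrite (lin0 (pext_linear _)).
by move: h (h) => /andP [/eqP e _] h; subst w; rewrite pextE // h.
Qed.
Lemma capl_nonemp v x : capl v (nonemp v x) = capl v x.
Proof.
move: x; apply: pext_eq => [||w s ws]; first exact: lin_comp (capl_lin v) (nonemp_lin v).
  exact: capl_lin.
rewrite /nonemp /capl pextE //.
case: ifP => [/andP [/eqP e _]|h]; first by subst w; rewrite !pextE ?eqxx.
rewrite (lin0 (pext_linear _)) pextE //.
by move: h; case: eqP => //=; case: s ws.
Qed.
(** This description by the coefficient of the trivial path does not distinguish the two ends of a
    path; it shows that the left and the right multiplication by [c2 v] share this part on loops at
    v. *)
Lemma nonempE v x : nonemp v x = pv v # x - (tr (pv v # x) / (mu v ^+ 2)%:C) *: pv v.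
Proof.
have m0 : ((mu v ^+ 2)%:C : C) != 0 by rewrite eq_complex /= eqxx andbT expf_neq0 ?muneq0.
move: x; apply: pext_eq => [||w s ws]; first exact: nonemp_lin.
  move=> c x y; rewrite pmul_linr ptr_lin scalerBr scalerA mulrDl scalerDl -mulrA.
  by rewrite opprD addrACA.
rewrite /nonemp pextE // mul_pv [v == w]eq_sym; case: eqP => [e|_]; last first.
  by rewrite ptr0 mul0r scale0r subr0.
subst w; rewrite ptr_bs //; case: s ws => [|a s] _ /=.
  by rewrite divff // scale1r subrr.
by rewrite mul0r scale0r subr0.
Qed.

(* c_{2n} at the vertex v, see cloopE. *)
Definition cn v n : P := iter n (cupl v) (pv v).

Lemma pv_cn v n : pv v # cn v n = cn v n.
Proof. by case: n => [|n]; rewrite /cn /= ?pv_pv ?eqxx // cupl_pvl. Qed.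

(** The terms record the fate of the first of the n + 1 cups: intact, half cancelled, or fully
    cancelled; in the last two cases all later cups are cancelled. The proof avoids this case
    analysis by the recurrence c_{2n+4} = c_2 c_{2n+2} - c_{2n+2} - delta c_{2n}. *)
Lemma cn_recl v n y : pv v # y = y ->
  cn v n.+1 # y = cupl v (cn v n # y) + nonemp v (iter n (capl v) y) + iter n.+1 (capl v) y.
Proof.
move=> py; elim: n {-2}n (leqnn n) => [|m IH] [|n] // nm.
- by rewrite /cn /= py -/(c2 v) c2_mul addrAC.
- by rewrite /cn /= py -/(c2 v) c2_mul addrAC.
have c2c k : c2 v # cn v k.+1 = cn v k.+2 + deltaC v *: cn v k + cn v k.+1.
  rewrite c2_mul /cn [capl v _]/= capl_cupl [nonemp v _]/= nonemp_cupl.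
  by rewrite -/(cn v k) pv_cn.
have e k : cn v k.+2 = c2 v # cn v k.+1 - cn v k.+1 - deltaC v *: cn v k.
  by rewrite c2c addrK addrK.
rewrite e !pmulBl pmulA pmulZl c2_mul.
have pc k : pv v # (cn v k # y) = cn v k # y by rewrite -pmulA pv_cn.
have IHn := IH n nm.
set u := cn v n.+1 # y in IHn *.
have -> : nonemp v u = u + nonemp v (iter n.+1 (capl v) y) - iter n.+1 (capl v) y.
  rewrite {1}IHn !(linD (nonemp_lin v)) nonemp_cupl nonemp_nonemp IHn.
  by rewrite [X in _ = X - _]addrAC addrK.
have -> : capl v u = deltaC v *: (cn v n # y) + iter n.+1 (capl v) y + iter n.+2 (capl v) y.
  by rewrite {1}IHn !(linD (capl_lin v)) capl_cupl pc capl_nonemp.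
rewrite !addrA [LHS](ACl (1*6*4*(3*7)*(5*8)*(2*9)))/= !subrr !addr0.
by [].
Qed.

Lemma capl_pv0 v : capl v (pv v) = 0.
Proof. by rewrite /capl /pv pextE // eqxx. Qed.

Lemma capl_cn v n : capl v (cn v n.+1) = deltaC v *: cn v n.
Proof. by rewrite /cn /= capl_cupl -/(cn v n) pv_cn. Qed.

Lemma pip_cn v m n : pip (cn v m) (cn v n) =
  if m == n then deltaC v ^+ n * (mu v ^+ 2)%:C else 0.
Proof.
elim: m n => [|m IH] [|n].
- by rewrite /cn /= pip_bs //= eqxx expr0 mul1r expr2.
- by rewrite /cn /= -capl_adjoint capl_pv0 pip0l.
- by rewrite /cn /= cupl_adjoint capl_pv0 pip0r.
rewrite [cn v m.+1]/cn /= cupl_adjoint capl_cn pipZr /deltaC conjcR IH eqSS.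
by case: eqP; rewrite ?mulr0 // mulrA -exprS.
Qed.

Lemma star_c2 v : star (c2 v) = c2 v.
Proof.
rewrite /c2 /cupl /pv pextE // eqxx pstar_sum; apply: eq_bigr => a /eqP sa.
rewrite pstarZ /wt conjcR pstar_bs /= ?sa ?src_bar ?eqxx // /wend /= dst_bar sa.
by rewrite /rbar /= /rev /= barK.
Qed.

Lemma cn_recr v n : cn v n.+2 = c2 v # cn v n.+1 - cn v n.+1 - deltaC v *: cn v n.
Proof.
rewrite c2_mul /cn [capl v _]/= capl_cupl [nonemp v _]/= nonemp_cupl -/(cn v n) pv_cn.
by rewrite !addrK.
Qed.

Lemma c2_pvr v : c2 v # pv v = c2 v.
Proof. by rewrite -{1}star_c2 -pstar_pv -pstar_mul cupl_pvl star_c2. Qed.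

Lemma cn_c2 v n : cn v n # c2 v = c2 v # cn v n.
Proof.
suff [] : cn v n # c2 v = c2 v # cn v n /\ cn v n.+1 # c2 v = c2 v # cn v n.+1 by [].
elim: n => [|n [IH1 IH2]]; first by split; rewrite // /cn /= c2_pvr cupl_pvl.
split=> //; rewrite cn_recr !(pmulBl, pmulBr) pmulZl pmulZr IH1 IH2.
by rewrite pmulA IH2.
Qed.

Lemma star_cn v n : star (cn v n) = cn v n.
Proof.
suff [] : star (cn v n) = cn v n /\ star (cn v n.+1) = cn v n.+1 by [].
elim: n => [|n [IH1 IH2]]; first by split; rewrite /cn /= ?pstar_pv ?star_c2.
split=> //; rewrite cn_recr !pstarB pstarZ pstar_mul star_c2 IH1 IH2 cn_c2.
by rewrite /deltaC conjcR.
Qed.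

(** Among the cups at dst a only the one that begins with [bar a] meets [a], with total weight wt
    (bar a) wt a = 1. *)
Lemma annih_cupl a x : annih a (cupl (dst a) x) = creat a x.
Proof.
move: x; apply: pext_eq => [||w s ws]; first exact: lin_comp (annih_lin a) (cupl_lin _).
  exact: creat_lin.
rewrite /cupl pextE // /creat pextE // [dst a == w]eq_sym.
case: eqP => [e|_]; last by rewrite (lin0 (annih_lin a)).
subst w; rewrite (lin_sum (annih_lin a)) (bigD1 (bar a)) /= ?src_bar // big1 ?addr0.
  rewrite (linZ (annih_lin a)) /annih pextE /= ?src_bar ?dst_bar ?barK ?eqxx //.
  by rewrite scalerA mulrC wtM_bar scale1r.
  by rewrite src_bar.
move=> d /andP [/eqP sd /negPf nd]; rewrite (linZ (annih_lin a)) /annih pextE.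
  by rewrite eqxx nd scaler0.
by rewrite /= src_bar dst_bar sd !eqxx.
Qed.

Lemma annih_pv a v : annih a (pv v) = 0.
Proof. by rewrite /annih /pv pextE //; case: ifP. Qed.

Definition zsum v m : P := \sum_(n < m) (-1) ^+ n *: cn v n.

(** By [annih_cupl], annihilation on c_{2n+2} equals creation on c_{2n}, so the alternating sum
    telescopes. The surviving term tends to 0 in norm when delta < 1, which is why edges annihilate
    zhat. *)
Lemma pe_zsum a m : pe a # zsum (dst a) m.+1 = (-1) ^+ m *: creat a (cn (dst a) m).
Proof.
elim: m => [|m IH].
  by rewrite /zsum big_ord_recl big_ord0 addr0 !expr0 !scale1r pe_mulE annih_pv addr0.
rewrite /zsum big_ord_recr -/(zsum _ _) pmulDr IH pmulZr pe_mulE /= annih_cupl.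
by rewrite scalerDr addrA [X in X + _]addrC -addrA -scalerDl exprS mulN1r subrr scale0r addr0.
Qed.

Lemma pv_zsum v m : pv v # zsum v m = zsum v m.
Proof. by rewrite pmul_sumr; apply: eq_bigr => n _; rewrite pmulZr pv_cn. Qed.

Lemma pe_zsum0 a v m : dst a != v -> pe a # zsum v m = 0.
Proof.
move=> n; rewrite -pv_zsum -pmulA mul_pvr /wend /= (negPf n) pmul0 //.
Qed.

Lemma star_zsum v m : star (zsum v m) = zsum v m.
Proof.
rewrite pstar_sum; apply: eq_bigr => n _.
by rewrite pstarZ rmorphXn rmorphN rmorph1 star_cn.
Qed.

Lemma pip_pv v x y : pip (pv v # x) y = pip x (pv v # y).
Proof. by rewrite pip_mull pstar_pv. Qed.
Lemma pv_idem v x : pv v # (pv v # x) = pv v # x.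
Proof. by rewrite -pmulA pv_pv eqxx. Qed.

Lemma nonemp_adjoint v x y : pip (nonemp v x) y = pip x (nonemp v y).
Proof.
move: x y; apply: pip_adjoint_ext; [exact: nonemp_lin|exact: nonemp_lin|].
move=> u s w t ws wt'; rewrite /nonemp !pextE //.
have [e|ne] := eqVneq u v => /=; last first.
  rewrite pip0l; case: ifP => [/andP [/eqP e _]|_]; last by rewrite pip0r.
  by subst w; rewrite pip_bs // (negPf ne).
have [e'|ne] := eqVneq w v => /=; last first.
  by rewrite pip0r; subst u; case: ifP => _; rewrite ?pip0l // pip_bs // eq_sym (negPf ne).
subst u w; case: s ws => [|a s] ws; case: t wt' => [|c t] wt'; rewrite ?pip0l ?pip0r //= pip_bs //= ?andbF //.
Qed.

Lemma zsum_pv v m : zsum v m # pv v = zsum v m.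
Proof. by rewrite -{1}star_zsum -(pstar_pv v) -pstar_mul pv_zsum star_zsum. Qed.

Lemma capl_pvl v x : pv v # capl v x = capl v x.
Proof.
move: x; apply: pext_eq => [||w s ws]; first exact: lin_comp (pmul_linr _) (capl_lin v).
  exact: capl_lin.
rewrite /capl pextE //; case: eqP => [e|]; last by rewrite pmulx0.
case: s ws => [|a [|d t]] ws; rewrite ?pmulx0 //; case: eqP; rewrite ?pmulx0 // => _.
by rewrite pmulZr mul_pv eqxx.
Qed.
Lemma cupl_pvr v w x : cupl v (x # pv w) = cupl v x # pv w.
Proof.
move: x; apply: pext_eq => [||u s ws]; first exact: lin_comp (cupl_lin v) (pmul_linl _).
  exact: lin_comp (pmul_linl _) (cupl_lin v).
rewrite mul_pvr /cupl [in RHS]pextE //; case: eqP => [e|ne].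
  rewrite pextE //; case: eqP => [e'|]; last by rewrite pmul0.
  rewrite pmul_suml; apply: eq_bigr => a /eqP sa; rewrite pmulZl mul_pvr.
  by rewrite /wend /= dst_bar sa -e'  -/(wend u s) e eqxx.
rewrite (lin0 (pext_linear _)); case: eqP => [e'|]; last by rewrite pmul0.
rewrite pmul_suml big1 // => a /eqP sa; rewrite pmulZl mul_pvr /wend /= dst_bar sa -e' -/(wend u s).
by case: eqP => // _; rewrite scaler0.
Qed.
Lemma capl_pvr v w x : capl v (x # pv w) = capl v x # pv w.
Proof.
move: x; apply: pext_eq => [||u s ws]; first exact: lin_comp (capl_lin v) (pmul_linl _).
  exact: lin_comp (pmul_linl _) (capl_lin v).
have -> : capl v (b u s # pv w) = if wend u s == w then capl v (b u s) else 0.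
  by rewrite mul_pvr; case: ifP => // _; rewrite (lin0 (capl_lin v)).
rewrite /capl pextE //; case: (eqVneq u v) => [e|_]; last by rewrite pmul0 if_same.
subst u; case: s ws => [|a [|d t]] //=; rewrite ?pmul0 ?if_same // => /and3P [/eqP sa /eqP sd wt'].
case: (d =P bar a) => [ed|_]; last by rewrite pmul0 if_same.
rewrite pmulZl mul_pvr (_ : wend v [:: a, d & t] = wend v t); last by rewrite /wend /= ed dst_bar sa.
by case: ifP => //; rewrite scaler0.
Qed.

(** * Cups and caps at the end of a path, obtained by conjugating with the involution *)

Definition cupr v x := star (cupl v (star x)).
Definition capr v x := star (capl v (star x)).
Lemma cupr_lin v : linear (cupr v).
Proof. by move=> c x y; rewrite /cupr pstar_lin cupl_lin pstar_lin conjCK. Qed.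
Lemma capr_lin v : linear (capr v).
Proof. by move=> c x y; rewrite /capr pstar_lin capl_lin pstar_lin conjCK. Qed.

Lemma cupr_adjoint v x y : pip (cupr v x) y = pip x (capr v y).
Proof. by rewrite /cupr /capr -[y in LHS]pstarK pip_star -capl_adjoint -{2}[x]pstarK pip_star. Qed.
Lemma capr_adjoint v x y : pip (capr v x) y = pip x (cupr v y).
Proof. by rewrite pipC -cupr_adjoint -pipC. Qed.

Lemma cupr_pvr v x : cupr v x # pv v = cupr v x.
Proof. by rewrite /cupr -{1}(pstar_pv v) -pstar_mul cupl_pvl. Qed.
Lemma capr_pvr v x : capr v x # pv v = capr v x.
Proof. by rewrite /capr -{1}(pstar_pv v) -pstar_mul capl_pvl. Qed.
Lemma cupr_pvl v w x : pv w # cupr v x = cupr v (pv w # x).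
Proof. by rewrite /cupr pstar_mul pstar_pv cupl_pvr pstar_mul pstar_pv. Qed.
Lemma capr_pvl v w x : pv w # capr v x = capr v (pv w # x).
Proof. by rewrite /capr pstar_mul pstar_pv capl_pvr pstar_mul pstar_pv. Qed.
Lemma capr_cupr v x : capr v (cupr v x) = deltaC v *: (x # pv v).
Proof. by rewrite /capr /cupr pstarK capl_cupl pstarZ /deltaC conjcR pstar_mul pstarK pstar_pv. Qed.
Lemma cupr_pv0 v : cupr v (pv v) = c2 v.
Proof. by rewrite /cupr pstar_pv star_c2. Qed.
Lemma capr_pv0 v : capr v (pv v) = 0.
Proof. by rewrite /capr pstar_pv capl_pv0 pstar0. Qed.

(** [star] exchanges right and left multiplication by the self-adjoint [c2 v]; the common part
    [nonemp] drops out of the commutator. *)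
Lemma mul_c2 v x : pv v # x = x -> x # pv v = x ->
  x # c2 v - c2 v # x = cupr v x + capr v x - (cupl v x + capl v x).
Proof.
move=> px xp; rewrite -{1}[x]pstarK -{1}(star_c2 v) -pstar_mul !c2_mul !pstarD.
rewrite -/(cupr v x) -/(capr v x).
have -> : star (nonemp v (star x)) = nonemp v x.
  rewrite !nonempE -{1 2}(pstar_pv v) -pstar_mul xp px pstarB pstarK pstarZ pstar_pv.
  by rewrite ptr_star rmorphM fmorphV /= conjCK conjcR.
by rewrite opprD addrACA subrr addr0.
Qed.

Lemma cupr_bs v u s : walk u s ->
  cupr v (b u s) = if wend u s == v then \sum_(a | src a == v) wt a *: b u (rcons (rcons s a) (bar a)) else 0.
Proof.
move=> ws; rewrite /cupr pstar_bs // /cupl pextE ?walk_rbar //.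
case: eqP => [e|]; last by rewrite pstar0.
rewrite pstar_sum; apply: eq_bigr => a /eqP sa.
rewrite pstarZ /wt conjcR pstar_bs; last by rewrite /= src_bar dst_bar sa !eqxx -e walk_rbar.
rewrite !rbar_cons rbarK barK (_ : wend v _ = u) // /wend /= dst_bar sa -e.
exact: wend_rbar.
Qed.

Lemma capr_bs v u s c d : walk u (rcons (rcons s c) d) ->
  capr v (b u (rcons (rcons s c) d)) = if (dst d == v) && (c == bar d) then wt c *: b u s else 0.
Proof.
move=> ws; rewrite /capr pstar_bs // wend_rcons /capl pextE; last first.
  by have := walk_rbar ws; rewrite wend_rcons.
have -> : rbar (rcons (rcons s c) d) = [:: bar d, bar c & rbar s] by rewrite !rbar_rcons.
case: eqP => [e|] /=; last by rewrite pstar0.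
rewrite (inj_eq (inv_inj (@barK R G))); case: eqP => [ec|_]; last by rewrite pstar0.
move: ws; rewrite !walk_rcons => /andP [/andP [ws /eqP sc] _].
rewrite pstarZ /wt conjcR -ec -e -[d]barK -ec dst_bar sc pstar_bs ?walk_rbar // wend_rbar // rbarK.
by [].
Qed.

Lemma capr_bs0 v u : capr v (b u [::]) = 0.
Proof. by rewrite /capr pstar_bs // /capl pextE //; case: ifP => _; rewrite pstar0. Qed.
Lemma capr_bs1 v a : capr v (b (src a) [:: a]) = 0.
Proof.
rewrite /capr pstar_bs /= ?eqxx // /capl pextE /= ?src_bar ?eqxx //.
by case: ifP => _; rewrite pstar0.
Qed.

Lemma cupl_cupr v x : cupl v (cupr v x) = cupr v (cupl v x).
Proof.
move: x; apply: pext_eq => [||u s ws]; first exact: lin_comp (cupl_lin v) (cupr_lin v).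
  exact: lin_comp (cupr_lin v) (cupl_lin v).
have wc c : src c == v -> u == v -> walk v [:: c, bar c & s].
  by move=> /eqP sc /eqP e; rewrite /= src_bar dst_bar sc !eqxx -e.
have wr a : src a == v -> wend u s == v -> walk u (rcons (rcons s a) (bar a)).
  by move=> /eqP sc /eqP e; rewrite !walk_rcons ws wend_rcons src_bar sc e !eqxx.
rewrite cupr_bs // /cupl [in RHS]pextE //.
have [e|ne] := eqVneq (wend u s) v; last first.
  rewrite (lin0 (pext_linear _)); have [e'|ne'] := eqVneq u v; last by rewrite (lin0 (cupr_lin v)).
  rewrite (lin_sum (cupr_lin v)) big1 // => a sa; rewrite (linZ (cupr_lin v)) cupr_bs ?wc ?e' ?eqxx //.
  rewrite (_ : wend v _ = wend u s) ?(negPf ne) ?scaler0 //.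
  by rewrite /wend /= dst_bar (eqP sa) e'.
rewrite (lin_sum (pext_linear _)).
have [e'|ne'] := eqVneq u v; last first.
  rewrite (lin0 (cupr_lin v)) big1 // => a sa; rewrite (linZ (pext_linear _)) pextE ?wr ?e ?eqxx //.
  by rewrite (negPf ne') scaler0.
subst u; rewrite (lin_sum (cupr_lin v)).
under eq_bigr => a sa.
  rewrite (linZ (pext_linear _)) pextE ?wr ?e ?eqxx // scaler_sumr.
  over.
under [RHS]eq_bigr => a sa.
  rewrite (linZ (cupr_lin v)) cupr_bs ?wc ?eqxx // (_ : wend v _ = v); last by rewrite /wend /= dst_bar (eqP sa).
  rewrite eqxx scaler_sumr.
  over.
rewrite exchange_big; apply: eq_bigr => a _; apply: eq_bigr => c _.
by rewrite !scalerA mulrC.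
Qed.

(** A cup at the start and a cap at the end involve different edges unless the path is too short. On
    the trivial path the cap closes the inserted cup itself, which yields delta times the
    coefficient of that path. *)
Lemma capr_cupl v x : capr v (cupl v x) =
  cupl v (capr v x) + (deltaC v * (tr (pv v # x) / (mu v ^+ 2)%:C)) *: pv v.
Proof.
have m0 : ((mu v ^+ 2)%:C : C) != 0 by rewrite eq_complex /= eqxx andbT expf_neq0 ?muneq0.
move: x; apply: pext_eq => [||u s ws]; first exact: lin_comp (capr_lin v) (cupl_lin v).
  move=> c x y; rewrite capr_lin cupl_lin pmul_linr ptr_lin scalerDr addrACA; congr (_ + _).
  by rewrite mulrDl mulrDr scalerDl scalerA; congr (_ *: _ + _); ring.
rewrite mul_pv /cupl [in LHS]pextE //; have [e|ne] := eqVneq u v; last first.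
  rewrite (lin0 (capr_lin v)) ptr0 mul0r mulr0 scale0r addr0.
  have pc : pv u # capr v (b u s) = capr v (b u s) by rewrite capr_pvl mul_pv eqxx.
  by rewrite -pc -/(cupl v _) -cupl_pv -pmulA pv_pv eq_sym (negPf ne) pmul0 (lin0 (cupl_lin v)).
subst u; rewrite ?eqxx (lin_sum (capr_lin v)).
have wc c : src c == v -> walk v [:: c, bar c & s].
  by move=> /eqP sc; rewrite /= src_bar dst_bar sc !eqxx.
case: (lastP s) ws wc => [|s1 d] ws wc.
  rewrite capr_bs0 (lin0 (pext_linear _)) add0r ptr_bs // divff // mulr1 delta_wt scaler_suml.
  apply: eq_bigr => a /eqP sa; rewrite (linZ (capr_lin v)).
  rewrite (@capr_bs v v [::] a (bar a)) /= ?dst_bar ?src_bar ?sa ?barK ?eqxx //.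
  by rewrite scalerA.
rewrite ptr_bs // (_ : (if rcons s1 d is [::] then _ else 0) = 0) ?mul0r ?mulr0 ?scale0r ?addr0; last by case: (s1).
case: (lastP s1) ws wc => [|s2 c] ws wc.
  move: ws => /=; rewrite andbT => /eqP sd.
  have -> : capr v (b v [:: d]) = 0 by have := capr_bs1 v d; rewrite sd.
  rewrite (lin0 (pext_linear _)) big1 // => a /eqP sa.
  have w1 := wc a; rewrite sa eqxx in w1; have {}w1 := w1 isT.
  rewrite (linZ (capr_lin v)) -[b _ _]/(b v (rcons (rcons [:: a] (bar a)) d)) capr_bs //.
  case: eqP => [dd|_] /=; last by rewrite scaler0.
  (* On a path of one edge d the cap could only close the cup if d were a loop at v, which
     bipartiteness excludes. *)
  by have := bipartite d; rewrite sd dd; case: (even_vertex v).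
rewrite capr_bs //; case: andP => [[/eqP dv /eqP cd]|h]; last first.
  rewrite (lin0 (pext_linear _)) big1 // => a sa; rewrite (linZ (capr_lin v)).
  rewrite -[b _ _]/(b v (rcons (rcons [:: a, bar a & s2] c) d)) capr_bs; last by have := wc a sa.
  by case: andP h => //; rewrite scaler0.
move: ws; rewrite !walk_rcons => /andP [/andP [ws _] _].
rewrite (linZ (pext_linear _)) pextE // eqxx scaler_sumr; apply: eq_bigr => a sa.
rewrite (linZ (capr_lin v)) -[b _ _]/(b v (rcons (rcons [:: a, bar a & s2] c) d)) capr_bs; last by have := wc a sa.
by rewrite dv cd !eqxx /= !scalerA mulrC.
Qed.

(** Each cap removes two edges. By adjointness, high powers of [cupl v] are orthogonal to any given
    element of F(G); this is the source of the weak limits used on tracial vectors. *)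
Lemma capl_nilpotent v x : exists N, forall i, (N <= i)%N -> iter i (capl v) x = 0.
Proof.
have il i : linear (iter i (capl v)).
  elim: i => [|i IH]; first by move=> c y z.
  exact: lin_comp (capl_lin v) IH.
move: x; apply: (pspan (p := P)) => [|c x y [N hN] [M hM]|w s ws].
- by exists 0 => i _; rewrite (lin0 (il i)).
- exists (maxn N M) => i; rewrite geq_max => /andP [h1 h2].
  by rewrite (il i) hN // hM // scaler0 addr0.
exists (size s).+1 => i; elim: i w s ws => // i IH w s ws; rewrite ltnS => si.
rewrite iterSr /capl pextE // -/(capl v); case: ifP => [_|_]; last by rewrite (lin0 (il i)).
case: s ws si => [|a [|d t]] /= ws si; rewrite ?(lin0 (il i)) //.
case: eqP => [ed|_]; last by rewrite (lin0 (il i)).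
have [wv|wv] := boolP (walk v t); last by rewrite (bs_nwalk P wv) scaler0 (lin0 (il i)).
by rewrite (linZ (il i)) IH ?scaler0 // ltnW.
Qed.

Lemma capl_bs v s : walk v s -> capl v (b v s) =
  if s is [:: a, d & t] then if d == bar a then wt a *: b v t else 0 else 0.
Proof. by move=> ws; rewrite /capl pextE // eqxx. Qed.

Lemma pip_pv_loop v a s : walk v (a :: s) -> pip (b v (a :: s)) (pv v) = 0.
Proof. by move=> ws; rewrite pip_bs // andbF. Qed.
End PathAlgebraTheory.

(** * Connected graphs *)

Section GraphFacts.
Variables (R : realType) (G : graph R).
Local Notation V := (vertex G).
Local Notation E := (edge G).

Hypothesis ne : (2 <= nedges G)%N.

Lemma two_edges_neq : exists a c : E, c != a /\ c != bar a.
Proof.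
move: ne => /card_gt1P [_ [_ [/imsetP [a _ ->] /imsetP [c _ ->] n]]].
exists a, c; split; apply: contraNneq n => ->; first by [].
by rewrite barK finset.setUC.
Qed.

Hypothesis gc : graph_connected G.

Lemma connected_ind (Q : V -> Prop) : (forall a : E, Q (src a) -> Q (dst a)) ->
  forall u v, Q u -> Q v.
Proof.
move=> hQ u v; case/connectP: (gc u v) => s.
elim: s u => [|w s IH] u /=; first by move=> _ ->.
case/andP => /existsP [a /andP [/eqP au /eqP aw]] ps ev Qu.
by apply: (IH w) => //; rewrite -aw; apply: hQ; rewrite au.
Qed.

Lemma delta_gt0 (v : V) : 0 < delta v.
Proof.
have [a _] := two_edges_neq.
have [e ev] : exists e : E, src e = v.
  apply: (@connected_ind (fun v => exists e : E, src e = v) _ (src a)); last by exists a.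
  by move=> d _; exists (bar d); rewrite src_bar.
rewrite /delta (bigD1 e) ?ev //=; apply: ltr_pwDl.
  by rewrite exprn_gt0 // divr_gt0 ?mu_gt0.
by apply: sumr_ge0 => d _; rewrite sqr_ge0.
Qed.

(* Otherwise the only edges are a and bar a. *)
Lemma turn_exists : exists a c : E, dst a = src c /\ c != bar a.
Proof.
have [a [c [n1 n2]]] := two_edges_neq; apply: contrapT => h.
have nt (a' c' : E) : dst a' = src c' -> c' = bar a'.
  by move=> e; apply/eqP; apply: contrapT => /negP n; apply: h; exists a', c'.
have ends v : v = src a \/ v = dst a.
  apply: (@connected_ind (fun v => v = src a \/ v = dst a) _ (src a)); last by left.
  move=> d [e|e]; last by left; rewrite (nt a d) ?dst_bar.
  by right; rewrite (nt (bar a) d) ?barK // dst_bar.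
case: (ends (src c)) => e.
  by move: n1; rewrite (nt (bar a) c) ?dst_bar // barK eqxx.
by move: n2; rewrite (nt a c) ?eqxx.
Qed.
End GraphFacts.

(** * The range of a projection and the corner of a von Neumann algebra *)

Section Subspace.
Variables (R : realType) (H : hilbert R).
Local Notation C := (R[i]).

(** A II_1 factor must contain the identity of the Hilbert space on which it acts, so M(G) p has to
    act on the range of p; the range is therefore made a [hilbert] of its own, as a subtype of
    [H]. *)
Record projection := Projection {
  proj :> H -> H;
  proj_bounded : bounded_op proj;
  proj_idem : forall x, proj (proj x) = proj x;
  proj_adjoint : is_adjoint proj proj
}.

Variable q : projection.
Local Notation ip := (hdot H).

Definition fixed : pred H := fun x => `[< q x = x >].

Lemma fixedP x : reflect (q x = x) (x \in fixed).
Proof. exact: asboolP. Qed.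

Lemma proj_lin : linear q. Proof. exact: bounded_lin (proj_bounded q). Qed.

Lemma fixed_submod : submod_closed fixed.
Proof.
split; first by apply/fixedP; rewrite (lin0 proj_lin).
by move=> c x y /fixedP ex /fixedP ey; apply/fixedP; rewrite proj_lin ex ey.
Qed.

HB.instance Definition _ := GRing.isSubmodClosed.Build C H fixed fixed_submod.

Definition psub : Type := {x : H | fixed x}.
HB.instance Definition _ := SubChoice.copy psub {x : H | fixed x}.
HB.instance Definition _ := [SubChoice_isSubLmodule of psub by <:].

Definition pnorm (x : psub) : C := `|val x|.
Lemma pnormD x y : pnorm (x + y) <= pnorm x + pnorm y.
Proof. exact: ler_normD. Qed.
Lemma pnormZ l x : pnorm (l *: x) = `|l| * pnorm x.
Proof. by rewrite /pnorm linearZ normrZ. Qed.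
Lemma pnorm0_eq0 x : pnorm x = 0 -> x = 0.
Proof. by move=> /eqP; rewrite normr_eq0 => /eqP h; apply: val_inj; rewrite h linear0. Qed.

HB.instance Definition _ := @Lmodule_isNormed.Build C psub pnorm pnormD pnormZ pnorm0_eq0.

Lemma pnormE (x : psub) : `|x| = `|val x| :> C. Proof. by []. Qed.

Definition pproj (h : H) : psub := exist _ (q h) (introT (fixedP _) (proj_idem q h)).

Lemma val_pproj h : val (pproj h) = q h. Proof. by []. Qed.
Lemma pprojK (x : psub) : pproj (val x) = x.
Proof. by apply: val_inj; rewrite val_pproj; apply/fixedP; apply: valP. Qed.

Lemma pproj_lin : linear pproj.
Proof. by move=> c x y; apply: val_inj; rewrite linearP !val_pproj proj_lin. Qed.

(** The limit is found in [H] and projected back; as the projection is bounded and fixes the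
    elements of the range, it is the limit there as well. *)
Lemma psub_complete (F : set_system psub) : ProperFilter F -> cauchy F -> cvg F.
Proof.
move=> FF /cauchyP cF.
have [l hl] : exists l : H, (val : psub -> H) @ F --> l.
  apply/cvg_ex; apply: cauchy_net_cvg => e e0.
  have [x hx] := cF e e0; exists (val x).
  apply: filterS hx => y; rewrite -ball_normE; exact.
apply/cvg_ex; exists (pproj l); apply/cvgrPdist_lt => e e0.
have [_ [c [c0 hc]]] := (bounded_opP _).1 (proj_bounded q).
have e1 : 0 < e / c by rewrite divr_gt0.
move/cvgrPdist_lt: hl => /(_ _ e1); apply: filterS => y.
rewrite ltr_pdivlMr // mulrC => hy; rewrite pnormE -(pprojK y) -(linB pproj_lin) val_pproj.
by apply: le_lt_trans hy; apply: hc.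
Qed.
HB.instance Definition _ := Uniform_isComplete.Build psub psub_complete.

Definition pdot (x y : psub) : C := ip (val x) (val y).

Lemma pdotBl (y : psub) : zmod_morphism (pdot^~ y).
Proof. by move=> x x'; rewrite /pdot linearB ipBl. Qed.
Lemma pdotBr (x : psub) : zmod_morphism (pdot x).
Proof. by move=> y y'; exact: ipBr. Qed.
Lemma pdotZl (y : psub) : scalable_for *%R (pdot^~ y).
Proof. by move=> c x; rewrite /pdot linearZ ipZl. Qed.
Lemma pdotZr (x : psub) : scalable_for (Num.conj \; *%R) (pdot x).
Proof. by move=> c y; exact: ipZr. Qed.
HB.instance Definition _ := isBilinear.Build C psub psub C *%R (Num.conj \; *%R) pdot
  pdotBl pdotBr pdotZl pdotZr.

Lemma pdot_herm (x y : psub) : pdot x y = (-1) ^+ false * (pdot y x)^*.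
Proof. by rewrite mul1r /pdot ipC. Qed.
HB.instance Definition _ := isHermitianSesquilinear.Build C psub false (@Num.conj C) pdot pdot_herm.

Lemma pdot_gt0 (x : psub) : x != 0 -> 0 < pdot x x.
Proof. by move=> n; rewrite /pdot hdot_norm exprn_gt0 // -pnormE normr_gt0. Qed.
HB.instance Definition _ := isDotProduct.Build C psub pdot pdot_gt0.

Lemma pdot_norm (x : psub) : pdot x x = `|x| ^+ 2.
Proof. by rewrite /pdot hdot_norm. Qed.

Definition range_hilbert : hilbert R := @Hilbert R psub pdot pdot_norm.
End Subspace.

Section Corner.
Variables (R : realType) (H : hilbert R) (q : projection H).
Local Notation C := (R[i]).
Local Notation K := (range_hilbert q).
Implicit Types (T X : H -> H) (S : K -> K).

Definition emb (x : K) : H := val (x : psub q).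
Definition cpr (h : H) : K := pproj q h.

Lemma emb_lin : linear emb. Proof. by move=> c x y; rewrite /emb linearP. Qed.
Lemma cpr_lin : linear cpr. Proof. exact: pproj_lin. Qed.
Lemma emb_cpr h : emb (cpr h) = q h. Proof. by []. Qed.
Lemma cpr_emb x : cpr (emb x) = x. Proof. exact: pprojK. Qed.
Lemma norm_emb x : `|emb x| = `|x|. Proof. by []. Qed.
Lemma emb_inj : injective emb. Proof. exact: val_inj. Qed.
Lemma q_emb x : q (emb x) = emb x. Proof. by rewrite -emb_cpr cpr_emb. Qed.
Lemma cpr_q h : cpr (q h) = cpr h. Proof. by rewrite -emb_cpr cpr_emb. Qed.
Lemma ip_emb (x y : K) : hdot K x y = hdot H (emb x) (emb y). Proof. by []. Qed.
Lemma ip_cpr (h : H) (y : K) : hdot K (cpr h) y = hdot H h (emb y).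
Proof. by rewrite ip_emb emb_cpr proj_adjoint q_emb. Qed.
Lemma ip_cprr (h : H) (y : K) : hdot K y (cpr h) = hdot H (emb y) h.
Proof. by rewrite ipC ip_cpr -ipC. Qed.

Definition compress T : K -> K := fun x => cpr (T (emb x)).
Definition dilate S : H -> H := fun h => emb (S (cpr h)).

Lemma compress_bounded T : bounded_op T -> bounded_op (compress T).
Proof.
move=> /bounded_opP [lT [c [c0 hc]]]; apply/bounded_opP; split.
  by move=> a x y; rewrite /compress emb_lin lT cpr_lin.
have [_ [d [d0 hd]]] := (bounded_opP _).1 (proj_bounded q).
exists (d * c); split; first by rewrite mulr_gt0.
move=> x; by rewrite -norm_emb emb_cpr -mulrA (le_trans (hd _)) // ler_wpM2l ?(ltW d0) // -norm_emb hc.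
Qed.

Lemma dilate_bounded S : bounded_op S -> bounded_op (dilate S).
Proof.
move=> /bounded_opP [lS [c [c0 hc]]]; apply/bounded_opP; split.
  by move=> a x y; rewrite /dilate cpr_lin lS emb_lin.
have [_ [d [d0 hd]]] := (bounded_opP _).1 (proj_bounded q).
exists (c * d); split; first by rewrite mulr_gt0.
move=> h; rewrite norm_emb -mulrA (le_trans (hc _)) // ler_wpM2l ?(ltW c0) //.
by rewrite -norm_emb emb_cpr hd.
Qed.

Lemma compress_adjoint T T' : is_adjoint T T' -> is_adjoint (compress T) (compress T').
Proof. by move=> a x y; rewrite ip_cpr a ip_cprr. Qed.
Lemma dilate_adjoint S S' : is_adjoint S S' -> is_adjoint (dilate S) (dilate S').
Proof. by move=> a x y; rewrite /dilate -ip_cprr a ip_cpr. Qed.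

Lemma compress_dilate S : compress (dilate S) = S.
Proof. by apply/funext => x; rewrite /compress /dilate !cpr_emb. Qed.
Lemma dilate_compress T : dilate (compress T) = q \o T \o q.
Proof. by []. Qed.
Lemma dilate_comp S S' : dilate (S \o S') = dilate S \o dilate S'.
Proof. by apply/funext => h; rewrite /dilate /= cpr_emb. Qed.
Lemma dilate_id : dilate idfun = q. Proof. by []. Qed.
Lemma dilate_inj S S' : dilate S = dilate S' -> S = S'.
Proof. by move=> e; rewrite -(compress_dilate S) e compress_dilate. Qed.
Lemma dilate_q S h : dilate S (q h) = dilate S h.
Proof. by rewrite /dilate cpr_q. Qed.
Lemma q_dilate S h : q (dilate S h) = dilate S h.
Proof. by rewrite /dilate q_emb. Qed.

Lemma compress_cpr T h : (forall k, T (q k) = q (T k)) -> compress T (cpr h) = cpr (T h).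
Proof. by move=> Tq; rewrite /compress emb_cpr Tq cpr_q. Qed.
Lemma emb_compress T x : (forall k, T (q k) = q (T k)) -> emb (compress T x) = T (emb x).
Proof. by move=> Tq; rewrite /compress emb_cpr -Tq q_emb. Qed.

Variable A : set (H -> H).
Hypotheses (vA : von_neumann A) (Aq : A q) (cAq : commutant A q).

(** [dilate S] is S extended by 0 to the orthogonal complement. Membership is thus read inside [A],
    and stability under adjoints is inherited from [A]; [corner_compress] provides the elements that
    come from [A] by compression. *)
Definition corner : set (K -> K) := [set S | bounded_op S /\ A (dilate S)].

Let bA := vn_bounded vA.
Let qA T h : A T -> q (T h) = T (q h).
Proof. exact: commutantE cAq. Qed.

Lemma vn_comp T T' : A T -> A T' -> A (T \o T').
Proof. by rewrite -(vn_bicommutant vA); apply: commutant_comp. Qed.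
Lemma corner_compress T : A T -> corner (compress T).
Proof.
move=> AT; split; first by apply: compress_bounded; apply: bA.
by rewrite dilate_compress; apply: vn_comp => //; apply: vn_comp.
Qed.

Lemma compress_comp T T' : A T' -> compress (T \o T') = compress T \o compress T'.
Proof. by move=> AT'; apply/funext => x; rewrite /compress /= emb_cpr (qA _ AT') q_emb. Qed.

(** For X in the commutant of [A], the compression of X commutes with the corner. So an S in the
    bicommutant of the corner commutes with it, and hence the extension of S by 0 commutes with
    X. *)
Lemma corner_von_neumann : von_neumann corner.
Proof.
have bN : corner `<=` @bounded_op R K by move=> S [].
split=> //.
- move=> S [bS AS]; have [bS' aS] := adjointP bS; split => //.
  by rewrite -(adjointE (bA AS) (dilate_adjoint aS)); apply: (vn_adjoint vA).
apply/seteqP; split; last exact: sub_bicommutant.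
move=> S cS; have bS := commutant_bounded cS; split => //.
rewrite -(vn_bicommutant vA); apply/commutantP; first exact: commutant_bounded.
split=> [|X h cX]; first exact: dilate_bounded.
have bX := commutant_bounded cX.
have Xq k : X (q k) = q (X k) := commutantE k cX Aq.
have cN : commutant corner (compress X).
  apply/commutantP => //; split=> [|T x [bT AT]]; first exact: compress_bounded.
  apply: emb_inj; rewrite /compress emb_cpr.
  have e y : dilate T (emb y) = emb (T y) by rewrite /dilate cpr_emb.
  by rewrite -e (commutantE _ cX AT) q_dilate -e emb_cpr dilate_q.
have := congr1 emb (commutantE (cpr h) cS cN).
by rewrite compress_cpr // emb_compress.
Qed.

(** As [q] is central, testing S against the compression of T is the same as testing the extension
    of S by 0 against T. *)
Lemma corner_center S : corner S -> commutant corner S -> commutant A (dilate S).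
Proof.
move=> [bS AS] cS; apply/commutantP => //; split=> [|T h AT]; first exact: dilate_bounded.
have := congr1 emb (commutantE (cpr h) cS (corner_compress AT)).
by rewrite compress_cpr ?emb_compress // => k; rewrite qA.
Qed.
End Corner.
(** Express |J| + 1 of the vectors in |J| generators: the coefficient matrix has a nonzero left
    kernel, a linear dependence which orthogonality forbids. *)
Lemma orthogonal_not_span (R : realType) (H : hilbert R) (J : finType) (u : nat -> H) (g : J -> H) :
  (forall k, hdot H (u k) (u k) != 0) -> (forall k l, k != l -> hdot H (u k) (u l) = 0) ->
  ~ forall k, exists c : J -> R[i], u k = \sum_j c j *: g j.
Proof.
move=> u1 u0 /choice [c hc]; pose n := #|J|.
pose A : 'M[R[i]]_(n.+1, n) := \matrix_(k, j) c k (enum_val j).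
have /rowV0Pn [y /sub_kermxP yA y0] : kermx A != 0.
  by rewrite -mxrank_eq0 mxrank_ker -lt0n subn_gt0 ltnS rank_leq_col.
have [l yl] : exists l, y 0 l != 0.
  apply: contrapT => h; case/eqP: y0; apply/rowP => l; rewrite mxE.
  by apply/eqP; apply: contrapT => /negP n0; apply: h; exists l.
have s0 : \sum_(k < n.+1) y 0 k *: u k = 0.
  under eq_bigr => k _ do rewrite hc scaler_sumr.
  rewrite exchange_big big1 //= => j _.
  under eq_bigr => k _ do rewrite scalerA.
  rewrite -scaler_suml; have := congr1 (fun B : 'rV_n => B 0 (enum_rank j)) yA.
  rewrite !mxE; under eq_bigr => k _ do rewrite mxE enum_rankK.
  by move=> ->; rewrite scale0r.
have := ip0l (u l); rewrite -{1}s0 ip_suml (bigD1 l) //= big1.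
  by rewrite addr0 ipZl => /eqP; rewrite mulf_eq0 (negPf yl) (negPf (u1 l)).
by move=> k n0; rewrite ipZl u0 ?mulr0.
Qed.

(** * The representation on the completion *)

Section Completion.
Variables (R : realType) (G : graph R) (P : path_algebra G).
Variables (H : hilbert R) (iota : P -> H).
Local Notation C := (R[i]).
Local Notation V := (vertex G).
Local Notation E := (edge G).
Local Notation b := (@bs R G P).
Local Notation pv := (@pv R G P).
Local Notation pe := (@pe R G P).
Local Notation pone := (@pone R G P).
Local Notation creat := (@creat R G P).
Local Notation annih := (@annih R G P).
Local Notation cupl := (@cupl R G P).
Local Notation capl := (@capl R G P).
Local Notation nonemp := (@nonemp R G P).
Local Notation cn := (@cn R G P).
Local Notation zsum := (@zsum R G P).
Local Notation star := (@pstar R G P).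
Local Notation tr := (@ptr R G P).
Local Notation "x # y" := (@pmul R G P x y) (at level 40, left associativity).
Local Notation ip := (hdot H).
Implicit Types (x y z : P) (v w : V) (s t : seq E) (a d : E) (S T : H -> H).
Hypothesis li : linear iota.
Hypothesis ip_iota : forall x y, ip (iota x) (iota y) = pip x y.
Hypothesis di : dense (range iota).

Lemma norm_iota x : `|iota x| ^+ 2 = pip x x.
Proof. by rewrite -hdot_norm ip_iota. Qed.

Lemma iota_ip0 h : (forall x, ip (iota x) h = 0) -> h = 0.
Proof. by move=> e; apply: (dense_ip0 di) => _ [x _ <-]. Qed.

Lemma iota_bounded_eq S T : bounded_op S -> bounded_op T ->
  (forall x, S (iota x) = T (iota x)) -> S = T.
Proof. by move=> bS bT e; apply: (bounded_dense_eq di) => // _ [x _ <-]. Qed.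

Definition fbounded (f : P -> P) :=
  exists c : C, 0 < c /\ forall x, `|iota (f x)| <= c * `|iota x|.

Lemma fb_lincomb c f g : fbounded f -> fbounded g -> fbounded (fun x => c *: f x + g x).
Proof.
move=> [k [k0 hk]] [l [l0 hl]]; exists (`|c| * k + l); split.
  by rewrite ltr_wpDl // mulr_ge0 // ltW.
move=> x; rewrite li (le_trans (ler_normD _ _)) // normrZ mulrDl -mulrA.
by rewrite lerD // ler_wpM2l.
Qed.

Lemma fb_comp f g : fbounded f -> fbounded g -> fbounded (fun x => f (g x)).
Proof.
move=> [k [k0 hk]] [l [l0 hl]]; exists (k * l); split; first by rewrite mulr_gt0.
by move=> x; rewrite (le_trans (hk _)) // -mulrA ler_wpM2l // ltW.
Qed.

Lemma norm_le_cs (h k : H) : ip h k = `|k| ^+ 2 -> `|k| <= `|h|.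
Proof.
move=> e; have [->|n0] := eqVneq k 0; first by rewrite normr0.
have p : 0 < `|k| by rewrite normr_gt0.
rewrite -(ler_pM2r p) -expr2 -e -[leLHS]ger0_norm ?e ?exprn_ge0 // -e.
exact: cauchy_schwarz.
Qed.

Lemma norm_pv v x : `|iota (pv v # x)| <= `|iota x|.
Proof.
by apply: norm_le_cs; rewrite norm_iota ip_iota pip_pv pv_idem.
Qed.

Lemma norm_le_of_sqr (h k : H) (c : C) : 0 <= c -> `|h| ^+ 2 <= c ^+ 2 * `|k| ^+ 2 -> `|h| <= c * `|k|.
Proof.
by move=> c0; rewrite -exprMn ler_pXn2r // nnegrE ?mulr_ge0.
Qed.

Lemma fb_creat a : fbounded (creat a).
Proof.
have k0 : 0 < (mu (src a) / mu (dst a))%:C by rewrite ltcR divr_gt0 ?mu_gt0.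
(* The bound k + 1 satisfies k <= (k + 1)^2 and so dispenses with the square root of k. *)
set k := _%:C in k0; exists (k + 1); split; first by rewrite addr_gt0.
move=> x; apply: norm_le_of_sqr; first by rewrite addr_ge0 // ltW.
rewrite norm_iota creat_pip -/k.
have -> : pip (pv (dst a) # x) x = `|iota (pv (dst a) # x)| ^+ 2.
  by rewrite norm_iota !pip_pv pv_idem.
apply: ler_pM; rewrite ?exprn_ge0 //; first exact: ltW.
- rewrite expr2 mulrDr mulr1 addrC -subr_ge0.
  rewrite (_ : _ - k = k * k + k + 1); last by ring.
  by rewrite !addr_ge0 // ?mulr_ge0 // ltW.
- by rewrite ler_pXn2r ?nnegrE // norm_pv.
Qed.

Lemma fb_annih a : fbounded (annih a).
Proof.
have [c [c0 hc]] := fb_creat (bar a); exists c; split => // x.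
have [->|n0] := eqVneq (iota (annih a x)) 0; first by rewrite normr0 mulr_ge0 // ltW.
have p : 0 < `|iota (annih a x)| by rewrite normr_gt0.
rewrite -(ler_pM2r p) -expr2 norm_iota annih_adjoint -ip_iota.
rewrite -[leLHS]ger0_norm; last by rewrite ip_iota -annih_adjoint -norm_iota exprn_ge0.
apply: (le_trans (cauchy_schwarz _ _)).
by rewrite [leRHS]mulrAC [leRHS]mulrC ler_wpM2l.
Qed.

(** Boundedness is stable under products and linear combinations, so [pa_ind] reduces it to vertices
    and to the two parts of an edge. *)
Lemma fb_mul x : fbounded (fun y => x # y).
Proof.
move: x; apply: pa_ind => [|c x x' hx hx'|v|a x hx].
- by exists 1; split => // x; rewrite pmul0 (lin0 li) normr0 mul1r.
- have [k [k0 hk]] := fb_lincomb c hx hx'; exists k; split => // y.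
  by rewrite pmul_linl.
- by exists 1; split => // x; rewrite mul1r norm_pv.
- have h : fbounded (fun y => pe a # y).
    have [k [k0 hk]] := fb_lincomb 1 (fb_creat a) (fb_annih a); exists k; split => // y.
    by rewrite pe_mulE -[creat _ _]scale1r.
  have [k [k0 hk]] := fb_comp h hx; exists k; split => // y.
  by rewrite pmulA.
Qed.

Lemma norm_star x : `|iota (star x)| = `|iota x|.
Proof. by apply/eqP; rewrite -(@eqrXn2 _ 2) // !norm_iota pip_star. Qed.

(** As the functional is a trace, [star] is isometric and turns right into left multiplication. *)
Lemma fb_mulr y : fbounded (fun x => x # y).
Proof.
have [k [k0 hk]] := fb_mul (star y); exists k; split => // x.
by rewrite -norm_star pstar_mul -(norm_star x).
Qed.

(** Repeats the body of [lambda] over an abstract path algebra, so that the two become convertible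
    for [F_path_algebra]. *)
Definition lam x : H -> H :=
  xget (0 : H -> H) [set T | bounded_op T /\ forall y, T (iota y) = iota (x # y)].
Definition rmu x : H -> H :=
  xget (0 : H -> H) [set T | bounded_op T /\ forall y, T (iota y) = iota (y # x)].

Lemma fb_extension f : linear f -> fbounded f ->
  exists T, bounded_op T /\ forall y, T (iota y) = iota (f y).
Proof.
move=> lf [c [c0 hc]].
exact: (@dense_extension _ _ P iota (fun y => iota (f y)) c li (lin_comp li lf) di c0 hc).
Qed.

Lemma lamP x : bounded_op (lam x) /\ forall y, lam x (iota y) = iota (x # y).
Proof.
rewrite /lam; case: xgetP => [T _ //|h].
by have [T hT] := fb_extension (pmul_linr x) (fb_mul x); case: (h T).
Qed.
Lemma rmuP x : bounded_op (rmu x) /\ forall y, rmu x (iota y) = iota (y # x).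
Proof.
rewrite /rmu; case: xgetP => [T _ //|h].
by have [T hT] := fb_extension (pmul_linl x) (fb_mulr x); case: (h T).
Qed.
Lemma lam_bounded x : bounded_op (lam x). Proof. exact: (lamP x).1. Qed.
Lemma lamE x y : lam x (iota y) = iota (x # y). Proof. exact: (lamP x).2. Qed.
Lemma rmu_bounded x : bounded_op (rmu x). Proof. exact: (rmuP x).1. Qed.
Lemma rmuE x y : rmu x (iota y) = iota (y # x). Proof. exact: (rmuP x).2. Qed.

Lemma iota_is_adjoint S T : bounded_op S -> bounded_op T ->
  (forall x y, ip (S (iota x)) (iota y) = ip (iota x) (T (iota y))) -> is_adjoint S T.
Proof.
move=> bS bT h; have [bS' hS'] := adjointP bS.
suff <- : adjoint S = T by [].
apply: iota_bounded_eq => // y; apply/subr0_eq/iota_ip0 => x.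
by rewrite ipBr -hS' h subrr.
Qed.

Lemma lam_adjoint x : is_adjoint (lam x) (lam (star x)).
Proof.
apply: iota_is_adjoint; [exact: lam_bounded|exact: lam_bounded|] => y z.
by rewrite !lamE !ip_iota pip_mull.
Qed.
Lemma rmu_adjoint x : is_adjoint (rmu x) (rmu (star x)).
Proof.
apply: iota_is_adjoint; [exact: rmu_bounded|exact: rmu_bounded|] => y z.
by rewrite !rmuE !ip_iota pip_mulr.
Qed.

Lemma lamM x y : lam (x # y) = lam x \o lam y.
Proof.
apply: iota_bounded_eq; [exact: lam_bounded|exact: bounded_comp (lam_bounded _) (lam_bounded _)|].
by move=> z; rewrite /= !lamE pmulA.
Qed.
Lemma lam_lin c x y : lam (c *: x + y) = c *: lam x + lam y.
Proof.
apply: iota_bounded_eq; [exact: lam_bounded|exact: bounded_lincomb (lam_bounded _) (lam_bounded _)|].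
by move=> z; rewrite !fctE !lamE pmul_linl li.
Qed.
Lemma rmuM x y : rmu (x # y) = rmu y \o rmu x.
Proof.
apply: iota_bounded_eq; [exact: rmu_bounded|exact: bounded_comp (rmu_bounded _) (rmu_bounded _)|].
by move=> z; rewrite /= !rmuE pmulA.
Qed.
Lemma rmu_lin c x y : rmu (c *: x + y) = c *: rmu x + rmu y.
Proof.
apply: iota_bounded_eq; [exact: rmu_bounded|exact: bounded_lincomb (rmu_bounded _) (rmu_bounded _)|].
by move=> z; rewrite !fctE !rmuE pmul_linr li.
Qed.

Definition Lset : set (H -> H) := range lam.
Definition MG : set (H -> H) := commutant (commutant Lset).

Lemma Lset_bounded : Lset `<=` @bounded_op R H.
Proof. by move=> _ [x _ <-]; apply: lam_bounded. Qed.
Lemma Lset_adjoint T : Lset T -> Lset (adjoint T).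
Proof.
move=> [x _ <-]; exists (star x) => //.
by rewrite (adjointE (lam_bounded x) (lam_adjoint x)).
Qed.
Lemma Lset_comm_adjoint T : commutant Lset T -> commutant Lset (adjoint T).
Proof. by apply: commutant_adjoint; [exact: Lset_bounded|exact: Lset_adjoint]. Qed.

Lemma MG_von_neumann : von_neumann MG.
Proof.
apply: von_neumann_commutant; first exact: commutant_bounded.
by apply: commutant_adjoint; [exact: commutant_bounded|exact: Lset_comm_adjoint].
Qed.
Lemma MG_bounded T : MG T -> bounded_op T. Proof. exact: commutant_bounded. Qed.
Lemma MG_adjoint T : MG T -> MG (adjoint T). Proof. by case: MG_von_neumann => _ h _; apply: h. Qed.
Lemma MG_lam x : MG (lam x).
Proof. by apply: (sub_bicommutant Lset_bounded); exists x. Qed.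
Lemma MG_comp S T : MG S -> MG T -> MG (S \o T). Proof. exact: commutant_comp. Qed.
Lemma MG_lincomb c S T : MG S -> MG T -> MG (c *: S + T).
Proof. exact/commutant_lincomb/commutant_bounded. Qed.
Lemma MG_id : MG (idfun : H -> H). Proof. exact: commutant_id. Qed.

Lemma rmu_comm y : commutant Lset (rmu y).
Proof.
split=> [|_ [x _ <-]]; first exact: rmu_bounded.
apply: iota_bounded_eq; [exact: bounded_comp (rmu_bounded _) (lam_bounded _)
  |exact: bounded_comp (lam_bounded _) (rmu_bounded _)|].
by move=> z; rewrite /= rmuE !lamE rmuE pmulA.
Qed.
Lemma MG_rmu T y h : MG T -> T (rmu y h) = rmu y (T h).
Proof. by move=> mT; apply: (commutantE _ mT); apply: rmu_comm. Qed.

Definition Om : H := iota (pone).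

Lemma rmu_Om y : rmu y Om = iota y. Proof. by rewrite rmuE pone_mul. Qed.
Lemma lam_Om y : lam y Om = iota y. Proof. by rewrite lamE pmul_one. Qed.
(** [rmu y] commutes with T and maps 1 to y. This is what makes 1 a separating vector, see
    [MG_inj]. *)
Lemma MG_iota T y : MG T -> T (iota y) = rmu y (T Om).
Proof. by move=> mT; rewrite -(MG_rmu y _ mT) rmu_Om. Qed.

Lemma MG_inj S T : MG S -> MG T -> S Om = T Om -> S = T.
Proof.
move=> mS mT e; apply: iota_bounded_eq; try exact: MG_bounded.
by move=> x; rewrite (MG_iota x mS) (MG_iota x mT) e.
Qed.

(** Moving T across and commuting it with [rmu y] gives <u, y> = <star y, T 1> for y in F(G). As
    [star] is isometric, |<u, y>| <= |T 1| |y|; then y is taken close to u. *)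
Lemma norm_adjoint_Om_le T : MG T -> `|adjoint T Om| <= `|T Om|.
Proof.
move=> mT; have [bT' aT] := adjointP (MG_bounded mT).
set u := adjoint T Om.
have hu y : `|ip u (iota y)| <= `|T Om| * `|iota y|.
  have -> : ip u (iota y) = ip (iota (star y)) (T Om).
    have aT' := is_adjoint_sym aT.
    rewrite /u aT' (MG_iota y mT) -(is_adjoint_sym (rmu_adjoint y)).
    by rewrite rmuE pone_mul.
  by rewrite (le_trans (cauchy_schwarz _ _)) // norm_star mulrC.
have [->|n0] := eqVneq u 0; first by rewrite normr0.
have p : 0 < `|u| by rewrite normr_gt0.
rewrite -(ler_pM2r p) -expr2; apply/ler_addgt0Pr => e e0.
have c0 : 0 < `|u| + `|T Om| by rewrite ltr_wpDr.
have e1 : 0 < e / (`|u| + `|T Om|) by rewrite divr_gt0.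
have [_ [y _ <-] hy] := dense_approx u di e1.
have hy' : (`|u| + `|T Om|) * `|u - iota y| <= e.
  by rewrite mulrC -ler_pdivlMr // ltW.
rewrite -hdot_norm -[X in ip _ X](subrK (iota y)) ipDr -[leLHS]ger0_norm; last first.
  by rewrite -ipDr subrK ip_ge0.
apply: (le_trans (ler_normD _ _)).
apply: (@le_trans _ _ (`|u| * `|u - iota y| + `|T Om| * (`|u| + `|u - iota y|))).
  apply: lerD; first exact: cauchy_schwarz.
  apply: (le_trans (hu y)); rewrite ler_wpM2l // -{1}[iota y](subKr u).
  exact: ler_normB.
by rewrite mulrDr addrCA lerD2l -mulrDl.
Qed.

Lemma norm_adjoint_Om T : MG T -> `|adjoint T Om| = `|T Om|.
Proof.
move=> mT; apply/eqP; rewrite eq_le norm_adjoint_Om_le //=.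
by rewrite -{1}(adjointK (MG_bounded mT)) norm_adjoint_Om_le //; apply: MG_adjoint.
Qed.

(* Polarize |T Om| = |T^* Om|. *)
Lemma MG_tracial S T : MG S -> MG T -> ip (S (T Om)) Om = ip (T (S Om)) Om.
Proof.
move=> mS mT.
have [bS' aS] := adjointP (MG_bounded mS); have [bT' aT] := adjointP (MG_bounded mT).
have q (c : C) : ip (c *: T Om + adjoint S Om) (c *: T Om + adjoint S Om) =
    ip (c^* *: adjoint T Om + S Om) (c^* *: adjoint T Om + S Om).
  have mU : MG (c *: T + adjoint S) by apply: MG_lincomb => //; apply: MG_adjoint.
  have := norm_adjoint_Om mU.
  rewrite (adjointE (MG_bounded mU) (is_adjoint_lincomb c aT (is_adjoint_sym aS))).
  by rewrite !hdot_norm /= !fctE => ->.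
have nT := norm_adjoint_Om mT; have nS := norm_adjoint_Om mS.
pose A := ip (S (T Om)) Om; pose B := ip (T (S Om)) Om.
have e1 : ip (T Om) (adjoint S Om) = A by rewrite -aS.
have e2 : ip (S Om) (adjoint T Om) = B by rewrite -aT.
have q' (c : C) : c * A + c^* * A^* = c^* * B^* + c * B.
  move: (q c); rewrite !(ipDl, ipDr, ipZl, ipZr) conjCK !hdot_norm nT nS.
  rewrite e1 e2 [ip (adjoint S Om) _]ipC e1 [ip (adjoint T Om) _]ipC e2.
  set X := `|_| ^+ 2; set Y := `|_| ^+ 2 => h.
  apply: (addrI (c * (c^* * X) + Y)); transitivity (c * (c^* * X + A) + (c^* * A^* + Y)); first by ring.
  by rewrite h; ring.
(* [q'] says that the real part of c (A - B) vanishes; c = 1 and c = i give A = B. *)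
have h1 := q' 1; have h2 := q' 'i.
rewrite conjC1 !mul1r in h1; rewrite conjCi in h2.
apply: (mulfI (_ : 2 * 'i != 0 :> C)).
  by rewrite mulf_neq0 ?pnatr_eq0 ?neq0Ci.
rewrite -/A -/B.
transitivity ('i * (A + A^*) + ('i * A + - 'i * A^*)); first by ring.
by rewrite h1 h2; ring.
Qed.
(** * The vectors zhat *)

Lemma delta_ge0 v : 0 <= delta v.
Proof. by apply: sumr_ge0 => e _; rewrite sqr_ge0. Qed.

Definition rr v : C := (Num.sqrt (delta v))%:C.
Lemma rr_ge0 v : 0 <= rr v. Proof. by rewrite lecR sqrtr_ge0. Qed.
Lemma rr_sqr v : rr v ^+ 2 = deltaC v.
Proof. by rewrite /rr -rmorphXn /= sqr_sqrtr ?delta_ge0. Qed.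
Lemma rr_lt1 v : delta v < 1 -> rr v < 1.
Proof. by move=> h; rewrite -(ltr_pXn2r (ltn0Sn 1)) ?nnegrE ?rr_ge0 // rr_sqr expr1n ltcR. Qed.

Lemma norm_cupl v x : `|iota (cupl v x)| <= rr v * `|iota x|.
Proof.
apply: norm_le_of_sqr; first exact: rr_ge0.
rewrite norm_iota cupl_adjoint capl_cupl pipZr /deltaC conjcR rr_sqr ler_wpM2l ?lecR ?delta_ge0 //.
rewrite -(pip_pv v) -pv_idem (pip_pv v) pip_pv pv_idem -pip_pv -pv_idem pip_pv -norm_iota.
by rewrite ler_pXn2r ?nnegrE // norm_pv.
Qed.

Lemma norm_capl v x : `|iota (capl v x)| <= rr v * `|iota x|.
Proof.
have [->|n0] := eqVneq (iota (capl v x)) 0; first by rewrite normr0 mulr_ge0 // rr_ge0.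
have p : 0 < `|iota (capl v x)| by rewrite normr_gt0.
rewrite -(ler_pM2r p) -expr2 norm_iota capl_adjoint -ip_iota.
rewrite -[leLHS]ger0_norm; last by rewrite ip_iota -capl_adjoint -norm_iota exprn_ge0.
apply: (le_trans (cauchy_schwarz _ _)).
by rewrite [leRHS]mulrAC [leRHS]mulrC ler_wpM2l // norm_cupl.
Qed.

Lemma norm_nonemp v x : `|iota (nonemp v x)| <= `|iota x|.
Proof. by apply: norm_le_cs; rewrite norm_iota ip_iota nonemp_adjoint nonemp_nonemp. Qed.

Lemma norm_cn v n : `|iota (cn v n)| = rr v ^+ n * (mu v)%:C.
Proof.
have m0 : 0 <= (mu v)%:C by rewrite lecR ltW // mu_gt0.
apply/eqP; rewrite -(@eqrXn2 _ 2) // ?mulr_ge0 ?exprn_ge0 ?rr_ge0 //.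
by rewrite norm_iota pip_cn eqxx exprMn -exprM mulnC exprM rr_sqr rmorphXn.
Qed.

Lemma pow_small (q : R) : 0 <= q -> q < 1 -> forall e : C, 0 < e ->
  \forall n \near \oo, (q%:C) ^+ n < e.
Proof.
move=> q0 q1 e e0.
have eE : e = (complex.Re e)%:C by apply/real_complexE/gtr0_real.
have e'0 : 0 < complex.Re e by rewrite -ltcR -eE.
have /cvg_expr /cvgrPdist_lt /(_ _ e'0) : `|q| < 1 by rewrite ger0_norm.
apply: filterS => n; rewrite sub0r normrN ger0_norm ?exprn_ge0 // => h.
by rewrite eE -rmorphXn ltcR.
Qed.

Lemma geom_le (q : C) m : 0 <= q -> q < 1 -> \sum_(n < m) q ^+ n <= (1 - q)^-1.
Proof.
move=> q0 q1; have p : 0 < 1 - q by rewrite subr_gt0.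
rewrite -(ler_pM2l p) mulfV ?gt_eqF //.
have -> : (1 - q) * \sum_(n < m) q ^+ n = 1 - q ^+ m.
  elim: m => [|m IH]; first by rewrite big_ord0 mulr0 expr0 subrr.
  by rewrite big_ord_recr mulrDr IH exprS /=; ring.
by rewrite lerBlDr lerDl exprn_ge0.
Qed.

Lemma zsum_tail v N j : delta v < 1 ->
  `|iota (zsum v (N + j)) - iota (zsum v N)| <= (mu v)%:C / (1 - rr v) * rr v ^+ N.
Proof.
move=> dv; have r0 := rr_ge0 v; have p : 0 < 1 - rr v by rewrite subr_gt0 rr_lt1.
have m0 : 0 <= (mu v)%:C by rewrite lecR ltW // mu_gt0.
(* Multiplied by 1 - rr v the bound becomes a telescoping difference, fit for induction on j. *)
suff h : (1 - rr v) * `|iota (zsum v (N + j)) - iota (zsum v N)| <= (mu v)%:C * (rr v ^+ N - rr v ^+ (N + j)).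
  rewrite mulrAC ler_pdivlMr // mulrC (le_trans h) // ler_wpM2l // lerBlDr lerDl.
  by rewrite exprn_ge0.
elim: j => [|j IH]; first by rewrite addn0 !subrr normr0 !mulr0.
rewrite addnS {1}/zsum big_ord_recr /= -/(zsum v (N + j)) (linD li) (linZ li).
rewrite addrAC.
apply: (@le_trans _ _ ((1 - rr v) * (`|iota (zsum v (N + j)) - iota (zsum v N)| + rr v ^+ (N + j) * (mu v)%:C))).
  rewrite ler_wpM2l ?(ltW p) // (le_trans (ler_normD _ _)) // lerD2l normrZ.
  by rewrite normrX normrN1 expr1n mul1r norm_cn.
rewrite mulrDr -lerBrDr (le_trans IH) // -subr_ge0.
set X := (X in 0 <= X); rewrite (_ : X = 0) // /X exprS; ring.
Qed.

Lemma zsum_cvg v : delta v < 1 -> cvg ((fun m => iota (zsum v m)) @ \oo).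
Proof.
move=> dv; apply: cauchy_net_cvg => e e0.
have p : 0 < 1 - rr v by rewrite subr_gt0 rr_lt1.
have mp : 0 < (mu v)%:C by rewrite ltcR mu_gt0.
have e1 : 0 < e / ((mu v)%:C / (1 - rr v)) by rewrite !divr_gt0.
have s1 : Num.sqrt (delta v) < 1 by rewrite -ltcR; apply: rr_lt1.
have [N _ hN] := pow_small (sqrtr_ge0 (delta v)) s1 e1.
exists (iota (zsum v N)); exists N => // m /= Nm.
rewrite distrC -(subnKC Nm) (le_lt_trans (zsum_tail N (m - N) dv)) //.
have := hN N (leqnn N); rewrite -/(rr v) ltr_pdivlMr ?divr_gt0 // mulrC //.
Qed.

Definition zhat v : H := lim ((fun m => iota (zsum v m)) @ \oo).
Lemma zhatP v : delta v < 1 -> (fun m => iota (zsum v m)) @ \oo --> zhat v.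
Proof. exact: zsum_cvg. Qed.

(** Density replaces whatever constant bounds [T] by [K]; a [K] valid for a whole sequence of
    operators on F(G) thereby stays uniform on [H]. *)
Lemma iota_norm_le T (K : C) : bounded_op T -> 0 <= K ->
  (forall y, `|T (iota y)| <= K * `|iota y|) -> forall h, `|T h| <= K * `|h|.
Proof.
move=> bT K0 hK h; have [lT [c [c0 hc]]] := (bounded_opP T).1 bT.
apply/ler_addgt0Pr => e e0.
have cK : 0 < c + K by rewrite ltr_wpDr.
have e1 : 0 < e / (c + K) by rewrite divr_gt0.
have [_ [y _ <-] hy] := dense_approx h di e1.
have hy' : (c + K) * `|h - iota y| <= e by rewrite mulrC -ler_pdivlMr // ltW.
rewrite -{1}(subrK (iota y) h) (linD lT) (le_trans (ler_normD _ _)) //.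
apply: (@le_trans _ _ (c * `|h - iota y| + K * (`|h| + `|h - iota y|))).
  apply: lerD => //; apply: (le_trans (hK y)); rewrite ler_wpM2l //.
  by rewrite -{1}(subKr h (iota y)) ler_normB.
by rewrite mulrDr addrCA lerD2l -mulrDl.
Qed.

(* By cn_recl, the left multiplication S_m by zsum v m satisfies
   S_(m+1) = pv v - cupl v o S_m + (a geometric sum of operators), and cupl v has
   norm sqrt (delta v) < 1. *)
Lemma zsum_mul_norm v : delta v < 1 -> exists2 K : C, 0 <= K &
  forall m y, `|iota (zsum v m # y)| <= K * `|iota y|.
Proof.
move=> dv; set r := rr v; have r0 : 0 <= r := rr_ge0 v.
have p : 0 < 1 - r by rewrite subr_gt0 rr_lt1.
have ip0 : 0 <= (1 - r)^-1 by rewrite invr_ge0 ltW.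
have r1 : r <= 1 by rewrite -subr_ge0 ltW.
(* The recursion bounds the next operator by 1 + r K + 2 / (1 - r) = B + r K, and K = B / (1 - r) is
   the fixed point of this bound. *)
pose B := 1 + 2 * (1 - r)^-1.
have B0 : 0 <= B by rewrite addr_ge0 // mulr_ge0.
exists (B / (1 - r)); first by rewrite mulr_ge0.
move=> m y.
have -> : zsum v m # y = zsum v m # (pv v # y).
  by rewrite -pmulA zsum_pv.
have := norm_pv v y; have : pv v # (pv v # y) = pv v # y by rewrite pv_idem.
move: (pv v # y) => y' py hy.
apply: (@le_trans _ _ (B / (1 - r) * `|iota y'|)); last by rewrite ler_wpM2l // mulr_ge0.
have capn n : `|iota (iter n (capl v) y')| <= r ^+ n * `|iota y'|.
  elim: n => [|n IH]; first by rewrite mul1r.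
  by rewrite iterS (le_trans (norm_capl _ _)) // exprS -mulrA ler_wpM2l.
elim: m => [|m IH]; first by rewrite /zsum big_ord0 pmul0 (lin0 li) normr0 !mulr_ge0.
have -> : zsum v m.+1 # y' = y' - cupl v (zsum v m # y') -
    \sum_(n < m) (-1) ^+ n *: (nonemp v (iter n (capl v) y') + iter n.+1 (capl v) y').
  rewrite /zsum big_ord_recl pmulDl expr0 scale1r {1}/cn /= py -addrA; congr (_ + _).
  rewrite !pmul_suml (lin_sum (@cupl_lin R G P v)) -!sumrN -big_split /=; apply: eq_bigr => n _.
  rewrite !pmulZl (linZ (@cupl_lin R G P v)) -!scaleNr -scalerDr addrA -cn_recl //.
  by rewrite /bump leq0n add1n exprS mulN1r.
rewrite !(linB li) (le_trans (ler_normB _ _)) //.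
have s1 : `|iota (\sum_(n < m) (-1) ^+ n *: (nonemp v (iter n (capl v) y') + iter n.+1 (capl v) y'))|
     <= 2 * (1 - r)^-1 * `|iota y'|.
  rewrite (lin_sum li) (le_trans (ler_norm_sum _ _ _)) //.
  apply: (@le_trans _ _ (\sum_(n < m) 2 * r ^+ n * `|iota y'|)).
    apply: ler_sum => n _; rewrite (linZ li) normrZ normrX normrN1 expr1n mul1r (linD li).
    rewrite (le_trans (ler_normD _ _)) // mulr_natl mulr2n mulrDl lerD //.
      by rewrite (le_trans (norm_nonemp _ _)).
    by rewrite iterS (le_trans (norm_capl _ _)) // (le_trans _ (capn n)) // ler_piMl.
  rewrite -mulr_suml -mulr_sumr ler_wpM2r // ler_wpM2l // geom_le //.
  by rewrite -subr_gt0.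
have s2 : `|iota y' - iota (cupl v (zsum v m # y'))| <= `|iota y'| + r * (B / (1 - r) * `|iota y'|).
  rewrite (le_trans (ler_normB _ _)) // lerD2l (le_trans (norm_cupl _ _)) // ler_wpM2l //.
apply: (le_trans (lerD s2 s1)); rewrite le_eqVlt; apply/orP; left; apply/eqP.
by rewrite /B; field; rewrite gt_eqF.
Qed.

Lemma rmu_zhat_lim v y : delta v < 1 -> (fun m => iota (zsum v m # y)) @ \oo --> rmu y (zhat v).
Proof.
move=> dv; have h : (rmu y \o (fun m => iota (zsum v m))) @ \oo --> rmu y (zhat v).
  by apply: bounded_cvg; [exact: rmu_bounded|exact: zhatP].
suff -> : (fun m => iota (zsum v m # y)) = rmu y \o (fun m => iota (zsum v m)) by [].
by apply/funext => m /=; rewrite rmuE.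
Qed.
Lemma lam_zhat_lim v x : delta v < 1 -> (fun m => iota (x # zsum v m)) @ \oo --> lam x (zhat v).
Proof.
move=> dv; have h : (lam x \o (fun m => iota (zsum v m))) @ \oo --> lam x (zhat v).
  by apply: bounded_cvg; [exact: lam_bounded|exact: zhatP].
suff -> : (fun m => iota (x # zsum v m)) = lam x \o (fun m => iota (zsum v m)) by [].
by apply/funext => m /=; rewrite lamE.
Qed.

Lemma pe_zsum_small v a (e : C) : delta v < 1 -> 0 < e ->
  \forall m \near \oo, `|iota (pe a # zsum v m)| <= e.
Proof.
move=> dv e0; have [k [k0 hk]] := fb_creat a.
have mp : 0 < (mu v)%:C by rewrite ltcR mu_gt0.
have s1 : Num.sqrt (delta v) < 1 by rewrite -ltcR; apply: rr_lt1.
have e1 : 0 < e / (k * (mu v)%:C) by rewrite divr_gt0 // mulr_gt0.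
have [N _ hN] := pow_small (sqrtr_ge0 (delta v)) s1 e1.
exists N.+1 => // -[//|m] /= Nm.
have [da|da] := eqVneq (dst a) v; last by rewrite pe_zsum0 // (lin0 li) normr0 ltW.
subst v; rewrite pe_zsum (linZ li) normrZ normrX normrN1 expr1n mul1r.
apply: (le_trans (hk _)); rewrite norm_cn.
have /ltW := hN m Nm; rewrite -/(rr _) ler_pdivlMr ?mulr_gt0 //.
by rewrite mulrCA.
Qed.

Lemma lam_pe_zhat v a : delta v < 1 -> lam (pe a) (zhat v) = 0.
Proof.
move=> dv; apply: (@norm_eps0 _ _ _ 1) => // e e0; rewrite mul1r -[lam _ _]subr0.
apply: (@cvg_dist_bound _ _ _ _ _ _ _ 0 _ (@lam_zhat_lim v (pe a) dv)).
by apply: filterS (pe_zsum_small a dv e0) => m; rewrite subr0.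
Qed.
Lemma rmu_pe_zhat v a : delta v < 1 -> rmu (pe a) (zhat v) = 0.
Proof.
move=> dv; apply: (@norm_eps0 _ _ _ 1) => // e e0; rewrite mul1r -[rmu _ _]subr0.
apply: (@cvg_dist_bound _ _ _ _ _ _ _ 0 _ (@rmu_zhat_lim v (pe a) dv)).
apply: filterS (pe_zsum_small (bar a) dv e0) => m; rewrite subr0.
by rewrite -(norm_star (zsum v m # _)) pstar_mul star_zsum pstar_pe.
Qed.

Lemma lam_pv_zhat v w : delta v < 1 -> lam (pv w) (zhat v) = if w == v then zhat v else 0.
Proof.
move=> dv; apply: (cvg_uniq _ (@lam_zhat_lim v (pv w) dv)).
have e m : pv w # zsum v m = if w == v then zsum v m else 0.
  by rewrite -pv_zsum -pmulA pv_pv; case: eqP => [->|_]; rewrite ?pmul0.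
under eq_fun => m do rewrite e.
case: eqP => _; first exact: zhatP.
by rewrite (lin0 li); apply: cvg_cst.
Qed.
Lemma rmu_pv_zhat v w : delta v < 1 -> rmu (pv w) (zhat v) = if w == v then zhat v else 0.
Proof.
move=> dv; apply: (cvg_uniq _ (@rmu_zhat_lim v (pv w) dv)).
have e m : zsum v m # pv w = if w == v then zsum v m else 0.
  by rewrite -{1}zsum_pv pmulA pv_pv [v == w]eq_sym; case: eqP => _; rewrite ?pmulx0 ?zsum_pv.
under eq_fun => m do rewrite e.
case: eqP => _; first exact: zhatP.
by rewrite (lin0 li); apply: cvg_cst.
Qed.

Lemma lam0 : lam 0 = 0.
Proof.
apply: iota_bounded_eq; [exact: lam_bounded|exact: bounded_op0|] => x.
by rewrite lamE pmul0 (lin0 li).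
Qed.
Lemma rmu0 : rmu 0 = 0.
Proof.
apply: iota_bounded_eq; [exact: rmu_bounded|exact: bounded_op0|] => x.
by rewrite rmuE pmulx0 (lin0 li).
Qed.

(** Right multiplication by [pe a # x] applies [rmu (pe a)] first, which kills zhat; only vertices
    contribute to the scalar. *)
Lemma rmu_zhat_ex v x : delta v < 1 -> exists c : C, rmu x (zhat v) = c *: zhat v.
Proof.
move=> dv; move: x; apply: pa_ind => [|c x y [k ek] [l el]|w|a x _].
- by exists 0; rewrite scale0r rmu0.
- by exists (c * k + l); rewrite rmu_lin !fctE ek el scalerA scalerDl.
- rewrite rmu_pv_zhat //; case: eqP => _; first by exists 1; rewrite scale1r.
  by exists 0; rewrite scale0r.
- exists 0; rewrite rmuM /= rmu_pe_zhat // (lin0 (bounded_lin (rmu_bounded _))) scale0r //.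
Qed.

Lemma ip_zhat_star v y : delta v < 1 -> ip (zhat v) (iota (star y)) = ip (iota y) (zhat v).
Proof.
move=> dv; apply/subr0_eq/(@norm_eps0 _ _ _ 2) => // e e0.
have [m [h1 h2]] : exists m, `|ip (zhat v) (iota (star y)) - ip (iota (zsum v m)) (iota (star y))| < e /\
    `|ip (zhat v) (iota y) - ip (iota (zsum v m)) (iota y)| < e.
  apply: (@filter_ex _ \oo); apply: filterI; apply: (@ip_cvg_near _ _ _ \oo _ (fun m => iota (zsum v m)) _ _ _ (zhatP dv) e0).
have e1 : ip (iota (zsum v m)) (iota (star y)) = (ip (iota (zsum v m)) (iota y))^*.
  by rewrite !ip_iota -{1}(@star_zsum R G P v m) pip_star pipC.
rewrite [ip (iota y) _]ipC -(subrKA (ip (iota (zsum v m)) (iota (star y)))).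
rewrite {2}e1 -rmorphB (le_trans (ler_normD _ _)) // mulr_natl mulr2n lerD ?(ltW h1) //.
by rewrite norm_conjC distrC ltW.
Qed.

Local Notation mu2 v := ((mu v ^+ 2)%:C : C).
Lemma mu2_gt0 v : 0 < mu2 v. Proof. by rewrite ltcR exprn_gt0 // mu_gt0. Qed.
Lemma mu2_neq0 v : mu2 v != 0. Proof. by rewrite gt_eqF // mu2_gt0. Qed.

Lemma pip_zsum_cn v m n : pip (zsum v m) (cn v n) = if (n < m)%N then (- deltaC v) ^+ n * mu2 v else 0.
Proof.
rewrite pip_suml; case: ltnP => nm.
  rewrite (bigD1 (Ordinal nm)) //= big1 ?addr0.
    by rewrite pipZl pip_cn eqxx mulrA -exprMn mulN1r.
  move=> i ni; rewrite pipZl pip_cn; case: eqP => [e|_]; last by rewrite mulr0.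
  by case/eqP: ni; apply: val_inj.
rewrite big1 // => i _; rewrite pipZl pip_cn; case: eqP => [e|_]; last by rewrite mulr0.
by have := ltn_ord i; rewrite e ltnNge nm.
Qed.

Lemma ip_zhat_cn v n : delta v < 1 -> ip (zhat v) (iota (cn v n)) = (- deltaC v) ^+ n * mu2 v.
Proof.
move=> dv; apply: (ip_cvg_eq _ (zhatP dv)); exists n.+1 => // m /= nm.
by rewrite ip_iota pip_zsum_cn nm.
Qed.

Lemma ip_zhat_pv v h : delta v < 1 -> ip (zhat v) (lam (pv v) h) = ip (zhat v) h.
Proof. by move=> dv; rewrite -(pstar_pv P v) -(lam_adjoint (pv v)) lam_pv_zhat // eqxx. Qed.

Lemma ip_zhat_pvN v w h : delta v < 1 -> w != v -> ip (zhat v) (lam (pv w) h) = 0.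
Proof.
by move=> dv /negPf n; rewrite -(pstar_pv P w) -(lam_adjoint (pv w)) lam_pv_zhat // n ip0l.
Qed.

Lemma ip_zhat_Om v : delta v < 1 -> ip (zhat v) Om = mu2 v.
Proof.
move=> dv; rewrite -(ip_zhat_pv Om dv) lam_Om.
by rewrite (ip_zhat_cn 0 dv) mul1r.
Qed.

Lemma ip_zhat_orth v w : delta v < 1 -> delta w < 1 -> w != v -> ip (zhat v) (zhat w) = 0.
Proof.
move=> dv dw n; have := lam_pv_zhat w dw; rewrite eqxx => <-.
exact: ip_zhat_pvN.
Qed.

(** The c_{2n} are orthogonal of square norm delta^n mu^2, which gives a geometric series; it is
    reached through the pairings of zhat with its partial sums. *)
Lemma ip_zhat v : delta v < 1 -> ip (zhat v) (zhat v) = mu2 v / (1 - deltaC v).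
Proof.
move=> dv; have r1 := rr_lt1 dv; have r0 := rr_ge0 v.
have d1 : 0 < 1 - deltaC v by rewrite subr_gt0 ltcR.
apply/subr0_eq/(@norm_eps0 _ _ _ 2) => // e e0.
have s1 : Num.sqrt (delta v) < 1 by rewrite -ltcR; apply: rr_lt1.
have e1 : 0 < e / (mu2 v / (1 - deltaC v)) by rewrite !divr_gt0 // mu2_gt0.
have [m [h1 h2]] : exists m, `|ip (zhat v) (zhat v) - ip (iota (zsum v m)) (zhat v)| < e /\
    (rr v) ^+ m < e / (mu2 v / (1 - deltaC v)).
  apply: (@filter_ex _ \oo); apply: filterI; last exact: pow_small (sqrtr_ge0 _) s1 _ e1.
  exact: (@ip_cvg_near _ _ _ \oo _ (fun m => iota (zsum v m)) _ _ _ (zhatP dv) e0).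
have E : ip (iota (zsum v m)) (zhat v) = mu2 v / (1 - deltaC v) * (1 - deltaC v ^+ m).
  rewrite ipC (_ : ip (zhat v) _ = mu2 v / (1 - deltaC v) * (1 - deltaC v ^+ m)).
    by rewrite /deltaC -[1 in LHS]/(1%:C) -!(rmorphXn, rmorphB, fmorphV, rmorphM) /= conjcR.
  rewrite (lin_sum li) ip_sumr.
  under eq_bigr => n _ do rewrite (linZ li) ipZr ip_zhat_cn // rmorphXn rmorphN rmorph1 mulrA -exprMn mulrNN mul1r.
  rewrite -mulr_suml; apply: (@mulfI _ (1 - deltaC v)); first by rewrite gt_eqF.
  rewrite mulrA (_ : (1 - deltaC v) * \sum_(n < m) deltaC v ^+ n = 1 - deltaC v ^+ m); last first.
    elim: (m) => [|k IH]; first by rewrite big_ord0 mulr0 expr0 subrr.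
    by rewrite big_ord_recr mulrDr IH exprS /=; ring.
  by field; rewrite gt_eqF.
rewrite -(subrKA (ip (iota (zsum v m)) (zhat v))) (le_trans (ler_normD _ _)) // mulr_natl mulr2n lerD ?(ltW h1) //.
rewrite E mulrBr mulr1 addrAC subrr add0r normrN ger0_norm; last first.
  by rewrite mulr_ge0 ?exprn_ge0 ?lecR ?delta_ge0 // divr_ge0 ?(ltW d1) // ltW // mu2_gt0.
move: h2 => /ltW; rewrite ler_pdivlMr ?divr_gt0 ?mu2_gt0 // => h2.
apply: le_trans h2; rewrite mulrC ler_wpM2r //; first by rewrite divr_ge0 ?(ltW d1) // ltW // mu2_gt0.
rewrite -rr_sqr -exprM mul2n -addnn exprD ler_piMr ?exprn_ge0 // exprn_ile1 // ltW //.
Qed.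

Lemma rmu_zhatE v y : delta v < 1 -> rmu y (zhat v) = (ip (iota y) (zhat v) / mu2 v) *: zhat v.
Proof.
move=> dv; have [c ec] := rmu_zhat_ex y dv; rewrite ec; congr (_ *: _).
apply: (mulIf (mu2_neq0 v)); rewrite divfK ?mu2_neq0 // -(ip_zhat_Om dv) -ipZl -ec.
by rewrite (rmu_adjoint y) rmu_Om ip_zhat_star.
Qed.

(** On y in F(G), left multiplication of y by the partial sum is [rmu y] applied to the partial sum,
    which tends to a multiple of zhat. The uniform bound of [zsum_mul_norm] extends this to all of
    [H]: convergence of vectors becomes strong convergence of operators. *)
Lemma lam_zsum_cvg v h : delta v < 1 ->
  (fun m => lam (zsum v m) h) @ \oo --> (ip h (zhat v) / mu2 v) *: zhat v.
Proof.
move=> dv; have [K K0 hK] := zsum_mul_norm dv.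
have hK' m k : `|lam (zsum v m) k| <= K * `|k|.
  apply: iota_norm_le => // [|y]; first exact: lam_bounded.
  by rewrite lamE.
pose B (k : H) := (ip k (zhat v) / mu2 v) *: zhat v.
pose M := `|zhat v| / mu2 v * `|zhat v|.
have M0 : 0 <= M by rewrite mulr_ge0 // divr_ge0 // ltW // mu2_gt0.
have hB k : `|B k| <= M * `|k|.
  rewrite /B normrZ normf_div (ger0_norm (ltW (mu2_gt0 v))) /M.
  rewrite [leRHS]mulrAC ler_wpM2r // [leRHS]mulrAC ler_wpM2r ?invr_ge0 ?(ltW (mu2_gt0 v)) //.
  by rewrite mulrC cauchy_schwarz.
apply/cvgrPdist_lt => e e0.
have c0 : 0 < K + M + 1 by rewrite ltr_wpDl // addr_ge0.
have e1 : 0 < e / 2 / (K + M + 1) by rewrite !divr_gt0.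
have [_ [y _ <-] hy] := dense_approx h di e1.
have e2 : 0 < e / 2 by rewrite divr_gt0.
have lim := @rmu_zhat_lim v y dv; rewrite rmu_zhatE // -/(B (iota y)) in lim.
move/cvgrPdist_lt: lim => /(_ _ e2); apply: filterS => m hm.
rewrite -/(B h).
have -> : B h - lam (zsum v m) h = B (h - iota y) - lam (zsum v m) (h - iota y) + (B (iota y) - iota (zsum v m # y)).
  rewrite -lamE (linB (bounded_lin (lam_bounded _))) /B ipBl mulrBl scalerBl.
  by rewrite opprB !addrA [RHS](ACl (1*4*(2*5)*(3*6)))/= addNr subrr !addr0.
rewrite (le_lt_trans (ler_normD _ _)) // [ltRHS](splitr e) ler_ltD //.
rewrite (le_trans (ler_normB _ _)) // (le_trans (lerD (hB _) (hK' _ _))) //.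
rewrite -mulrDl addrC; move: hy => /ltW; rewrite ler_pdivlMr // mulrC => hy.
apply: le_trans hy; rewrite ler_wpM2r // addrC lerDl //.
Qed.
(** * Tracial vectors *)

Lemma iota0_norm x : pip x x = 0 -> iota x = 0.
Proof. by rewrite -norm_iota => /eqP; rewrite sqrf_eq0 normr_eq0 => /eqP. Qed.

(** Replace [xi] by an element of F(G), to which the sequence is eventually orthogonal; the uniform
    bound controls the error. *)
Lemma weakly_null (u : nat -> P) (K : C) xi (e : C) : (forall i, `|iota (u i)| <= K) ->
  (forall y, exists N, forall i, (N <= i)%N -> pip y (u i) = 0) -> 0 < e ->
  \forall i \near \oo, `|ip (iota (u i)) xi| <= e.
Proof.
move=> hK hu e0.
have K0 : 0 <= K by apply: le_trans (hK 0).
have K1 : 0 < K + 1 by rewrite ltr_wpDl.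
have e1 : 0 < e / (K + 1) by rewrite divr_gt0.
have [_ [y _ <-] hy] := dense_approx xi di e1.
have [N hN] := hu y; exists N => // i /= Ni.
have -> : ip (iota (u i)) xi = ip (iota (u i)) (xi - iota y).
  by rewrite ipBr ip_iota [pip (u i) y]pipC hN // conjC0 subr0.
apply: (le_trans (cauchy_schwarz _ _)).
apply: (@le_trans _ _ (K * (e / (K + 1)))); first by apply: ler_pM => //; exact: ltW.
by rewrite mulrCA ger_pMr // ler_pdivrMr // mul1r lerDl.
Qed.

Definition tracial (xi : H) := forall x y, ip (iota (x # y)) xi = ip (iota (y # x)) xi.

Section TracialVector.
Variable xi : H.
Hypothesis cxi : tracial xi.
Local Notation phi x := (ip (iota x) xi).

Lemma phi_lin c x y : phi (c *: x + y) = c * phi x + phi y.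
Proof. by rewrite li ipDl ipZl. Qed.
Lemma phiZ c x : phi (c *: x) = c * phi x.
Proof. by rewrite (linZ li) ipZl. Qed.
Lemma phiD x y : phi (x + y) = phi x + phi y.
Proof. by rewrite (linD li) ipDl. Qed.
Lemma phiB x y : phi (x - y) = phi x - phi y.
Proof. by rewrite (linB li) ipBl. Qed.
Lemma phi0 : phi 0 = 0. Proof. by rewrite (lin0 li) ip0l. Qed.

Lemma phi_c2 v x : pv v # x = x -> x # pv v = x ->
  phi (cupl v x) + phi (capl v x) = phi (cupr v x) + phi (capr v x).
Proof.
move=> px xp; apply/esym/subr0_eq; rewrite -!phiD -phiB -mul_c2 // phiB.
by rewrite cxi subrr.
Qed.

(** Loops at v orthogonal to the trivial path and to the range of [cupl v]. Stated through
    orthogonality, the conditions are seen to be stable under [cupr] and [capr] by passing to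
    adjoints. *)
Definition capfree v z := [/\ pv v # z = z, z # pv v = z,
  (forall x, pip z (cupl v x) = 0) & pip z (pv v) = 0].

Lemma capfree_capl v z : capfree v z -> phi (capl v z) = 0.
Proof.
move=> [_ _ h _]; suff -> : iota (capl v z) = 0 by rewrite ip0l.
by apply: iota0_norm; rewrite capl_adjoint h.
Qed.

(** The correction term of [capr_cupl] is a multiple of the trivial path; orthogonality to that path
    disposes of it. *)
Lemma capfree_cupr v z : capfree v z -> capfree v (cupr v z).
Proof.
move=> [h1 h2 h3 h4]; split.
- by rewrite cupr_pvl h1.
- exact: cupr_pvr.
- by move=> x; rewrite cupr_adjoint capr_cupl addrC pip_linr h4 mulr0 add0r h3.
- by rewrite cupr_adjoint capr_pv0 pip0r.
Qed.

Lemma capfree_capr v z : capfree v z -> capfree v (capr v z).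
Proof.
move=> [h1 h2 h3 h4]; split.
- by rewrite capr_pvl h1.
- exact: capr_pvr.
- by move=> x; rewrite capr_adjoint -cupl_cupr h3.
- by rewrite capr_adjoint cupr_pv0 h3.
Qed.

Lemma iter_cupl_lin v i : linear (iter i (cupl v)).
Proof.
elim: i => [|i IH]; first by move=> c y z.
exact: lin_comp (@cupl_lin R G P v) IH.
Qed.

Lemma iter_cupl_cupr v i x : iter i (cupl v) (cupr v x) = cupr v (iter i (cupl v) x).
Proof. by elim: i => //= i ->; rewrite cupl_cupr. Qed.

Lemma loop_cupl v x : pv v # x = x -> x # pv v = x ->
  pv v # cupl v x = cupl v x /\ cupl v x # pv v = cupl v x.
Proof. by move=> h1 h2; rewrite cupl_pvl -cupl_pvr h2. Qed.
Lemma loop_cupr v x : pv v # x = x -> x # pv v = x ->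
  pv v # cupr v x = cupr v x /\ cupr v x # pv v = cupr v x.
Proof. by move=> h1 h2; rewrite cupr_pvr cupr_pvl h1. Qed.
Lemma loop_iter_cupl v i x : pv v # x = x -> x # pv v = x ->
  pv v # iter i (cupl v) x = iter i (cupl v) x /\ iter i (cupl v) x # pv v = iter i (cupl v) x.
Proof. by move=> h1 h2; elim: i => //= i [e1 e2]; apply: loop_cupl. Qed.
Lemma loop_iter_cupr v i x : pv v # x = x -> x # pv v = x ->
  pv v # iter i (cupr v) x = iter i (cupr v) x /\ iter i (cupr v) x # pv v = iter i (cupr v) x.
Proof. by move=> h1 h2; elim: i => //= i [e1 e2]; apply: loop_cupr. Qed.

Lemma norm_iter_cupl v i x : `|iota (iter i (cupl v) x)| <= rr v ^+ i * `|iota x|.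
Proof.
elim: i => [|i IH]; first by rewrite mul1r.
by rewrite iterS (le_trans (norm_cupl _ _)) // exprS -mulrA ler_wpM2l // rr_ge0.
Qed.
Lemma norm_iter_cupr v i x : `|iota (iter i (cupr v) x)| <= rr v ^+ i * `|iota x|.
Proof.
elim: i => [|i IH]; first by rewrite mul1r.
rewrite iterS /cupr norm_star (le_trans (norm_cupl _ _)) // exprS -mulrA ler_wpM2l ?rr_ge0 //.
by rewrite norm_star.
Qed.

Lemma pip_iter_cupl v i x y : pip y (iter i (cupl v) x) = pip (iter i (capl v) y) x.
Proof. by elim: i y => //= i IH y; rewrite -capl_adjoint IH -iterSr. Qed.

(* With U_i = cupl^i (cupr^i z) and Z_i = cupl^i (cupr^(i+2) z), applying
   phi_c2 to cupl^i (cupr^(i+1) z) gives phi U_(i+1) - phi Z_i = delta^(i+1) phi z,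
   although U_i and Z_i, divided by delta^i, are bounded and weakly null. *)
Lemma phi_capfree v z : 0 < delta v -> capfree v z -> phi z = 0.
Proof.
move=> dv kz; have [h1 h2 _ _] := kz.
pose U i := iter i (cupl v) (iter i (cupr v) z).
pose Z i := iter i (cupl v) (iter i.+2 (cupr v) z).
have step i : phi (U i.+1) - phi (Z i) =
    deltaC v * phi (U i) - phi (capl v (iter i (cupl v) (iter i.+1 (cupr v) z))).
  set W := iter i (cupl v) (iter i.+1 (cupr v) z).
  have WE : W = cupr v (U i) by rewrite /W iterS iter_cupl_cupr.
  have [p1 p2] := loop_iter_cupr i.+1 h1 h2; have [p3 p4] := loop_iter_cupl i p1 p2.
  have [q1 q2] := loop_iter_cupr i h1 h2; have [q3 q4] := loop_iter_cupl i q1 q2.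
  have r := phi_c2 p3 p4; rewrite -/W in r.
  have e2 : cupr v W = Z i by rewrite /W /Z [in RHS]iterS iter_cupl_cupr.
  have e3 : capr v W = deltaC v *: U i by rewrite WE capr_cupr q4.
  rewrite e2 e3 phiZ in r.
  have e1 : cupl v W = U i.+1 by [].
  rewrite e1 in r; apply/eqP; rewrite subr_eq addrAC eq_sym subr_eq eq_sym r addrC //.
(* In [step] at i + 1 the cap removes one cup and leaves delta times Z i, so the left side at i + 1
   is delta times the left side at i. *)
have E i : phi (U i.+1) - phi (Z i) = deltaC v ^+ i.+1 * phi z.
  elim: i => [|i IH]; rewrite step.
    by rewrite /= capfree_capl; [rewrite expr1 subr0|exact: capfree_cupr].
  have [p1 p2] := loop_iter_cupr i.+2 h1 h2; have [t1 t2] := loop_iter_cupl i p1 p2.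
  by rewrite iterS capl_cupl t1 phiZ -mulrBr IH mulrA -exprS.
have r0 := rr_ge0 v.
have rp : 0 < rr v by rewrite ltcR sqrtr_gt0.
have dp : deltaC v != 0 by rewrite -rr_sqr expf_neq0 // gt_eqF.
(* U (i + 1) and Z i both arise from z by 2 i + 2 cups of norm at most sqrt (delta v), so division
   by delta^(i+1) keeps them bounded. *)
pose u i := (deltaC v ^+ i.+1)^-1 *: U i.+1.
pose w i := (deltaC v ^+ i.+1)^-1 *: Z i.
have nd i : `|(deltaC v ^+ i.+1)^-1| = (rr v ^+ (i.+1 + i.+1))^-1.
  by rewrite normfV normrX ger0_norm ?lecR ?delta_ge0 // -rr_sqr -exprM mul2n addnn.
have nu i : `|iota (u i)| <= `|iota z|.
  rewrite (linZ li) normrZ nd mulrC ler_pdivrMr ?exprn_gt0 // mulrC.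
  apply: (le_trans (norm_iter_cupl _ _ _)); rewrite exprD -mulrA ler_wpM2l ?exprn_ge0 //.
  exact: norm_iter_cupr.
have nw i : `|iota (w i)| <= `|iota z|.
  rewrite (linZ li) normrZ nd mulrC ler_pdivrMr ?exprn_gt0 // mulrC.
  rewrite addSnnS; apply: (le_trans (norm_iter_cupl _ _ _)); rewrite exprD -mulrA ler_wpM2l ?exprn_ge0 //.
  exact: norm_iter_cupr.
have eu y : exists N, forall i, (N <= i)%N -> pip y (u i) = 0.
  have [N hN] := capl_nilpotent v y; exists N => i Ni.
  by rewrite /u /U pipZr pip_iter_cupl hN ?pip0l ?mulr0 // (leq_trans Ni).
have ew y : exists N, forall i, (N <= i)%N -> pip y (w i) = 0.
  have [N hN] := capl_nilpotent v y; exists N => i Ni.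
  by rewrite /w /Z pipZr pip_iter_cupl hN ?pip0l ?mulr0.
apply: (@norm_eps0 _ _ _ 2) => // e e0.
have [i [h3 h4]] : exists i, `|phi (u i)| <= e /\ `|phi (w i)| <= e.
  by apply: (@filter_ex _ \oo); apply: filterI; apply: weakly_null => //; eauto.
have -> : phi z = phi (u i) - phi (w i).
  rewrite /u /w !phiZ -mulrBr E mulKf // expf_neq0 //.
by rewrite (le_trans (ler_normB _ _)) // mulr_natl mulr2n lerD.
Qed.

Lemma iter_capfree_pv v j z : capfree v z -> pip (iter j (cupl v) z) (pv v) = 0.
Proof.
move=> [_ _ _ h4]; case: j => [//|j].
by rewrite iterS cupl_adjoint capl_pv0 pip0r.
Qed.

Lemma capr_iter_cupl v j z : capfree v z ->
  capr v (iter j (cupl v) z) = iter j (cupl v) (capr v z).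
Proof.
move=> kz; elim: j => // j IH; rewrite iterS capr_cupl IH [X in _ = X]iterS.
suff -> : tr (pv v # iter j (cupl v) z) = 0 by rewrite mul0r mulr0 scale0r addr0.
have [h1 h2 _ _] := kz; have [-> e2] := loop_iter_cupl j h1 h2.
have := iter_capfree_pv j kz; rewrite /pip pstar_pv ptr_mulC e2 //.
Qed.

(** Solve [phi_c2] at cupl^j z for the term cupl^(j+1) z. The right cup and cap commute down to
    capfree vectors, and the left cap lowers j, so the other three terms vanish by strong induction
    on j. *)
Lemma phi_iter_capfree v : 0 < delta v -> forall j z, capfree v z -> phi (iter j (cupl v) z) = 0.
Proof.
move=> dv j; elim: j {-2}j (leqnn j) => [|n IH] [|j] //= jn z kz; try exact: phi_capfree dv kz.
have [h1 h2 _ _] := kz; have [e1 e2] := loop_iter_cupl j h1 h2.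
have r := phi_c2 e1 e2.
have r1 : phi (cupr v (iter j (cupl v) z)) = 0.
  by rewrite -iter_cupl_cupr IH //; apply: capfree_cupr.
have r2 : phi (capr v (iter j (cupl v) z)) = 0.
  by rewrite capr_iter_cupl // IH //; apply: capfree_capr.
have r3 : phi (capl v (iter j (cupl v) z)) = 0.
  case: j jn e1 e2 {r r1 r2} => [|j] jn e1 e2; first exact: capfree_capl.
  have [e3 e4] := loop_iter_cupl j h1 h2.
  by rewrite iterS capl_cupl e3 phiZ IH ?mulr0 // ltnW.
by move: r; rewrite r1 r2 r3 !addr0.
Qed.

(* The coefficient of a path in the projection onto the span of the cn v n:
   0 unless it is a concatenation of cups at v. *)
Fixpoint cupcoef v (s : seq E) : C :=
  match s with
  | [::] => 1
  | a :: s' => if s' is d :: t then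
      if d == bar a then wt a / deltaC v * cupcoef v t else 0 else 0
  end.

(** A loop that does not begin with a cup is capfree; one that does is a multiple of a cup on a
    shorter loop up to a capfree vector, which [phi_iter_capfree] discards. Iterating leaves a
    multiple of a c_{2n}, or 0. *)
Lemma phi_loop v : 0 < delta v -> forall s j, walk v s -> wend v s = v ->
  phi (iter j (cupl v) (b v s)) = cupcoef v s * phi (cn v (j + (size s)./2)).
Proof.
move=> dv s; have [n sn] := ubnP (size s); elim: n s sn => // n IH s sn j ws ev.
have il := iter_cupl_lin v j.
have dn : deltaC v != 0 by rewrite -rr_sqr expf_neq0 // gt_eqF // ltcR sqrtr_gt0.
case: s sn ws ev => [|a s] sn ws ev; first by rewrite /= mul1r addn0.
have kf : capl v (b v (a :: s)) = 0 -> phi (iter j (cupl v) (b v (a :: s))) = 0.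
  move=> c0; apply: phi_iter_capfree => //; split.
  - by rewrite mul_pv eqxx.
  - by rewrite mul_pvr ev eqxx.
  - by move=> x; rewrite -capl_adjoint c0 pip0l.
  - by rewrite pip_bs //= andbF.
have cE : capl v (b v (a :: s)) = if s is d :: t then if d == bar a then wt a *: b v t else 0 else 0.
  exact: capl_bs.
case: s sn ws ev kf cE => [|d t] sn ws ev kf cE; first by rewrite kf //= mul0r.
rewrite /=; have [ed|nd] := eqVneq d (bar a); last by rewrite kf ?mul0r // cE (negPf nd).
subst d; rewrite eqxx in cE; move: (ws) => /= /and3P [/eqP sa /eqP sd wt'].
have dd : dst (bar a) = v by rewrite dst_bar.
rewrite dd in wt'; have ev' : wend v t = v by move: ev; rewrite /wend /= dd.
(* The coefficient is chosen so that [capl v z] is 0: the cap of the path is wt a times t, that of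
   the cup on t is delta times t. *)
pose z := b v [:: a, bar a & t] - (wt a / deltaC v) *: cupl v (b v t).
have kz : capfree v z.
  split.
  - by rewrite pmulBr pmulZr cupl_pvl mul_pv eqxx.
  - by rewrite pmulBl pmulZl -cupl_pvr !mul_pvr ev ev' eqxx.
  - move=> x; rewrite -capl_adjoint (linB (@capl_lin R G P v)) (linZ (@capl_lin R G P v)).
    by rewrite cE capl_cupl mul_pv eqxx scalerA divfK // subrr pip0l.
  - rewrite /z -scaleNr addrC pip_linl cupl_adjoint capl_pv0 pip0r mulr0 add0r.
    exact: pip_pv_loop.
have := phi_iter_capfree dv j kz; rewrite /z (linB il) (linZ il) phiB phiZ => /subr0_eq ->.
rewrite -iterSr IH //; last by move: sn => /=; lia.
by rewrite mulrA addSnnS.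
Qed.

Lemma phi_nonloop v s : walk v s -> wend v s != v -> phi (b v s) = 0.
Proof.
move=> ws /negPf ne; have := cxi (pv v) (b v s); rewrite mul_pv eqxx => ->.
by rewrite mul_pvr ne phi0.
Qed.

Lemma tracial_eq0 : (forall v, 0 < delta v) -> (forall v n, phi (cn v n) = 0) -> xi = 0.
Proof.
move=> dv h; apply: iota_ip0; apply: (@pspan _ _ P) => [|c x y ex ey|v s ws].
- exact: phi0.
- by rewrite phi_lin ex ey mulr0 addr0.
have [e|ne] := eqVneq (wend v s) v; last exact: phi_nonloop.
by have := phi_loop (dv v) 0 ws e => /= ->; rewrite h mulr0.
Qed.

(** With this normalization the value on (a bar a)^n is wt a ^ n times [alpha], so delta disappears
    from the relations along edges. *)
Definition alpha v n : C := phi (cn v n) / deltaC v ^+ n.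

Fixpoint zigzag a n : seq E := if n is m.+1 then [:: a, bar a & zigzag a m] else [::].

Lemma walk_zigzag a n : walk (src a) (zigzag a n).
Proof. by elim: n => //= n IH; rewrite src_bar dst_bar !eqxx. Qed.
Lemma wend_zigzag a n : wend (src a) (zigzag a n) = src a.
Proof. by elim: n => //= n IH; rewrite /wend /= dst_bar. Qed.
Lemma size_zigzag a n : (size (zigzag a n))./2 = n.
Proof. by elim: n => //= n ->. Qed.
Lemma zigzag_shift a n : a :: zigzag (bar a) n = rcons (zigzag a n) a.
Proof. by elim: n => //= n IH; rewrite barK -IH. Qed.
Lemma cupcoef_zigzag a n : cupcoef (src a) (zigzag a n) = (wt a / deltaC (src a)) ^+ n.
Proof. by elim: n => //= n ->; rewrite eqxx exprS. Qed.

Lemma phi_zigzag a n : 0 < delta (src a) -> phi (b (src a) (zigzag a n)) = wt a ^+ n * alpha (src a) n.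
Proof.
move=> dv; have := phi_loop dv 0 (walk_zigzag a n) (wend_zigzag a n) => /= ->.
by rewrite add0n size_zigzag cupcoef_zigzag /alpha exprMn exprVn -mulrA [_^-1 * _]mulrC.
Qed.

Lemma wt_neq0 a : wt a != 0 :> C.
Proof.
by rewrite /wt eq_complex /= eqxx andbT mulf_neq0 // ?invr_neq0 ?muneq0.
Qed.

(** Traciality for the edge [bar a] and a path s from src a to dst a, which closes up on either
    side. All relations among the [alpha] come from s = a, a (bar a a)^n and a (c bar c)^n. *)
Lemma phi_edge a s : walk (src a) s -> wend (src a) s = dst a ->
  phi (b (dst a) (bar a :: s)) +
    phi (if s is c :: t then if c == a then wt (bar a) *: b (dst c) t else 0 else 0) =
  phi (b (src a) (rcons s (bar a))) +
    phi (if rev s is c :: t then if c == a then wt a *: b (src a) (rev t) else 0 else 0).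
Proof.
move=> ws es; have := cxi (pe (bar a)) (b (src a) s).
rewrite mul_pe mul_per // dst_bar src_bar eqxx es eqxx !phiD barK.
have -> : (if rev s is d :: t then if bar a == bar d then wt d *: b (src a) (rev t) else 0 else 0) =
  (if rev s is c :: t then if c == a then wt a *: b (src a) (rev t) else 0 else 0).
  case: (rev s) => // d t; rewrite (inj_eq (inv_inj (@barK R G))) eq_sym.
  by case: eqP => // ->.
by [].
Qed.

Hypothesis dpos : forall v, 0 < delta v.

Lemma alpha01 a : (alpha (dst a) 0 + alpha (dst a) 1) / (mu (dst a) ^+ 2)%:C =
   (alpha (src a) 0 + alpha (src a) 1) / (mu (src a) ^+ 2)%:C.
Proof.
have := @phi_edge a [:: a]; rewrite /= !eqxx => /(_ isT erefl).
have e1 : phi (b (dst a) [:: bar a; a]) = wt (bar a) * alpha (dst a) 1.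
  have := phi_zigzag (a := bar a) 1; rewrite src_bar /= barK expr1; exact.
have e2 : phi (b (src a) [:: a; bar a]) = wt a * alpha (src a) 1.
  by have := phi_zigzag (a := a) 1; rewrite /= expr1; exact.
have e0 v : phi (b v [::]) = alpha v 0 by rewrite /alpha expr0 divr1.
rewrite e1 (_ : rev [::] = [::]) // !phiZ !e0 e2 -!mulrDr => h.
have m0 : (mu (dst a))%:C != 0 :> C by rewrite eq_complex /= eqxx andbT muneq0.
have m1 : (mu (src a))%:C != 0 :> C by rewrite eq_complex /= eqxx andbT muneq0.
move: h; rewrite /wt src_bar dst_bar !rmorphM !fmorphV /= => h.
have -> : alpha (dst a) 0 + alpha (dst a) 1 =
  ((mu (dst a))%:C / (mu (src a))%:C) * ((mu (src a))%:C / (mu (dst a))%:C * (alpha (dst a) 1 + alpha (dst a) 0)).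
  by field; rewrite m0.
by rewrite h; field; rewrite m0 m1.
Qed.

Definition altern v := forall n, (0 < n)%N -> alpha v n.+1 + alpha v n = 0.

(** For s = a (bar a a)^n, [phi_edge] equates wt(bar a)^(n+1) (alpha_{n+1} + alpha_n) at dst a with
    wt(a)^(n+1) (alpha_{n+1} + alpha_n) at src a. *)
Lemma altern_edge a : altern (src a) -> altern (dst a).
Proof.
move=> h n n0; have dd := dpos (dst a).
have := @phi_edge a (a :: zigzag (bar a) n).
have w1 : walk (src a) (a :: zigzag (bar a) n).
  by rewrite /= eqxx /=; have := walk_zigzag (bar a) n; rewrite src_bar.
have w2 : wend (src a) (a :: zigzag (bar a) n) = dst a.
  by rewrite zigzag_shift wend_rcons.
move=> /(_ w1 w2); rewrite eqxx.
rewrite [X in rcons X _]zigzag_shift [in RHS]zigzag_shift rev_rcons eqxx revK.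
have -> : rcons (rcons (zigzag a n) a) (bar a) = zigzag a n.+1.
  by rewrite -zigzag_shift rcons_cons -{1}(barK a) -zigzag_shift barK.
have -> : bar a :: a :: zigzag (bar a) n = zigzag (bar a) n.+1 by rewrite /= barK.
have pz := phi_zigzag (a := bar a); rewrite src_bar in pz.
rewrite !phiZ (pz n dd) (pz n.+1 dd) (phi_zigzag n (dpos (src a))) (phi_zigzag n.+1 (dpos (src a))).
move: (wt_neq0 (bar a)) (wt a) => /negPf w0 wa.
have key (w x y : C) : w ^+ n.+1 * x + w * (w ^+ n * y) = w ^+ n.+1 * (x + y) by rewrite exprS; ring.
move: (h n n0) w0; move: (wt (bar a)) (alpha (src a) n) (alpha (src a) n.+1).
move: (alpha (dst a) n) (alpha (dst a) n.+1) => x x' wb y y' e w0.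
rewrite (key wb) (key wa) e mulr0 => /eqP.
by rewrite mulf_eq0 expf_eq0 w0 andbF /= => /eqP.
Qed.

(** For s = a (c bar c)^n the product s # bar a is not a concatenation of cups and nothing cancels
    in it, so its value is 0; the product bar a # s gives a nonzero multiple of alpha_{n+1} +
    alpha_n. *)
Lemma altern_start a c : dst a = src c -> c != bar a -> altern (src c).
Proof.
move=> ac nc n n0.
have := @phi_edge a (a :: zigzag c n).
have w1 : walk (src a) (a :: zigzag c n) by rewrite /= eqxx ac walk_zigzag.
have w2 : wend (src a) (a :: zigzag c n) = dst a by rewrite /wend /= ac -/(wend _ _) wend_zigzag.
move=> /(_ w1 w2); rewrite eqxx.
have e1 : phi (b (src a) (rcons (a :: zigzag c n) (bar a))) = 0.
  have w3 : walk (src a) (rcons (a :: zigzag c n) (bar a)) by rewrite walk_rcons w1 w2 src_bar eqxx.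
  have := phi_loop (dpos _) 0 w3; rewrite wend_rcons dst_bar => /(_ erefl) /= ->.
  (* For n = 0 the path would be the cup a, bar a; for n > 0 its second edge is c, which differs
     from [bar a]. *)
  by case: n n0 {w1 w2 w3} => // n _ /=; rewrite (negPf nc) mul0r.
have e2 : phi (if rev (a :: zigzag c n) is c0 :: t then if c0 == a then wt a *: b (src a) (rev t) else 0 else 0) = 0.
  case: n n0 {w1 w2 e1} => // n _.
  have -> : rev (a :: zigzag c n.+1) = bar c :: rev (a :: zigzag c n ++ [:: c]).
    have -> : a :: zigzag c n.+1 = rcons (a :: zigzag c n ++ [:: c]) (bar c).
      by rewrite -cats1 /= -catA /= ; congr (_ :: _); elim: (n) => //= k <-.
    by rewrite rev_rcons.
  by rewrite eq_sym bar_eqC (negPf nc) phi0.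
rewrite e1 e2 addr0.
have -> : phi (b (dst a) (bar a :: a :: zigzag c n)) = wt (bar a) * wt c ^+ n * alpha (src c) n.+1.
  have w4 : walk (dst a) (bar a :: a :: zigzag c n) by rewrite /= src_bar dst_bar ac !eqxx walk_zigzag.
  have := phi_loop (dpos _) 0 w4.
  have -> : wend (dst a) (bar a :: a :: zigzag c n) = dst a by rewrite /wend /= ac -/(wend _ _) wend_zigzag.
  move=> /(_ erefl) /= ->; rewrite barK eqxx size_zigzag ac cupcoef_zigzag /alpha exprMn exprVn exprS.
  have dn : deltaC (src c) != 0 by rewrite eq_complex /= eqxx andbT gt_eqF // dpos.
  rewrite -[cupl _ (cn _ n)]/(cn (src c) n.+1).
  rewrite invfM; move: (deltaC _)^-1 (_ ^+ n)^-1 (phi _) => D D' X; ring.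
rewrite phiZ ac phi_zigzag // -mulrA -mulrDr => /eqP.
rewrite -mulrDr.
by rewrite !mulf_eq0 expf_eq0 !(negPf (wt_neq0 _)) andbF /= => /eqP.
Qed.
End TracialVector.
Hypothesis gc : graph_connected G.
Hypothesis ne : (2 <= nedges G)%N.

Lemma tracial_lincomb c (x y : H) : tracial x -> tracial y -> tracial (c *: x + y).
Proof. by move=> cx cy u v; rewrite !ipDr !ipZr cx cy. Qed.

Lemma tracial_Om : tracial Om.
Proof. by move=> x y; rewrite /Om !ip_iota !pip_one ptr_mulC. Qed.

Lemma tracial_zhat v : delta v < 1 -> tracial (zhat v).
Proof.
move=> dv.
suff e x y : ip (iota (x # y)) (zhat v) = ip (iota y) (zhat v) / mu2 v * ip (iota x) (zhat v).
  by move=> x y; rewrite !e; move: (ip (iota x) _) (ip (iota y) _) (_^-1) => p q r; ring.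
rewrite -rmuE (rmu_adjoint y) rmu_zhatE // ipZr rmorphM fmorphV /=.
by rewrite /= -(ip_zhat_star (star y) dv) pstarK -ipC [X in X^-1]conjcR.
Qed.

(** * Tracial vectors are combinations of 1 and the zhat *)

Section CenterForm.
Variable xi : H.
Hypothesis cxi : tracial xi.
Let dpos := delta_gt0 ne gc.

Lemma altern_all v : altern xi v.
Proof.
have [a [c [ac nc]]] := turn_exists ne gc.
apply: (@connected_ind R G gc (altern xi) _ (src c)); last exact: (altern_start cxi dpos ac nc).
by move=> d; apply: (altern_edge cxi dpos).
Qed.

Lemma alpha_succ v n : alpha xi v n.+1 = (-1) ^+ n * alpha xi v 1.
Proof.
elim: n => [|n IH]; first by rewrite mul1r.
by apply/eqP; rewrite exprS mulN1r mulNr -IH -addr_eq0 altern_all.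
Qed.

Lemma deltaC_neq0 v : deltaC v != 0 :> C.
Proof. by rewrite eq_complex /= eqxx andbT gt_eqF // dpos. Qed.

Lemma ip_cnE v n : ip (iota (cn v n)) xi = alpha xi v n * deltaC v ^+ n.
Proof. by rewrite /alpha divfK // expf_neq0 // deltaC_neq0. Qed.

(** The vectors c_{2n} divided by delta^(n/2) are bounded and weakly null, whereas by [alpha_succ]
    their pairings with [xi] have modulus |alpha_1| delta^(n/2) >= |alpha_1|. *)
Lemma alpha1_eq0 v : 1 <= delta v -> alpha xi v 1 = 0.
Proof.
move=> dv; have r1 : 1 <= rr v.
  by rewrite -(ler_pXn2r (ltn0Sn 1)) ?nnegrE ?rr_ge0 // rr_sqr expr1n lecR.
have r0 : 0 < rr v by apply: lt_le_trans r1.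
have mp : 0 <= (mu v)%:C by rewrite lecR ltW // mu_gt0.
pose u i := (rr v ^+ i.+1)^-1 *: cn v i.+1.
have nu i : `|iota (u i)| <= (mu v)%:C.
  rewrite /u (linZ li) normrZ norm_cn normfV normrX (ger0_norm (rr_ge0 v)).
  by rewrite mulKf // expf_neq0 // gt_eqF.
have hu y : exists N, forall i, (N <= i)%N -> pip y (u i) = 0.
  have [N hN] := capl_nilpotent v y; exists N => i Ni.
  by rewrite /u pipZr /cn pip_iter_cupl hN ?pip0l ?mulr0 // ltnW.
apply: (@norm_eps0 _ _ _ 1) => // e e0; rewrite mul1r.
have [i hi] : exists i, `|ip (iota (u i)) xi| <= e.
  by apply: (@filter_ex _ \oo); apply: weakly_null nu hu e0.
apply: le_trans hi; rewrite /u (linZ li) ipZl ip_cnE (alpha_succ v i) -rr_sqr -exprM mul2n -addnn exprD.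
move: (alpha xi v 1) => al; rewrite !normrM normfV !normrX normrN1 expr1n mul1r (ger0_norm (rr_ge0 v)).
rewrite mulrCA mulKf ?expf_neq0 ?gt_eqF //.
by rewrite ler_peMr // exprn_ege1.
Qed.

Lemma alpha01_const v w : (alpha xi v 0 + alpha xi v 1) / mu2 v =
  (alpha xi w 0 + alpha xi w 1) / mu2 w.
Proof.
apply: (@connected_ind R G gc (fun v => (alpha xi v 0 + alpha xi v 1) / mu2 v = _) _ w) => //.
by move=> a <-; apply: (alpha01 cxi dpos).
Qed.

Lemma ip_cn_Om v n : ip (iota (cn v n)) Om = if n == 0%N then mu2 v else 0.
Proof.
rewrite ip_iota pip_one; have := pip_cn P v n 0.
rewrite /cn [iter 0 _ _]/= /pip pstar_pv -/(cn v n) pv_cn => ->.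
by case: n => [|n] //=; rewrite mul1r.
Qed.

Lemma ip_cn_zhat v n w : delta w < 1 -> ip (iota (cn v n)) (zhat w) =
  if w == v then (- deltaC v) ^+ n * mu2 v else 0.
Proof.
move=> dw; rewrite ipC; case: eqP => [<-|/eqP nw].
  by rewrite ip_zhat_cn // /deltaC -[(mu w ^+ 2)%:C]/((mu w ^+ 2)%:C) -rmorphN -rmorphXn -rmorphM conjcR.
by rewrite -pv_cn -lamE ip_zhat_pvN ?conjC0 // eq_sym.
Qed.

Lemma center_form : exists (be : C) (ka : {v | delta v < 1} -> C),
  xi = be *: Om + \sum_i ka i *: zhat (val i).
Proof.
have [a _] := two_edges_neq ne; pose v0 := src a.
(* Against zhat_v the sequence alternates in sign, which fixes its coefficient by alpha_1; the rest
   of alpha_0 comes from 1. The conjugates arise because the form is conjugate-linear in [xi]. *)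
pose B := (alpha xi v0 0 + alpha xi v0 1) / mu2 v0.
pose ka (i : {v | delta v < 1}) := (- (alpha xi (val i) 1 / mu2 (val i)))^*.
exists B^*, ka; apply/subr0_eq/tracial_eq0 => [|v|v n].
- rewrite -scaleN1r addrC; apply: tracial_lincomb => //; apply: tracial_lincomb; first exact: tracial_Om.
  elim/big_ind: _ => [x y|x y cx cy|i _]; first by rewrite !ip0r.
    by rewrite -[x]scale1r; apply: tracial_lincomb.
  by rewrite -[_ *: _]addr0; apply: tracial_lincomb; [apply: tracial_zhat (valP i)|move=> x y; rewrite !ip0r].
- exact: dpos.
rewrite ipBr ipDr ipZr conjCK ip_cn_Om ip_cnE ip_sumr.
have m0 : mu2 v != 0 := mu2_neq0 v.
have BE : alpha xi v 0 = B * mu2 v - alpha xi v 1.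
  by rewrite /B (alpha01_const v0 v) divfK // addrK.
have sE : \sum_i ip (iota (cn v n)) (ka i *: zhat (val i)) =
    - (alpha xi v 1) * (- deltaC v) ^+ n.
  have [dv|dv] := boolP (delta v < 1).
    rewrite (bigD1 (exist _ v dv)) //= big1 ?addr0.
      rewrite ipZr conjCK ip_cn_zhat //= eqxx; move: (alpha _ _ _) => al.
      by move: (_ ^+ n) m0 => D; move: (mu2 v) => m m0; field.
    move=> i ni; rewrite ipZr ip_cn_zhat ?(valP i) //; case: eqP => [e|_]; last by rewrite mulr0.
    by case/eqP: ni; apply: val_inj.
  rewrite alpha1_eq0 ?leNgt // oppr0 mul0r big1 // => i _.
  rewrite ipZr ip_cn_zhat ?(valP i) //; case: eqP => [e|_]; last by rewrite mulr0.
  by move: dv; rewrite -e (valP i).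
rewrite sE; case: n {sE} => [|n]; first by rewrite /= BE; move: (alpha _ _ _) => al; ring.
rewrite (alpha_succ v n) /= mulr0 add0r [(- deltaC v) ^+ _]exprNn; move: (alpha _ _ _) => al; rewrite !exprS; ring.
Qed.
End CenterForm.

(** * The decomposition of M(G) *)

(* This is e_v^I, see ev_lim. *)
Definition ev v (h : H) : H := (ip h (zhat v) / ip (zhat v) (zhat v)) *: zhat v.

Section Ev.
Variable v : V.
Hypothesis dv : delta v < 1.

Lemma ip_zhat_neq0 : ip (zhat v) (zhat v) != 0.
Proof.
by rewrite ip_zhat // mulf_neq0 ?mu2_neq0 // invr_neq0 // subr_eq0 eq_sym lt_eqF // ltcR.
Qed.

Lemma ev_bounded : bounded_op (ev v).
Proof.
apply/bounded_opP; split=> [c x y|].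
  by rewrite /ev ipDl ipZl mulrDl scalerDl scalerA mulrA.
exists (`|zhat v| / `|ip (zhat v) (zhat v)| * `|zhat v| + 1); split.
  by rewrite ltr_wpDl // mulr_ge0 // divr_ge0.
move=> x; rewrite /ev normrZ normf_div mulrDl mul1r ler_wpDr //.
rewrite [leRHS]mulrAC ler_wpM2r // [leRHS]mulrAC ler_wpM2r ?invr_ge0 //.
by rewrite mulrC cauchy_schwarz.
Qed.

Lemma ev_adjoint : is_adjoint (ev v) (ev v).
Proof.
move=> x y; rewrite /ev ipZl ipZr rmorphM fmorphV /= -!ipC mulrAC [RHS]mulrAC.
by congr (_ * _); rewrite mulrC.
Qed.

Lemma ev_zhat : ev v (zhat v) = zhat v.
Proof. by rewrite /ev divff ?ip_zhat_neq0 // scale1r. Qed.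

Lemma ev_commute T T' : bounded_op T -> is_adjoint T T' ->
  (exists c, T (zhat v) = c *: zhat v) -> (exists c, T' (zhat v) = c *: zhat v) ->
  forall h, T (ev v h) = ev v (T h).
Proof.
move=> bT aT [c ec] [d ed] h; rewrite /ev (linZ (bounded_lin bT)) ec scalerA aT ed ipZr.
have -> : d^* = c.
  apply: (mulIf ip_zhat_neq0); rewrite -ipZr -ed -aT ec ipZl //.
by congr (_ *: _); rewrite mulrC mulrA.
Qed.

Lemma lam_zhat_ex x : exists c : C, lam x (zhat v) = c *: zhat v.
Proof.
move: x; apply: pa_ind => [|c x y [k ek] [l el]|w|a x [k ek]].
- by exists 0; rewrite scale0r lam0.
- by exists (c * k + l); rewrite lam_lin !fctE ek el scalerA scalerDl.
- rewrite lam_pv_zhat //; case: eqP => _; first by exists 1; rewrite scale1r.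
  by exists 0; rewrite scale0r.
- exists 0; rewrite lamM /= ek (linZ (bounded_lin (lam_bounded _))) lam_pe_zhat // scaler0 scale0r //.
Qed.

Lemma lam_zsum_cvg_ev h :
  (fun m => (1 - deltaC v) *: lam (zsum v m) h) @ \oo --> ev v h.
Proof.
have -> : ev v h = (1 - deltaC v) *: ((ip h (zhat v) / mu2 v) *: zhat v).
  rewrite /ev scalerA ip_zhat // invf_div; congr (_ *: _).
  by rewrite mulrCA mulrA.
by apply: cvgZr; apply: lam_zsum_cvg.
Qed.

(** [lam x] and its adjoint preserve the line of zhat, hence commute with the projection onto it. *)
Lemma ev_Lset : commutant Lset (ev v).
Proof.
split=> [|_ [x _ <-]]; first exact: ev_bounded.
apply/funext => h /=; apply/esym/(ev_commute (lam_bounded x) (lam_adjoint x)); exact: lam_zhat_ex.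
Qed.

(** A strong limit of multiples of [lam (zsum v m)] commutes with everything that commutes with the
    [lam x]. *)
Lemma ev_MG : MG (ev v).
Proof.
apply/commutantP; first exact: commutant_bounded.
split=> [|X h cX]; first exact: ev_bounded.
have bX := commutant_bounded cX.
have l1 : X \o (fun m => (1 - deltaC v) *: lam (zsum v m) h) @ \oo --> X (ev v h).
  by apply: bounded_cvg => //; apply: lam_zsum_cvg_ev.
apply: (cvg_uniq _ _ l1); have := @lam_zsum_cvg_ev (X h).
suff <- : (fun m => (1 - deltaC v) *: lam (zsum v m) (X h)) =
   X \o (fun m => (1 - deltaC v) *: lam (zsum v m) h) by [].
apply/funext => m /=; rewrite (linZ (bounded_lin bX)); congr (_ *: _).
by rewrite (commutantE _ cX) //; exists (zsum v m).
Qed.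

Lemma MG_ev T h : MG T -> T (ev v h) = ev v (T h).
Proof. by move=> mT; apply: (commutantE _ mT); apply: ev_Lset. Qed.

Lemma MG_zhat T : MG T -> T (zhat v) = (ip (T (zhat v)) (zhat v) / ip (zhat v) (zhat v)) *: zhat v.
Proof. by move=> mT; rewrite -{1}ev_zhat MG_ev. Qed.
End Ev.

(** * The central projection onto the complement of the vectors zhat *)

Local Notation I := {v | delta v < 1}.
Definition pc (h : H) : H := h - \sum_(i : I) ev (val i) h.

Lemma ev_lin (i : I) : linear (ev (val i)). Proof. exact: bounded_lin (ev_bounded _). Qed.

Lemma ev_zhatI (i j : I) : ev (val i) (zhat (val j)) = if i == j then zhat (val j) else 0.
Proof.
case: eqP => [->|/eqP n]; first exact: ev_zhat (valP j).
by rewrite /ev ip_zhat_orth ?(valP i, valP j) ?mul0r ?scale0r // (inj_eq val_inj).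
Qed.

Lemma pcE : pc = idfun - \sum_(i : I) ev (val i).
Proof. by apply/funext => h; rewrite /pc !fctE fct_sumE. Qed.

Lemma sum_ev_MG (J : pred I) (c : I -> C) : MG (\sum_(i | J i) c i *: ev (val i)).
Proof.
elim/big_ind: _ => [|S T mS mT|i _].
- apply/commutantP; [exact: commutant_bounded|split; [exact: bounded_op0|]] => X h cX.
  by rewrite (lin0 (bounded_lin (commutant_bounded cX))).
- by rewrite -[S]scale1r; apply: MG_lincomb.
(* A multiple c e is written (c - 1) e + e, as [MG_lincomb] takes two members and [MG0] is itself
   derived from this lemma. *)
- have := MG_lincomb (c i - 1) (ev_MG (valP i)) (ev_MG (valP i)).
  by rewrite -{2}[ev _]scale1r -scalerDl subrK.
Qed.

Lemma pc_MG : MG pc.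
Proof.
have := MG_lincomb (-1) (sum_ev_MG xpredT (fun=> 1)) MG_id.
by rewrite pcE scaleN1r addrC; under eq_bigr do rewrite scale1r.
Qed.

Lemma pc_lin : linear pc. Proof. exact/bounded_lin/MG_bounded/pc_MG. Qed.

Lemma ev_ev (i j : I) h : ev (val i) (ev (val j) h) = if i == j then ev (val j) h else 0.
Proof.
rewrite {2}/ev (linZ (ev_lin i)) ev_zhatI; case: eqP => // _.
by rewrite scaler0.
Qed.

Lemma ev_pc (i : I) h : ev (val i) (pc h) = 0.
Proof.
rewrite /pc (linB (ev_lin i)) (lin_sum (ev_lin i)) (bigD1 i) //= big1 ?addr0.
  by rewrite ev_ev eqxx subrr.
by move=> j n; rewrite ev_ev eq_sym (negPf n).
Qed.

Lemma pc_idem h : pc (pc h) = pc h.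
Proof. by rewrite {1}/pc big1 ?subr0 // => i _; rewrite ev_pc. Qed.

Lemma pc_zhat (i : I) : pc (zhat (val i)) = 0.
Proof.
rewrite /pc (bigD1 i) //= ev_zhatI eqxx big1 ?addr0 ?subrr // => j n.
by rewrite ev_zhatI (negPf n).
Qed.

Lemma pc_adjoint : is_adjoint pc pc.
Proof.
move=> x y; rewrite /pc ipBl ipBr ip_suml ip_sumr; congr (_ - _); apply: eq_bigr => i _.
exact: (ev_adjoint (val i)).
Qed.

Lemma MG_pc T h : MG T -> T (pc h) = pc (T h).
Proof.
move=> mT; have lT := bounded_lin (MG_bounded mT).
rewrite /pc (linB lT) (lin_sum lT); congr (_ - _); apply: eq_bigr => i _.
by rewrite (MG_ev (valP i)).
Qed.

Lemma ip_Om : ip Om Om = 1.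
Proof.
rewrite /Om ip_iota pip_one (_ : pone = \sum_v pv v) //.
rewrite (big_morph tr (@ptrD R G P) (@ptr0 R G P)).
under eq_bigr => v _ do rewrite ptr_bs //.
by rewrite -rmorph_sum mu_sum.
Qed.

(** For the projection onto the line of zhat this is |<zhat, 1>|^2 / |zhat|^2, that is mu^4 divided
    by mu^2 / (1 - delta). *)
Lemma ip_ev_Om (i : I) : ip (ev (val i) Om) Om = ((1 - delta (val i)) * mu (val i) ^+ 2)%:C.
Proof.
have dv := valP i; have m0 := mu2_neq0 (val i).
have d0 : 1 - deltaC (val i) != 0 by rewrite subr_eq0 eq_sym lt_eqF // ltcR.
rewrite /ev ipZl [ip Om _]ipC ip_zhat_Om // ip_zhat // conjcR; have -> : ((1 - delta (val i)) * mu (val i) ^+ 2)%:C = (1 - deltaC (val i)) * mu2 (val i) by rewrite /deltaC rmorphM rmorphB rmorph1.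
by rewrite invf_div mulrCA divff // mulr1.
Qed.

Lemma ip_pc_Om : ip (pc Om) Om = (1 - \sum_(i : I) (1 - delta (val i)) * @mu R G (val i) ^+ 2)%:C.
Proof.
rewrite /pc ipBl ip_Om ip_suml rmorphB rmorph1 rmorph_sum; congr (_ - _).
by apply: eq_bigr => i _; apply: ip_ev_Om.
Qed.

(** T commutes with left multiplications by centrality and with right ones as a member of M(G), so
    both send T 1 to T (star x). *)
Lemma center_tracial T : MG T -> commutant MG T -> tracial (T Om).
Proof.
move=> mT cT x y; rewrite -lamE (lam_adjoint x) -(commutantE Om cT (MG_lam _)) lam_Om.
by rewrite (MG_iota _ mT) -(rmu_adjoint x) rmuE.
Qed.

Lemma center_pc T : MG T -> commutant MG T -> exists be : C, T \o pc = be *: pc.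
Proof.
move=> mT cT; have [be [ka e]] := center_form (center_tracial mT cT).
exists be; apply: MG_inj => [||]; first exact: MG_comp mT pc_MG.
  by rewrite -[_ *: pc]addr0; apply: MG_lincomb pc_MG _; have := sum_ev_MG xpred0 (fun=> 0); rewrite big_pred0.
rewrite /= (MG_pc _ mT) e pc_lin (lin_sum pc_lin) big1 ?addr0 // => i _.
by rewrite (linZ pc_lin) pc_zhat scaler0.
Qed.

Lemma pc_commutant : commutant MG pc.
Proof.
apply/commutantP; first exact: MG_bounded.
by split=> [|T h mT]; [exact: MG_bounded pc_MG|rewrite (MG_pc h mT)].
Qed.

(** * The II_1 factor on the range of [pc] *)

Definition qc : projection H := Projection (MG_bounded pc_MG) pc_idem pc_adjoint.
Local Notation K := (range_hilbert qc).
Local Notation N := (@corner R H qc MG).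
Local Notation compress := (@compress R H qc).
Local Notation cpr := (@cpr R H qc).
Local Notation emb := (@emb R H qc).
Local Notation dilate := (@dilate R H qc).
Local Notation mC := (1 - \sum_(i : I) (1 - delta (val i)) * @mu R G (val i) ^+ 2).

Lemma qcE h : qc h = pc h. Proof. by []. Qed.
Lemma qc_MG : MG qc. Proof. exact: pc_MG. Qed.
Lemma qc_commutant : commutant MG qc. Proof. exact: pc_commutant. Qed.

Lemma MG0 : MG 0.
Proof. by have := sum_ev_MG xpred0 (fun=> 0); rewrite big_pred0. Qed.

(** The paths (a bar a)^k are pairwise orthogonal and nonzero. *)
Lemma iota_not_span (J : finType) (g : J -> H) : ~ forall x, exists c : J -> C, iota x = \sum_j c j *: g j.
Proof.
have [a _] := two_edges_neq ne => h.
pose u k := b (src a) (zigzag a k).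
have sz k : size (zigzag a k) = k.*2 by elim: k => //= k ->.
have pu k l : ip (iota (u k)) (iota (u l)) = if k == l then mu2 (src a) else 0.
  rewrite ip_iota /u pip_bs ?walk_zigzag // eqxx wend_zigzag /=.
  have -> : (zigzag a k == zigzag a l) = (k == l).
    by apply/eqP/eqP => [/(congr1 size)|-> //]; rewrite !sz => /double_inj.
  by [].
apply: (@orthogonal_not_span R H J (fun k => iota (u k)) g) => [k|k l n|k].
- by rewrite pu eqxx mu2_neq0.
- by rewrite pu (negPf n).
- exact: h.
Qed.

Lemma pc_decomp h : h = pc h + \sum_(i : I) ev (val i) h.
Proof. by rewrite /pc subrK. Qed.

(** Otherwise [pc] is 0, because 1 is separating, and finitely many vectors zhat would span F(G). It
    makes the trace left for the factor positive. *)
Lemma pc_Om_neq0 : pc Om != 0.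
Proof.
apply/eqP => e; have p0 : pc = 0 by apply: (MG_inj pc_MG MG0); rewrite e.
apply: (@iota_not_span I (fun i => zhat (val i))) => x.
exists (fun i => ip (iota x) (zhat (val i)) / ip (zhat (val i)) (zhat (val i))).
by rewrite {1}[iota x]pc_decomp p0 add0r.
Qed.

Lemma mC_gt0 : 0 < mC.
Proof.
rewrite -ltcR -ip_pc_Om -pc_idem pc_adjoint hdot_norm exprn_gt0 // normr_gt0.
exact: pc_Om_neq0.
Qed.

(** The unit vector of p 1, since |p 1|^2 is the trace [mC] of p; its vector state is the normalized
    trace of the corner. *)
Definition wK : K := ((Num.sqrt mC)^-1)%:C *: cpr Om.
Definition tauK (S : K -> K) : C := hdot K (S wK) wK.

Lemma tauKE (S : K -> K) : linear S -> tauK S = mC%:C^-1 * ip (dilate S Om) Om.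
Proof.
move=> lS; rewrite /tauK /wK (linZ lS) ipZl ipZr conjcR mulrA ip_cprr -rmorphM -invfM.
by rewrite -expr2 sqr_sqrtr ?fmorphV // ltW // mC_gt0.
Qed.

Lemma corner_vN : von_neumann N.
Proof. exact: corner_von_neumann MG_von_neumann qc_MG. Qed.

Lemma corner_lin (S : K -> K) : N S -> linear S. Proof. by move=> [/bounded_lin]. Qed.

(** Applied to p 1, finitely many generators of the corner would span all p x for x in F(G);
    together with the vectors zhat they would span F(G). *)
Lemma N_finite_span : ~ finite_dimensional N.
Proof.
move=> [n [g hg]].
pose gg (j : 'I_n + I) : H := match j with inl j => emb (g j (cpr Om)) | inr i => zhat (val i) end.
apply: (@iota_not_span _ gg) => x.
have [c hc] := hg _ (corner_compress MG_von_neumann qc_MG (MG_lam x)).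
exists (fun j => match j with inl j => c j
  | inr i => ip (iota x) (zhat (val i)) / ip (zhat (val i)) (zhat (val i)) end).
rewrite big_sumType {1}[iota x]pc_decomp; congr (_ + _) => //=.
have := congr1 (fun S : K -> K => emb (S (cpr Om))) hc.
rewrite compress_cpr ?lam_Om ?emb_cpr => [/= ->|k]; last exact: MG_pc (MG_lam x).
rewrite fct_sumE (lin_sum (@emb_lin R H qc)); apply: eq_bigr => j _.
by rewrite fctE (linZ (@emb_lin R H qc)).
Qed.

Lemma dilateM_eq0 (S : K -> K) : N S -> dilate S Om = 0 -> S = 0.
Proof.
move=> [bS mS] e; apply: (@dilate_inj _ _ qc).
have -> : dilate (0 : K -> K) = 0 :> (H -> H) by apply/funext => h; exact: (lin0 (@emb_lin R H qc)).
by apply: (MG_inj mS MG0); rewrite e.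
Qed.

Lemma corner_trace : faithful_normal_tracial_state N tauK.
Proof.
have cC : mC%:C != 0 :> C by rewrite eq_complex /= eqxx andbT gt_eqF // mC_gt0.
split.
- by move=> a S T _ _; rewrite /tauK !fctE ipDl ipZl.
- by rewrite tauKE // dilate_id /= ip_pc_Om mulVf.
- move=> T [bT _]; have [_ aT] := adjointP bT.
  by rewrite /tauK /= (is_adjoint_sym aT) ip_ge0.
- move=> T nT; have [bT mT] := nT; have [_ aT] := adjointP bT.
  rewrite /tauK /= (is_adjoint_sym aT) => /ip_eq0; rewrite /wK (linZ (corner_lin nT)) => /eqP.
  rewrite scaler_eq0 eq_complex /= eqxx andbT invr_eq0 sqrtr_eq0 leNgt mC_gt0 /= => /eqP e.
  by apply: dilateM_eq0 => //; rewrite /dilate e (lin0 (@emb_lin R H qc)).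
- move=> S T nS nT; have lS := corner_lin nS; have lT := corner_lin nT.
  have [_ mS] := nS; have [_ mT] := nT.
  rewrite !tauKE; [|by move=> a x y /=; rewrite lS lT|by move=> a x y /=; rewrite lT lS].
  by congr (_ * _); rewrite (dilate_comp S T) (dilate_comp T S); exact: (MG_tracial mS mT).
- apply: vector_state_normal; first exact: vn_bounded corner_vN.
  by rewrite (vn_bicommutant corner_vN).
Qed.

Lemma corner_II1 : II1_factor N tauK.
Proof.
split; [exact: corner_vN| |exact: N_finite_span|exact: corner_trace].
move=> T nT cT; have [bT mT] := nT.
have cT' := corner_center MG_von_neumann qc_MG qc_commutant nT cT.
have [be e] := center_pc mT cT'; exists be.
apply: (@dilate_inj _ _ qc); apply/funext => h; rewrite -(dilate_q T).
have := congr1 (fun f => f h) e; rewrite /= => ->.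
by rewrite fctE /dilate fctE (linZ (@emb_lin R H qc)).
Qed.

(** The character by which M(G) acts on the line of zhat, see [MG_chi]. *)
Definition chi (i : I) (X : H -> H) : C :=
  ip (X (zhat (val i))) (zhat (val i)) / ip (zhat (val i)) (zhat (val i)).
Definition split_MG (X : H -> H) : (K -> K) * (I -> C) := (compress X, fun i => chi i X).

Lemma MG_chi X i : MG X -> X (zhat (val i)) = chi i X *: zhat (val i).
Proof. by move=> mX; rewrite (MG_zhat (valP i) mX). Qed.

Lemma MG_evE X i h : MG X -> X (ev (val i) h) = chi i X *: ev (val i) h.
Proof.
move=> mX; rewrite /ev (linZ (bounded_lin (MG_bounded mX))) (MG_chi i mX).
by rewrite !scalerA mulrC.
Qed.

Lemma zz_neq0 (i : I) : ip (zhat (val i)) (zhat (val i)) != 0.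
Proof. exact: ip_zhat_neq0 (valP i). Qed.

(** Injective because compression and characters determine Z 1 through 1 = p 1 + sum of e_v 1, and 1
    is separating. A preimage of (S, c) is the extension of S by 0 plus the combination of the e_v
    with coefficients c. *)
Lemma split_bij : set_bij MG (fun x : (K -> K) * (I -> C) => N x.1) split_MG.
Proof.
split.
- by move=> X mX; exact: (corner_compress MG_von_neumann qc_MG mX).
- move=> X Y /set_mem mX /set_mem mY [e1 e2]; apply: MG_inj => //.
  have E Z : MG Z -> Z Om = emb (compress Z (cpr Om)) + \sum_(i : I) chi i Z *: ev (val i) Om.
    move=> mZ; rewrite compress_cpr; last by move=> k; apply: MG_pc.
    rewrite emb_cpr {1}[Om]pc_decomp (linD (bounded_lin (MG_bounded mZ))) (MG_pc _ mZ).
    rewrite (lin_sum (bounded_lin (MG_bounded mZ))); congr (_ + _); apply: eq_bigr => i _.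
    exact: MG_evE.
  rewrite (E X mX) (E Y mY) e1; congr (_ + _); apply: eq_bigr => i _.
  by have -> : chi i X = chi i Y by have := congr1 (fun f => f i) e2.
- move=> [S c] /= nS; have [bS mS] := nS.
  pose X := dilate S + \sum_(i : I) c i *: ev (val i).
  exists X; first by rewrite /X -[dilate S]scale1r; apply: MG_lincomb => //; apply: sum_ev_MG.
  have XE h : X h = dilate S h + \sum_(i : I) c i *: ev (val i) h by rewrite /X fctE fct_sumE.
  congr (_, _).
    rewrite -[RHS](compress_dilate S); apply/funext => x; rewrite /compress XE; congr cpr.
    rewrite big1 ?addr0 // => i _; rewrite -q_emb qcE ev_pc scaler0 //.
  apply/funext => i; rewrite /chi XE -(dilate_q S (zhat _)) qcE pc_zhat.
  rewrite /dilate (lin0 (@cpr_lin _ _ qc)) (lin0 (bounded_lin bS)) (lin0 (@emb_lin R H qc)) add0r.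
  rewrite (bigD1 i) //= big1 ?addr0; last by move=> j n; rewrite ev_zhatI (negPf n) scaler0.
  by rewrite ev_zhatI eqxx ipZl mulfK // zz_neq0.
Qed.

Lemma split_iso : @ncps_iso R (op_ncps MG (fun T => ip (T Om) Om))
  (dsum_ncps (op_ncps N tauK) (fun i : I => (1 - delta (val i)) * mu (val i) ^+ 2)) split_MG.
Proof.
split.
- exact: split_bij.
- move=> a X Y mX mY; rewrite /split_MG; congr (_, _); apply/funext => z.
    by rewrite /compress !fctE cpr_lin.
  transitivity (a * chi z X + chi z Y); last by [].
  by rewrite /chi !fctE ipDl ipZl mulrDl mulrA.
- rewrite /split_MG /=; congr (_, _); apply/funext => z; first by rewrite /compress cpr_emb.
  by rewrite /chi divff // zz_neq0.
- move=> X Y mX mY; rewrite /split_MG /=; congr (_, _).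
    exact: compress_comp qc_commutant _ _ mY.
  apply/funext => i; rewrite {1}/chi /= (MG_chi i mY) (linZ (bounded_lin (MG_bounded mX))).
  by rewrite ipZl -mulrA mulrC.
- move=> X mX; have [_ aX] := adjointP (MG_bounded mX); rewrite /split_MG /=; congr (_, _).
    rewrite (adjointE _ (@compress_adjoint _ _ qc _ _ aX)) //.
    exact/compress_bounded/MG_bounded.
  by apply/funext => i; rewrite /chi rmorphM fmorphV /= -!ipC (is_adjoint_sym aX).
- move=> X mX; rewrite /= tauKE; last exact: bounded_lin (@compress_bounded _ _ qc _ (MG_bounded mX)).
  have c0 : mC%:C != 0 :> C by rewrite eq_complex /= eqxx andbT gt_eqF // mC_gt0.
  rewrite mulrA mulfV // mul1r dilate_compress /= (MG_pc _ mX) !pc_idem.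
  rewrite [X in _ = ip X _]pc_decomp ipDl ip_suml; congr (_ + _); apply: eq_bigr => i _.
  by rewrite -(MG_ev (valP i) _ mX) (MG_evE _ _ mX) ipZl ip_ev_Om mulrC.
Qed.

Lemma split_ev (i : I) : split_MG (ev (val i)) = (0, fun j => (j == i)%:R).
Proof.
rewrite /split_MG; congr (_, _); apply/funext => z.
  by rewrite /compress -q_emb qcE ev_pc (lin0 (@cpr_lin _ _ qc)).
rewrite /chi ev_zhatI eq_sym; case: eqP => _; first by rewrite divff ?zz_neq0.
by rewrite ip0l mul0r.
Qed.

Lemma ev_lim v h : delta v < 1 ->
  ev v h = (1 - delta v)%:C *: limn (fun m : nat => \sum_(n < m) (-1) ^+ n *: lam (cn v n) h).
Proof.
move=> dv; have c1 := @lam_zsum_cvg_ev v dv h.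
have e : (fun m : nat => \sum_(n < m) (-1) ^+ n *: lam (cn v n) h) = (fun m => lam (zsum v m) h).
  apply/funext => m; have -> : zsum v m = \sum_(n < m) (-1) ^+ n *: cn v n by [].
  rewrite (lin_sum lam_lin) fct_sumE; apply: eq_bigr => n _.
  by rewrite (linZ lam_lin).
have c2 := @lam_zsum_cvg v h dv; rewrite e (cvg_lim _ c2) //.
have c3 : (fun m => (1 - deltaC v) *: lam (zsum v m) h) @ \oo --> (1 - delta v)%:C *: ((ip h (zhat v) / mu2 v) *: zhat v).
  by rewrite rmorphB; apply: cvgZr.
exact: cvg_uniq _ c1 c3.
Qed.
End Completion.

Lemma cupl_bs (R : realType) (G : graph R) (P : path_algebra G) (v : vertex G) s : walk v s ->
  cupl v (bs P v s) = \sum_(a | src a == v) wt a *: bs P v [:: a, bar a & s].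
Proof. by move=> ws; rewrite /cupl pextE // eqxx. Qed.

(** * The given c_{2n} as iterated cups *)

Section CupWords.
Variables (R : realType) (G : graph R).
Local Notation V := (vertex G).
Local Notation E := (edge G).
Let P := F_path_algebra G.

Lemma sum_tuple_cons (W : nmodType) n (Q : pred E) (f : seq E -> W) :
  \sum_(r : n.+1.-tuple E | all Q r) f r = \sum_(a | Q a) \sum_(t : n.-tuple E | all Q t) f (a :: t).
Proof.
rewrite pair_big (reindex (fun p : E * n.-tuple E => [tuple of p.1 :: p.2])) //=.
exists (fun r : n.+1.-tuple E => (thead r, [tuple of behead r])) => [[a t] _|r _] /=.
  by congr pair; apply: val_inj.
by rewrite -tuple_eta.
Qed.

Lemma walk_cups (v : V) (t : seq E) : all (fun e => src e == v) t ->
  walk v (flatten [seq [:: e; bar e] | e <- t]).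
Proof.
elim: t => //= a t IH /andP [/eqP av h]; rewrite av src_bar dst_bar av !eqxx.
exact: IH.
Qed.

(** Splitting off the first edge of the tuple prepends one cup, that is, applies [cupl] once. *)
Lemma cloopE (v : V) n : cloop v n = @cn R G P v n.
Proof.
elim: n => [|n IH].
  rewrite /cloop (big_pred1 [tuple]) => [|r]; last by rewrite (tuple0 r) /= eqxx.
  by rewrite big_nil scale1r.
transitivity (@cupl R G P v (cloop v n)); last by rewrite IH.
rewrite /cloop.
rewrite (sum_tuple_cons n (fun e => src e == v) (fun r => (\prod_(e <- r) (mu (dst e) / mu v))%:C
    *: bas v (flatten [seq [:: e; bar e] | e <- r]))).
rewrite (lin_sum (@cupl_lin R G P v)) exchange_big; apply: eq_bigr => t ht.
have ct : @cupl R G P v (bas v (flatten [seq [:: e; bar e] | e <- t])) =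
    \sum_(a | src a == v) wt a *: bas v [:: a, bar a & flatten [seq [:: e; bar e] | e <- t]].
  exact: (@cupl_bs R G P v _ (walk_cups ht)).
rewrite (linZ (@cupl_lin R G P v)) ct scaler_sumr.
apply: eq_bigr => a /eqP av; rewrite big_cons scalerA rmorphM mulrC.
by rewrite /wt av.
Qed.
End CupWords.

Theorem theorem21 (R : realType) (G : graph R)
    (G_connected : graph_connected G) (two_edges : (2 <= nedges G)%N)
    (H : hilbert R) (iota : {linear F G -> H})
    (H_completion : hilbert_completion iota) :
  exists (K : hilbert R) (N : set (K -> K)) (tau : (K -> K) -> R[i])
         (Phi : (H -> H) ->
                (K -> K) * ({v : vertex G | delta v < 1} -> R[i])),
    [/\ II1_factor N tau,
        @ncps_iso R
          (op_ncps (MGamma iota) (MGamma_tr iota))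
          (dsum_ncps (op_ncps N tau)
             (fun v : {v : vertex G | delta v < 1} =>
                (1 - delta (val v)) * mu (val v) ^+ 2))
          Phi
      & forall v : {v : vertex G | delta v < 1},
          MGamma iota (eI iota (val v)) /\
          Phi (eI iota (val v)) = (0, fun w => (w == v)%:R)].
Proof.
case: H_completion => iso dns.
pose P := F_path_algebra G; pose io : P -> H := iota.
have li : linear io by move=> c x y; apply: linearP.
have ipio : forall x y : P, hdot H (io x) (io y) = pip x y := iso.
have one : Fone G = pone P.
  by apply: eq_bigr => v _; rewrite /pv /= (bas_path (isT : walk v [::])).
have trE : MGamma_tr iota = fun T => hdot H (T (Om io)) (Om io).
  by apply/funext => T; rewrite /MGamma_tr one.
have clE : @cloop R G = @cn R G P by apply/funext => v; apply/funext => n; apply: cloopE.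
(* Convertible: [lam] has the body of [lambda], with the product of [F_path_algebra] being
   [Fmul]. *)
have laE : lambda iota = lam io by [].
have eE (v : {v : vertex G | delta v < 1}) : eI iota (val v) = ev io (val v).
  by rewrite /eI clE laE; apply/funext => h; rewrite (ev_lim li ipio dns h (valP v)).
exists (range_hilbert (qc li ipio dns)), (corner (MG io)), (@tauK R G P H io li ipio dns).
exists (@split_MG R G P H io li ipio dns); split.
- exact: corner_II1 li ipio dns G_connected two_edges.
- rewrite trE; exact: split_iso li ipio dns two_edges.
- move=> v; rewrite eE; split; first exact: ev_MG li ipio dns _ (valP v).
  exact: split_ev.
Qed.
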